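(* Let $1<p\le q<\infty$, $\omega\in\mathcal{D}$, $\upsilon$ a positive Borel measure on $\mathbb{D}$, $\varphi,\psi\in S(\mathbb{D})$ and $u_0,u_1\in H(\mathbb{D})$. If $u_0C_\varphi+u_1D^{(1)}_\psi:A^p_\omega\to L^q_\upsilon$ is bounded, then $$\|u_0C_\varphi+u_1D^{(1)}_\psi\|_{e,A^p_\omega\to L^q_\upsilon}\approx\|u_0C_\varphi\|_{e,A^p_\omega\to L^q_\upsilon}+\|u_1D^{(1)}_\psi\|_{e,A^p_\omega\to L^q_\upsilon}.$$
   Context: $\mathbb{D}$ is the open unit disc, $dA$ the normalized area measure, $H(\mathbb{D})$ the analytic functions on $\mathbb{D}$, $S(\mathbb{D})$ the analytic self-maps of $\mathbb{D}$. For $u\in H(\mathbb{D})$, $\varphi\in S(\mathbb{D})$: $uC_\varphi f=u\,(f\circ\varphi)$ and $uD^{(1)}_\varphi f=u\,(f'\circ\varphi)$. A radial weight is a nonnegative $\omega\in L^1([0,1])$ extended by $\omega(z)=\omega(|z|)$; set $\hat\omega(r)=\int_r^1\omega(t)\,dt$, and assume $\hat\omega(r)>0$ for all $r<1$. $\hat{\mathcal{D}}$ is the class of radial weights with $\hat\omega(r)\le C\hat\omega(\frac{1+r}{2})$ for all $0\le r<1$ and some $C\ge1$; $\mathcal{D}$ is the class of $\omega\in\hat{\mathcal{D}}$ for which additionally there are $K>1$, $C>1$ with $\hat\omega(r)\ge C\hat\omega(1-\frac{1-r}{K})$ for all $0\le r<1$. $A^p_\omega$ is the space of $f\in H(\mathbb{D})$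 with $\|f\|^p_{A^p_\omega}=\int_{\mathbb{D}}|f|^p\omega\,dA<\infty$. $L^q_\upsilon=L^q(\mathbb{D},\upsilon)$. The essential norm of a bounded operator $T:X\to Y$ is $\|T\|_{e,X\to Y}=\inf\{\|T-K\|_{X\to Y}:K:X\to Y\text{ compact}\}$. $A\approx B$ means two-sided inequality with constants independent of $u_0,u_1,\varphi,\psi,\upsilon$. *)

(* Defs.v *)
From HB Require Import structures.
From mathcomp Require Import all_boot all_order all_algebra.
From mathcomp Require Import all_classical all_reals all_analysis.
From mathcomp Require Import complex.
Import Order.TTheory GRing.Theory Num.Theory.
Import numFieldNormedType.Exports.

Set Implicit Arguments.
Unset Strict Implicit.
Unset Printing Implicit Defensive.

Local Open Scope classical_set_scope.
Local Open Scope ring_scope.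

Section Defs.
Variable R : realType.

(* The complex plane C = R[i], viewed as a normed space over itself,
   so that [derivable f z 1] is complex differentiability. *)
Definition Cplx : numClosedFieldType := R[i].

Definition cabs (z : Cplx) : R :=
  Num.sqrt (complex.Re (z : R[i]) ^+ 2 + complex.Im (z : R[i]) ^+ 2).

(* The plane as R x R (Borel product sigma-algebra), identified with C. *)
Definition toC (x : R * R) : Cplx := (x.1 +i* x.2)%C.
Definition rad (x : R * R) : R := Num.sqrt (x.1 ^+ 2 + x.2 ^+ 2).

Definition discC : set Cplx := [set z | cabs z < 1].
Definition discR : set (R * R) := [set x | rad x < 1].

(* Lebesgue (area) measure on R x R; dA = area / pi *)
Definition area := (@lebesgue_measure R \x @lebesgue_measure R)%E.

(* H(D): analytic functions on D (functions C -> C, only values on D matter) *)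
Definition analytic_on_disc (f : Cplx -> Cplx) : Prop :=
  forall z, z \in discC -> derivable f z 1.

Definition self_map (phi : Cplx -> Cplx) : Prop :=
  analytic_on_disc phi /\ forall z, z \in discC -> phi z \in discC.

Definition cderiv (f : Cplx -> Cplx) (z : Cplx) : Cplx := 'D_1 f z.

Definition omega_hat (omega : R -> R) (r : R) : \bar R :=
  (\int[@lebesgue_measure R]_(t in `[r, 1%R]) (omega t)%:E)%E.

Definition radial_weight (omega : R -> R) : Prop :=
  [/\ (forall t, 0 <= t <= 1 -> 0 <= omega t),
      (@lebesgue_measure R).-integrable `[0%R, 1%R] (EFin \o omega) &
      (forall r, 0 <= r < 1 -> (0 < omega_hat omega r)%E)].

Definition hatD (omega : R -> R) : Prop :=
  radial_weight omega /\
  exists C : R, 1 <= C /\ forall r, 0 <= r < 1 ->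
    (omega_hat omega r <= C%:E * omega_hat omega ((1 + r) / 2))%E.

Definition classD (omega : R -> R) : Prop :=
  hatD omega /\
  exists K C : R, [/\ 1 < K, 1 < C & forall r, 0 <= r < 1 ->
    (C%:E * omega_hat omega (1 - (1 - r) / K) <= omega_hat omega r)%E].

Definition Apnorm (p : R) (omega : R -> R) (f : Cplx -> Cplx) : \bar R :=
  ((\int[area]_(x in discR)
      ((pi^-1 * omega (rad x)) * (cabs (f (toC x)) `^ p))%:E) `^ p^-1)%E.

Definition in_Ap (p : R) (omega : R -> R) (f : Cplx -> Cplx) : Prop :=
  analytic_on_disc f /\ (Apnorm p omega f < +oo)%E.

(* elements of L^q_upsilon are represented by functions R x R -> C *)
Definition cmeasurable (g : R * R -> Cplx) : Prop :=
  measurable_fun setT (fun x => complex.Re (g x : R[i])) /\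
  measurable_fun setT (fun x => complex.Im (g x : R[i])).

Definition Lqnorm (q : R) (ups : {measure set (R * R) -> \bar R})
  (g : R * R -> Cplx) : \bar R :=
  Lnorm ups q%:E (fun x => (cabs (g x))%:E).

(* operators A^p_omega -> L^q_upsilon, as maps on representatives *)
Definition operator := (Cplx -> Cplx) -> (R * R -> Cplx).

Definition bounded_op (p q : R) (omega : R -> R)
  (ups : {measure set (R * R) -> \bar R}) (T : operator) : Prop :=
  (forall f, in_Ap p omega f -> cmeasurable (T f)) /\
  exists M : R, forall f, in_Ap p omega f ->
    (Lqnorm q ups (T f) <= M%:E * Apnorm p omega f)%E.

(* compact linear operators A^p_omega -> L^q_upsilon: linear, L^q-valued,
   and the image of the closed unit ball is relatively compact in L^q
   (sequential form: every sequence in the unit ball has a subsequence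
   whose images converge in L^q_upsilon) *)
Definition compact_op (p q : R) (omega : R -> R)
  (ups : {measure set (R * R) -> \bar R}) (K : operator) : Prop :=
  [/\ (forall f g (a b : Cplx), in_Ap p omega f -> in_Ap p omega g ->
        K (fun z => a * f z + b * g z) = (fun x => a * K f x + b * K g x)),
      (forall f, in_Ap p omega f -> cmeasurable (K f)) &
      (forall F : nat -> Cplx -> Cplx,
         (forall n, in_Ap p omega (F n) /\ (Apnorm p omega (F n) <= 1)%E) ->
         exists sigma : nat -> nat, (forall n, (sigma n < sigma n.+1)%N) /\
         exists g : R * R -> Cplx, [/\ cmeasurable g,
           (Lqnorm q ups g < +oo)%E &
           (fun n => Lqnorm q ups (fun x => K (F (sigma n)) x - g x))
             @ \oo --> 0%E])].

Definition opnorm_diff (p q : R) (omega : R -> R)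
  (ups : {measure set (R * R) -> \bar R}) (T K : operator) : \bar R :=
  ereal_sup [set Lqnorm q ups (fun x => T f x - K f x) | f in
              [set f | in_Ap p omega f /\ (Apnorm p omega f <= 1)%E]].

Definition ess_norm (p q : R) (omega : R -> R)
  (ups : {measure set (R * R) -> \bar R}) (T : operator) : \bar R :=
  ereal_inf [set opnorm_diff p q omega ups T K | K in
              [set K | compact_op p q omega ups K]].

Definition wcomp (u phi : Cplx -> Cplx) : operator :=
  fun f x => u (toC x) * f (phi (toC x)).
Definition wdcomp (u phi : Cplx -> Cplx) : operator :=
  fun f x => u (toC x) * cderiv f (phi (toC x)).
Definition op_add (T S : operator) : operator := fun f x => T f x + S f x.

End Defs.

(* Main.v *)
(** The upper estimate is the triangle inequality. For the lower one, let [K] be compact with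
    [||T - K|| <= B], [T = u0 C_phi + u1 D_psi], and let [b_z(w) = (1 - |z|) / (1 - conj z w)].
    Normalized powers of [b_z] tend to [0] weakly as [|z| -> 1], so [K] is negligible on them and
    [T] is [O(B)] there. At a point [x] the values of [T] on three consecutive powers are
    [u0 t^m + v m s^(m-1)] with [t = b_z(phi x)], [s = b_z(psi x)] and a common [v]; eliminating
    [v] bounds [u0 b_z(phi)^m] alone. By a sub-mean value estimate, [|f(w)|^q] is at most an integral
    of [|f(y)|^p omega(y) |b_y(w)|^N] over [|y| >= |w|], up to a factor depending on [|y|], so Tonelli
    gives [int_{|phi| >= r} |u0|^q |f o phi|^q = O(B^q)] uniformly on the unit ball. On [|phi| < r]
    the operator [u0 C_phi] is a norm limit of finite rank operators, obtained by rounding [phi]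
    to a grid. Hence the essential norm of [u0 C_phi] is [O(B)], and so is that of [T - u0 C_phi]. *)

Require Import Defs.
From HB Require Import structures.
From mathcomp Require Import all_boot all_order all_algebra.
From mathcomp Require Import all_classical all_reals all_analysis.
From mathcomp Require Import measurable_realfun complex ring lra.
Import Order.TTheory GRing.Theory Num.Theory.
Import numFieldNormedType.Exports.
Local Open Scope classical_set_scope.
Local Open Scope ring_scope.

Set Implicit Arguments.
Unset Strict Implicit.
Unset Printing Implicit Defensive.

(** * The complex absolute value *)

Section ComplexBasics.
Variable R : realType.
Local Notation C := (Cplx R).
Local Notation Re := (@complex.Re R).
Local Notation Im := (@complex.Im R).
Implicit Types (z w : C) (x y : R).

(** Two obstacles shape the proof: neither summand of [T] is assumed bounded by itself, and
    [upsilon] may fail to be sigma-finite. Testing [T] on the constant 1, which the derivative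
    kills, answers both: [u0] lies in L^q_upsilon, so |u0|^q upsilon is a finite measure. It
    controls the operator on |phi| < r and makes Tonelli available. Powers of a single kernel are
    tested because u0 and v can then be separated with coefficients polynomial in t and s: there is
    no division by t - s, so nothing degenerates where phi and psi almost agree. The two conditions
    on omega have different tasks. Doubling bounds the norms of the kernel powers; with the reverse
    condition it leaves a fixed fraction of the mass in an annulus kept away from the boundary, over
    which the sub-mean value estimate is averaged. The relation p <= q raises |f|^p to |f|^q by
    point evaluation, and p > 1 makes the normalized kernels tend to 0 weakly. Rounding phi makes
    the approximating operators depend on finitely many values of f. *)

Definition ofR (x : R) : C := (x +i* 0)%C.

Lemma cabsE z : ofR (cabs z) = `|z|.
Proof. by case: z. Qed.

Lemma ofR_inj : injective ofR. Proof. by move=> x y []. Qed.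

Lemma ofR_le x y : (ofR x <= ofR y) = (x <= y).
Proof. exact: (@lecR R). Qed.

Lemma ofR_lt x y : (ofR x < ofR y) = (x < y).
Proof. exact: (@ltcR R). Qed.

Lemma ofRD : {morph ofR : x y / x + y}.
Proof. by move=> x y; apply/eqP; rewrite eq_complex /= addr0 !eqxx. Qed.

Lemma ofRM : {morph ofR : x y / x * y}.
Proof.
by move=> x y; apply/eqP; rewrite eq_complex /= !mulr0 mul0r subr0 addr0 !eqxx.
Qed.

Lemma cabs_ge0 z : 0 <= cabs z. Proof. exact: sqrtr_ge0. Qed.

Lemma cabsM z w : cabs (z * w) = cabs z * cabs w.
Proof. by apply: ofR_inj; rewrite ofRM !cabsE normrM. Qed.

Lemma cabsV z : cabs z^-1 = (cabs z)^-1.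
Proof. by case: z => a b; exact: (@ComplexField.Normc.normcV R (Complex a b)). Qed.

Lemma cabsD z w : cabs (z + w) <= cabs z + cabs w.
Proof. by rewrite -ofR_le ofRD !cabsE ler_normD. Qed.

Lemma cabsN z : cabs (- z) = cabs z.
Proof. by apply: ofR_inj; rewrite !cabsE normrN. Qed.

Lemma cabsB z w : cabs (z - w) <= cabs z + cabs w.
Proof. by rewrite (le_trans (cabsD _ _)) // cabsN. Qed.

Lemma cabs_distC z w : cabs (z - w) = cabs (w - z).
Proof. by rewrite -cabsN opprB. Qed.

Lemma cabs_dist z w : cabs z - cabs w <= cabs (z - w).
Proof. by rewrite lerBlDr -[leLHS](congr1 (@cabs R) (subrK w z)) cabsD. Qed.

Lemma cabs0 : cabs (0 : C) = 0.
Proof. by apply: ofR_inj; rewrite cabsE normr0. Qed.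

Lemma cabs1 : cabs (1 : C) = 1.
Proof. by apply: ofR_inj; rewrite cabsE normr1. Qed.

Lemma cabs_eq0 z : (cabs z == 0) = (z == 0).
Proof. by rewrite -(inj_eq ofR_inj) cabsE normr_eq0. Qed.

Lemma cabs_gt0 z : (0 < cabs z) = (z != 0).
Proof. by rewrite lt_neqAle cabs_ge0 andbT eq_sym cabs_eq0. Qed.

Lemma cabsX z n : cabs (z ^+ n) = cabs z ^+ n.
Proof. by elim: n => [|n IH]; rewrite ?expr0 ?cabs1 // !exprS cabsM IH. Qed.

Lemma cabs_ofR x : cabs (ofR x) = `|x|.
Proof. by rewrite /cabs /= expr0n addr0 sqrtr_sqr. Qed.

Lemma Re_le_cabs z : `|Re z| <= cabs z.
Proof. by rewrite /cabs -sqrtr_sqr ler_wsqrtr // lerDl sqr_ge0. Qed.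

Lemma Im_le_cabs z : `|Im z| <= cabs z.
Proof. by rewrite /cabs -sqrtr_sqr ler_wsqrtr // lerDr sqr_ge0. Qed.

Lemma cabs_leD z : cabs z <= `|Re z| + `|Im z|.
Proof.
rewrite /cabs -[leRHS]ger0_norm ?addr_ge0 // -sqrtr_sqr ler_wsqrtr //.
rewrite sqrrD !real_normK ?num_real // lerD2r lerDl.
by rewrite mulrn_wge0 // mulr_ge0.
Qed.

Lemma cabs_sqr z : cabs z ^+ 2 = Re z ^+ 2 + Im z ^+ 2.
Proof. by rewrite sqr_sqrtr // addr_ge0 ?sqr_ge0. Qed.

Lemma ReD z w : Re (z + w) = Re z + Re w. Proof. by case: z; case: w. Qed.
Lemma ImD z w : Im (z + w) = Im z + Im w. Proof. by case: z; case: w. Qed.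
Lemma ReN z : Re (- z) = - Re z. Proof. by case: z. Qed.
Lemma ImN z : Im (- z) = - Im z. Proof. by case: z. Qed.
Lemma ReM z w : Re (z * w) = Re z * Re w - Im z * Im w.
Proof. by case: z; case: w. Qed.
Lemma ImM z w : Im (z * w) = Re z * Im w + Im z * Re w.
Proof. by case: z; case: w. Qed.

Lemma Cplx_eq z w : Re z = Re w -> Im z = Im w -> z = w.
Proof. by case: z w => a b [c d] /= -> ->. Qed.

Definition conj z : C := (Re z +i* - Im z)%C.

Lemma cabs_conj z : cabs (conj z) = cabs z.
Proof. by rewrite /cabs /= sqrrN. Qed.

Lemma mul_conj z : z * conj z = ofR (cabs z ^+ 2).
Proof.
rewrite cabs_sqr; apply: Cplx_eq; rewrite ?ReM ?ImM /=; first by rewrite mulrN opprK -!expr2.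
by rewrite mulrN addrC mulrC subrr.
Qed.

Lemma conjM z w : conj (z * w) = conj z * conj w.
Proof. by apply: Cplx_eq; rewrite /= ?ReM ?ImM /=; ring. Qed.

Lemma conjB z w : conj (z - w) = conj z - conj w.
Proof. by apply: Cplx_eq; rewrite ?ReD ?ImD ?ReN ?ImN /= ?ReD ?ImD ?ReN ?ImN ?opprD. Qed.

Lemma Re_conj z : Re (conj z) = Re z. Proof. by []. Qed.

(** Radius and error are real, so that estimates run in [R] through [cabs]; the norm of [C] takes
    its values in [C]. *)
Definition has_cderiv (f : C -> C) z (d : C) := forall e : R, 0 < e ->
  exists2 r : R, 0 < r &
    forall h : C, cabs h < r -> cabs (f (z + h) - f z - d * h) <= e * cabs h.

Lemma derivable_has_cderiv (f : C -> C) z :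
  derivable f z 1 -> has_cderiv f z (cderiv f z).
Proof.
move=> df e e0.
have /cvgrPdist_le/(_ (ofR e)) := df.
have e0' : 0 < ofR e by rewrite ofR_lt.
move=> /(_ e0'); rewrite /dnbhs near_withinE.
move=> /nbhs_ballP[r /= r0 H].
(* The radius supplied by the neighbourhood is a complex number; being positive, it is real. *)
have rr : r = ofR (Re r).
  by apply: Cplx_eq => //=; move: r0; rewrite ltcE => /andP[/eqP].
have r0' : 0 < Re r by rewrite -ofR_lt -rr.
exists (Re r) => // h hr.
have [->|h0] := eqVneq h 0; first by rewrite mulr0 subr0 addr0 subrr cabs0 mulr0.
have /H/(_ h0) : ball (0 : C) r h.
  by rewrite -ball_normE /= sub0r normrN -cabsE rr ofR_lt.
rewrite -cabsE ofR_le /= scaler1 -/(cderiv f z) => Hh.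
rewrite cabs_distC.
rewrite [X in cabs X](_ : _ = ((cderiv f z) - h^-1 *: (f (h + z) - f z)) * h).
  by rewrite cabsM ler_wpM2r ?cabs_ge0.
rewrite [_ *: _](_ : _ = h^-1 * (f (h + z) - f z)) //.
by rewrite mulrBl mulrAC mulVf // mul1r [h + z]addrC.
Qed.

Lemma derivable_cabs_continuous (f : C -> C) z (e : R) :
  derivable f z 1 -> 0 < e -> exists2 r, 0 < r &
  forall w, cabs (w - z) < r -> cabs (f w - f z) <= e.
Proof.
move=> dfz e0; have [r r0 H] := derivable_has_cderiv dfz ltr01.
pose D := cabs (cderiv f z) + 1; have D0 : 0 < D by rewrite ltr_wpDl // cabs_ge0.
exists (Num.min r (e / D)) => [|w]; first by rewrite lt_min r0 divr_gt0.
rewrite lt_min => /andP[/H wr we]; move: wr; rewrite (addrC z) subrK mul1r => wr.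
rewrite -[X in cabs X](subrK (cderiv f z * (w - z))) (le_trans (cabsD _ _)) //.
rewrite (le_trans (lerD wr (lexx _))) // (cabsM (cderiv f z)) addrC.
by rewrite -[X in _ + X]mul1r -mulrDl -/D mulrC -ler_pdivlMr // ltW.
Qed.

Lemma conjV z : conj z^-1 = (conj z)^-1.
Proof.
by case: z => u v; apply: Cplx_eq; rewrite /= ?sqrrN ?opprK ?mulNr ?opprK.
Qed.

End ComplexBasics.

(** * Cauchy's formula on circles *)

Section Bisection.
Variable R : realType.
Implicit Types (x y e r : R).

Lemma nested_point (u v : nat -> R) :
  (forall n, u n <= u n.+1) -> (forall n, v n.+1 <= v n) ->
  (forall n, u n <= v n) -> exists x, forall n, u n <= x <= v n.
Proof.
move=> uS vS uv.
have u_le m n : (m <= n)%N -> u m <= u n.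
  by move=> /subnK <-; elim: (n - m)%N => // k /le_trans; apply; rewrite addSn.
have v_le m n : (m <= n)%N -> v n <= v m.
  by move=> /subnK <-; elim: (n - m)%N => // k; apply: le_trans; rewrite addSn.
have uvmn m n : u m <= v n.
  rewrite (le_trans (u_le _ (maxn m n) _)) ?leq_maxl //.
  by rewrite (le_trans (uv _)) // v_le // leq_maxr.
have uh : has_sup (range u).
  by split; [exists (u 0%N), 0%N | exists (v 0%N) => _ [m _ <-]].
exists (sup (range u)) => n; apply/andP; split.
  by apply: ub_le_sup; [exact: uh.2 | exists n].
by apply: ge_sup; [exact: uh.1 | move=> _ [m _ <-]].
Qed.

Variable J : R -> R -> R -> R -> R.
Variables a b c d : R.
Hypothesis ab : a <= b.
Hypothesis cd : c <= d.
Hypothesis Jx : forall x1 x2 x3 y1 y2, a <= x1 -> x1 <= x2 -> x2 <= x3 -> x3 <= b ->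
  c <= y1 -> y1 <= y2 -> y2 <= d -> J x1 x3 y1 y2 = J x1 x2 y1 y2 + J x2 x3 y1 y2.
Hypothesis Jy : forall x1 x2 y1 y2 y3, a <= x1 -> x1 <= x2 -> x2 <= b ->
  c <= y1 -> y1 <= y2 -> y2 <= y3 -> y3 <= d -> J x1 x2 y1 y3 = J x1 x2 y1 y2 + J x1 x2 y2 y3.
Hypothesis Jsmall : forall x y e, a <= x <= b -> c <= y <= d -> 0 < e ->
  exists2 r, 0 < r & forall x1 x2 y1 y2, a <= x1 -> x1 <= x -> x <= x2 -> x2 <= b ->
    c <= y1 -> y1 <= y -> y <= y2 -> y2 <= d -> x2 - x1 < r -> y2 - y1 < r ->
    `|J x1 x2 y1 y2| <= e * ((x2 - x1) + (y2 - y1)) ^+ 2.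

(** Goursat's argument for an additive function of rectangles. The four quarters share the bound e
    (sum of sides)^2 equally, so a bad rectangle has a bad quarter; the nested bad rectangles shrink
    to a point, where [Jsmall] is contradicted. *)
Lemma rectangle_function_eq0 : J a b c d = 0.
Proof.
apply/eqP; apply/contraT => J0.
pose L2 : R := (b - a + (d - c)) ^+ 2.
have L20 : 0 <= L2 by exact: sqr_ge0.
(* The [+ 1] makes the initial rectangle strictly bad and keeps the quotient meaningful if it is
   degenerate. *)
pose e := `|J a b c d| / (L2 + 1).
have e0 : 0 < e by rewrite divr_gt0 ?normr_gt0 // ltr_wpDl.
pose rect := (R * R * (R * R))%type.
pose bad (q : rect) := e * (q.1.2 - q.1.1 + (q.2.2 - q.2.1)) ^+ 2 <
  `|J q.1.1 q.1.2 q.2.1 q.2.2|.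
pose mx (q : rect) := (q.1.1 + q.1.2) / 2.
pose my (q : rect) := (q.2.1 + q.2.2) / 2.
pose q1 q : rect := ((q.1.1, mx q), (q.2.1, my q)).
pose q2 q : rect := ((q.1.1, mx q), (my q, q.2.2)).
pose q3 q : rect := ((mx q, q.1.2), (q.2.1, my q)).
pose q4 q : rect := ((mx q, q.1.2), (my q, q.2.2)).
(* The fourth quarter is the default: if the other three are not bad, additivity forces it to be. *)
pose next q := if bad (q1 q) then q1 q else if bad (q2 q) then q2 q else
               if bad (q3 q) then q3 q else q4 q.
pose inside (q : rect) := [/\ a <= q.1.1, q.1.1 <= q.1.2 & q.1.2 <= b] /\
                          [/\ c <= q.2.1, q.2.1 <= q.2.2 & q.2.2 <= d].
have nextP q : inside q -> bad q ->
  [/\ inside (next q), bad (next q),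
    q.1.1 <= (next q).1.1 /\ (next q).1.2 <= q.1.2,
    q.2.1 <= (next q).2.1 /\ (next q).2.2 <= q.2.2 &
    (next q).1.2 - (next q).1.1 = (q.1.2 - q.1.1) / 2 /\
    (next q).2.2 - (next q).2.1 = (q.2.2 - q.2.1) / 2].
  move=> [[ax xx xb] [cy yy yd]] badq.
  have [mx1 mx2] : q.1.1 <= mx q /\ mx q <= q.1.2 by rewrite /mx; split; lra.
  have [my1 my2] : q.2.1 <= my q /\ my q <= q.2.2 by rewrite /my; split; lra.
  have badn : bad (next q).
    rewrite /next; case: ifPn => // n1; case: ifPn => // n2; case: ifPn => // n3.
    apply: contraT => n4; move: badq n1 n2 n3 n4; rewrite /bad /=.
    rewrite -!leNgt (Jx (x2 := mx q)) // (Jy (y2 := my q)) //; last lra.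
    rewrite (Jy (x1 := mx q) (y2 := my q)) //; last lra.
    set j1 := J _ _ _ _; set j2 := J _ _ _ _; set j3 := J _ _ _ _; set j4 := J _ _ _ _.
    move=> H h1 h2 h3 h4.
    have := ler_normD (j1 + j2) (j3 + j4); have := ler_normD j1 j2.
    have := ler_normD j3 j4; move: H h1 h2 h3 h4; rewrite /mx /my.
    set u := q.1.1; set u' := q.1.2; set v := q.2.1; set v' := q.2.2.
    have -> : (u + u') / 2 - u + ((v + v') / 2 - v) = (u' - u + (v' - v)) / 2 by lra.
    have -> : (u + u') / 2 - u + (v' - (v + v') / 2) = (u' - u + (v' - v)) / 2 by lra.
    have -> : u' - (u + u') / 2 + ((v + v') / 2 - v) = (u' - u + (v' - v)) / 2 by lra.
    have -> : u' - (u + u') / 2 + (v' - (v + v') / 2) = (u' - u + (v' - v)) / 2 by lra.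
    rewrite expr_div_n; set l := (_ + _) ^+ 2; clear => *; lra.
  split=> //; rewrite /inside /next; do 3?case: ifP => _; rewrite /= /mx /my;
    move: ax xx xb cy yy yd; clear => *; split; try split; lra.
pose s n := iter n next ((a, b), (c, d)).
have sP n : inside (s n) /\ bad (s n).
  elim: n => [|n [i bd]]; last by have [] := nextP _ i bd.
  split; first by rewrite /inside /=; split; split.
  rewrite /bad /= /e -/L2 mulrAC ltr_pdivrMr ?ltr_wpDl //.
  by rewrite ltr_pM2l ?normr_gt0 // ltrDl.
have sN n : (s n).1.2 - (s n).1.1 = (b - a) / 2 ^+ n /\
            (s n).2.2 - (s n).2.1 = (d - c) / 2 ^+ n.
  elim: n => [|n [IH1 IH2]]; first by rewrite expr0 !divr1.
  have [i bd] := sP n; have [_ _ _ _ [h1 h2]] := nextP _ i bd.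
  by rewrite [s n.+1]/= h1 h2 IH1 IH2 exprSr invfM !mulrA.
have [x xP] : exists x, forall n, (s n).1.1 <= x <= (s n).1.2.
  apply: nested_point => n; have [i bd] := sP n; have [_ _ [? ?] _ _] := nextP _ i bd => //.
  by case: i => [[]].
have [y yP] : exists y, forall n, (s n).2.1 <= y <= (s n).2.2.
  apply: nested_point => n; have [i bd] := sP n; have [_ _ _ [? ?] _] := nextP _ i bd => //.
  by case: i => [_ []].
have [r r0 Hr] := Jsmall (xP 0%N) (yP 0%N) e0.
have [n Hn] : exists n, (b - a) / 2 ^+ n < r /\ (d - c) / 2 ^+ n < r.
  have [n Hn] : exists n, ((b - a) + (d - c)) / r < n%:R.
    by exists (Num.truncn (((b - a) + (d - c)) / r)).+1; exact: truncnS_gt.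
  exists n; rewrite ltr_pdivrMr // in Hn.
  have : n%:R <= 2 ^+ n :> R by rewrite -natrX ler_nat ltnW // ltn_expl.
  rewrite !ltr_pdivrMr ?exprn_gt0 // => H2.
  have : n%:R * r <= 2 ^+ n * r by rewrite ler_pM2r.
  move: Hn ab cd; set p := 2 ^+ n; clear => *; by split; lra.
have [[[i1 i2 i3] [i4 i5 i6]] bd] := sP n.
have /andP[x1 x2] := xP n; have /andP[y1 y2] := yP n; have [l1 l2] := sN n.
have := Hr _ _ _ _ i1 x1 x2 i3 i4 y1 y2 i6.
by rewrite l1 l2 => /(_ Hn.1 Hn.2); rewrite leNgt -l1 -l2 -/(bad (s n)) bd.
Qed.

End Bisection.

(** * Integrals of continuous real functions over a segment *)

Section IntervalIntegral.
Variable R : realType.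
Local Notation mu := (@lebesgue_measure R).
Implicit Types (a b e : R) (f g : R -> R).

Definition RI a b f := (\int[mu]_(x in `[a, b]) f x)%R.
Definition ctson a b f := {within `[a, b], continuous f}.

Lemma ctsonP a b f :
  (forall x e, a <= x <= b -> 0 < e -> exists2 r, 0 < r &
     forall y, a <= y <= b -> `|y - x| < r -> `|f y - f x| <= e) ->
  ctson a b f.
Proof.
move=> H; apply/subspace_continuousP => x /=; rewrite in_itv /= => xab.
apply/cvgrPdist_le => e e0; have [r r0 Hr] := H _ _ xab e0.
apply/nbhs_ballP; exists r => //= y; rewrite -ball_normE /= => xy.
by rewrite in_itv /= => yab; rewrite distrC Hr // distrC.
Qed.

Lemma ctson_continuous a b f : continuous f -> ctson a b f.
Proof. by move=> cf; exact: continuous_subspaceT. Qed.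

Lemma ctson_integrable a b f : ctson a b f -> mu.-integrable `[a, b] (EFin \o f).
Proof. by move=> cf; apply: continuous_compact_integrable => //; exact: segment_compact. Qed.

Lemma ctsonB a b f g : ctson a b f -> ctson a b g -> ctson a b (fun x => f x - g x).
Proof. by move=> cf cg x; apply: cvgB; [exact: cf|exact: cg]. Qed.

Lemma ctsonM a b f g : ctson a b f -> ctson a b g -> ctson a b (fun x => f x * g x).
Proof. by move=> cf cg x; apply: cvgM; [exact: cf|exact: cg]. Qed.

Lemma ctson_cst a b (k : R) : ctson a b (fun=> k).
Proof. by move=> x; exact: cvg_cst. Qed.

Lemma mu_itv a b : a <= b -> fine (mu `[a, b]) = b - a.
Proof.
rewrite le_eqVlt => /predU1P[->|ab]; first by rewrite set_itv1 lebesgue_measure_set1 subrr.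
by rewrite lebesgue_measure_itv /= lte_fin ab.
Qed.

Lemma RI_eq a b f g : (forall x, a <= x <= b -> f x = g x) -> RI a b f = RI a b g.
Proof.
by move=> fg; apply: eq_Rintegral => x; rewrite inE /= in_itv /=; exact: fg.
Qed.

Lemma RI_cst a b (k : R) : a <= b -> RI a b (fun=> k) = k * (b - a).
Proof. by move=> ab; rewrite /RI Rintegral_cst //= mu_itv. Qed.

Lemma RID a b f g : ctson a b f -> ctson a b g ->
  RI a b (fun x => f x + g x) = RI a b f + RI a b g.
Proof. by move=> cf cg; rewrite /RI RintegralD //; exact: ctson_integrable. Qed.

Lemma RIB a b f g : ctson a b f -> ctson a b g ->
  RI a b (fun x => f x - g x) = RI a b f - RI a b g.
Proof. by move=> cf cg; rewrite /RI RintegralB //; exact: ctson_integrable. Qed.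

Lemma RIZ a b (k : R) f : ctson a b f -> RI a b (fun x => k * f x) = k * RI a b f.
Proof. by move=> cf; rewrite /RI RintegralZl //; exact: ctson_integrable. Qed.

Lemma RI_le a b f g : ctson a b f -> ctson a b g ->
  (forall x, a <= x <= b -> f x <= g x) -> RI a b f <= RI a b g.
Proof.
move=> cf cg fg; by rewrite /RI; apply: (le_Rintegral _ (ctson_integrable cf) (ctson_integrable cg)) => //.
Qed.

Lemma RI_norm_le a b f (k : R) : a <= b -> ctson a b f ->
  (forall x, a <= x <= b -> `|f x| <= k) -> `|RI a b f| <= k * (b - a).
Proof.
move=> ab cf fk; rewrite -RI_cst // ler_norml; apply/andP; split.
  rewrite lerNl -mulN1r -RIZ //; apply: RI_le => [||x /fk]; last by rewrite ler_norml mulN1r lerNl => /andP[].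
    by apply: ctsonM => //; exact: ctson_cst.
  exact: ctson_cst.
apply: RI_le => // [|x /fk]; first exact: ctson_cst.
by rewrite ler_norml => /andP[].
Qed.

Lemma RI_chasles a m b f : a <= m -> m <= b -> ctson a b f ->
  RI a b f = RI a m f + RI m b f.
Proof.
move=> am mb cf; apply/eqP; rewrite addrC -subr_eq; apply/eqP.
rewrite /RI (@Rintegral_itvB _ f (BLeft a) (BRight b) m) ?bnd_simp //; last exact: ctson_integrable.
apply: Rintegral_itv_obnd_cbnd; apply: integrableS (ctson_integrable cf) => //.
by apply: subset_itvScc; rewrite bnd_simp.
Qed.

Lemma RI_FTC a b (F : R -> R) f : a <= b -> (forall x, is_derive (x : R) 1 F (f x)) -> continuous f ->
  RI a b f = F b - F a.
Proof.
rewrite le_eqVlt => /predU1P[->|ab] dF cf.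
  by rewrite /RI set_itv1 Rintegral_set1 subrr.
rewrite /RI /Rintegral (@continuous_FTC2 _ f F) //; first exact: ctson_continuous.
  have dF1 x : derivable F x 1 by have [] := dF x.
  split=> //.
    by apply: cvg_at_right_filter; apply: differentiable_continuous; exact/derivable1_diffP.
  by apply: cvg_at_left_filter; apply: differentiable_continuous; exact/derivable1_diffP.
by move=> x _; rewrite derive1E; have [_ ->] := dF x.
Qed.

End IntervalIntegral.

(** * Contraction of a circle to an interior point *)

Section CauchyFormula.
Variable R : realType.
Local Notation C := (Cplx R).
Local Notation Re := (@complex.Re R).
Local Notation Im := (@complex.Im R).
Implicit Types (z w : C) (t e : R).

Definition ccts (a b : R) (h : R -> C) := forall x e, a <= x <= b -> 0 < e ->
  exists2 r, 0 < r & forall y, a <= y <= b -> `|y - x| < r -> cabs (h y - h x) <= e.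

Lemma ccts_Re a b h : ccts a b h -> ctson a b (fun t => Re (h t)).
Proof.
move=> hc; apply: ctsonP => x e xab e0; have [r r0 H] := hc _ _ xab e0.
exists r => // y yab /(H _ yab); apply: le_trans.
by rewrite -ReN -ReD Re_le_cabs.
Qed.

Lemma ccts_Im a b h : ccts a b h -> ctson a b (fun t => Im (h t)).
Proof.
move=> hc; apply: ctsonP => x e xab e0; have [r r0 H] := hc _ _ xab e0.
exists r => // y yab /(H _ yab); apply: le_trans.
by rewrite -ImN -ImD Im_le_cabs.
Qed.

Lemma ccts_lip a b h (L : R) :
  (forall x y, a <= x <= b -> a <= y <= b -> cabs (h y - h x) <= L * `|y - x|) -> ccts a b h.
Proof.
move=> hL x e xab e0; exists (e / (`|L| + 1)) => [|y yab yx].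
  by rewrite divr_gt0 // ltr_wpDl.
rewrite (le_trans (hL _ _ xab yab)) // (@le_trans _ _ ((`|L| + 1) * `|y - x|)) //.
  by rewrite ler_wpM2r // (le_trans (ler_norm _)) // lerDl.
by rewrite mulrC -ler_pdivlMr ?ltr_wpDl // ltW.
Qed.

Lemma cctsB a b h1 h2 : ccts a b h1 -> ccts a b h2 -> ccts a b (fun t => h1 t - h2 t).
Proof.
move=> c1 c2 x e xab e0; have e20 : 0 < e / 2 by rewrite divr_gt0.
have [r1 r10 H1] := c1 _ _ xab e20; have [r2 r20 H2] := c2 _ _ xab e20.
exists (Num.min r1 r2) => [|y yab]; first by rewrite lt_min r10.
rewrite lt_min => /andP[/(H1 _ yab) h /(H2 _ yab) h'].
rewrite (_ : h1 y - h2 y - _ = (h1 y - h1 x) - (h2 y - h2 x)); last by ring.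
by rewrite (le_trans (cabsB _ _)) // [leRHS]splitr lerD.
Qed.

Lemma ctson_ReM a b h1 h2 : ccts a b h1 -> ccts a b h2 -> ctson a b (fun t => Re (h1 t * h2 t)).
Proof.
move=> c1 c2; rewrite (_ : (fun t => _) = fun t => Re (h1 t) * Re (h2 t) - Im (h1 t) * Im (h2 t)).
  by apply: ctsonB; apply: ctsonM; [exact: ccts_Re|exact: ccts_Re|exact: ccts_Im|exact: ccts_Im].
by apply: funext => t; rewrite ReM.
Qed.

Definition cis t : C := (cos t +i* sin t)%C.
Definition Ci : C := (0 +i* 1)%C.

Lemma cabs_Ci : cabs Ci = 1.
Proof. by rewrite /cabs /= expr0n expr1n add0r sqrtr1. Qed.

Lemma cabs_cis t : cabs (cis t) = 1.
Proof. by rewrite /cabs /= cos2Dsin2 sqrtr1. Qed.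

Lemma cis0 : cis 0 = 1. Proof. by rewrite /cis cos0 sin0. Qed.

Lemma cis2pi : cis (pi *+ 2) = 1. Proof. by rewrite /cis cos2pi sin2pi. Qed.

Lemma lip_of_is_derive (f df : R -> R) :
  (forall x : R, is_derive x 1 f (df x)) -> (forall x, `|df x| <= 1) ->
  forall x y, `|f y - f x| <= `|y - x|.
Proof.
move=> dF df1 x y; wlog xy : x y / x <= y => [H|].
  by case: (leP x y) => [/H//|/ltW /H]; rewrite distrC [leRHS]distrC.
have cf : {within `[x, y], continuous f}.
  apply: continuous_subspaceT => z; apply: differentiable_continuous.
  by apply/derivable1_diffP; have [] := dF z.
have [c _ ->] := MVT_segment xy (fun u _ => dF u) cf.
by rewrite normrM ler_piMl.
Qed.

Lemma cis_lip t0 t : cabs (cis t - cis t0) <= 2 * `|t - t0|.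
Proof.
rewrite (le_trans (cabs_leD _)) // mulrDl !mul1r; apply: lerD; rewrite /=.
  apply: lip_of_is_derive => x; rewrite normrN ler_norml.
  by rewrite sin_geN1 sin_le1.
by apply: lip_of_is_derive => x; rewrite ler_norml cos_geN1 cos_le1.
Qed.

Variables (x a : C) (f : C -> C).
Hypothesis ax : cabs a < cabs x.
Hypothesis df : forall z, cabs z <= cabs x -> derivable f z 1.

Let s := cabs x.
Let s0 : 0 < s. Proof. exact: le_lt_trans (cabs_ge0 _) ax. Qed.
Let xi t : C := x * cis t.
Let eta t : C := xi t - a.
(** As xi' = i xi, this is the logarithmic derivative eta' / eta: [k t] dt is dz / (z - a) along the
    circle and along each of its contractions towards [a]. *)
Let k t : C := Ci * xi t / eta t.
(** Linear contraction of the circle |z| = |x| to [a]; it stays in the closed disc where [f] is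
    differentiable. *)
Let pt (l t : R) : C := a + ofR l * eta t.
Let g l t := f (pt l t).

Let xiE t : cabs (xi t) = s. Proof. by rewrite cabsM cabs_cis mulr1. Qed.

Let xi_lip t0 t : cabs (xi t - xi t0) <= 2 * s * `|t - t0|.
Proof.
by rewrite -mulrBr cabsM mulrC [leRHS]mulrAC ler_wpM2r ?cabs_ge0 // cis_lip.
Qed.

Let eta_ge t : s - cabs a <= cabs (eta t).
Proof. by rewrite -(xiE t) cabs_dist. Qed.

Let sa0 : 0 < s - cabs a. Proof. by rewrite subr_gt0. Qed.

Let eta_gt0 t : 0 < cabs (eta t). Proof. exact: lt_le_trans (eta_ge t). Qed.

Let eta_neq0 t : eta t != 0. Proof. by rewrite -cabs_gt0. Qed.

Let eta_le t : cabs (eta t) <= 2 * s.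
Proof. by rewrite (le_trans (cabsB _ _)) // xiE mulrDl mul1r lerD2l ltW. Qed.

Let eta_k t : eta t * k t = Ci * xi t.
Proof. by rewrite mulrC divfK. Qed.

Let kE t : k t = Ci + Ci * a / eta t.
Proof.
by rewrite -[X in X + _](mulfK (eta_neq0 t)) -mulrDl -mulrDr subrK.
Qed.

Let K := s / (s - cabs a).

Let k_le t : cabs (k t) <= K.
Proof.
rewrite /k (cabsM _ (_^-1)) (cabsM Ci) cabs_Ci mul1r xiE cabsV ler_wpM2l ?(ltW s0) //.
by rewrite lef_pV2 // posrE.
Qed.

Let k_lip t0 t : cabs (k t - k t0) <= (cabs a * (2 * s) / (s - cabs a) ^+ 2) * `|t - t0|.
Proof.
rewrite !kE (_ : _ - _ = Ci * a * ((eta t)^-1 - (eta t0)^-1)); last by ring.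
rewrite (_ : _^-1 - _ = (xi t0 - xi t) / (eta t * eta t0)); last first.
  have -> : xi t0 - xi t = eta t0 - eta t by rewrite /eta; ring.
  by have h1 := eta_neq0 t; have h2 := eta_neq0 t0; field; rewrite h1 h2.
have A : cabs (xi t0 - xi t) <= 2 * s * `|t - t0| by rewrite cabs_distC.
have B : (cabs (eta t * eta t0))^-1 <= ((s - cabs a) ^+ 2)^-1.
  rewrite lef_pV2 ?posrE ?exprn_gt0 // (cabsM (eta t)) ?mulr_gt0 //.
  by rewrite expr2 ler_pM // ltW.
have B0 : 0 <= (cabs (eta t * eta t0))^-1 by rewrite invr_ge0 cabs_ge0.
rewrite (cabsM (Ci * a)) (cabsM Ci) cabs_Ci mul1r (cabsM (xi t0 - xi t)) cabsV.
apply: le_trans (ler_wpM2l (cabs_ge0 a) (ler_pM (cabs_ge0 _) B0 A B)) _.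
by rewrite le_eqVlt; apply/orP; left; apply/eqP; ring.
Qed.

Let ptE l t : pt l t = ofR (1 - l) * a + ofR l * xi t.
Proof.
rewrite /pt /eta mulrBr addrCA addrC; congr (_ + _).
by apply: Cplx_eq; rewrite /= ?ReD ?ImD ?ReN ?ImN ?ReM ?ImM /=; ring.
Qed.

Let pt_le l t : 0 <= l <= 1 -> cabs (pt l t) <= s.
Proof.
move=> /andP[l0 l1]; rewrite ptE (le_trans (cabsD _ _)) // (cabsM _ a) (cabsM _ (xi t)) !cabs_ofR xiE.
rewrite !ger0_norm ?subr_ge0 //; have l1' : 0 <= 1 - l by rewrite subr_ge0.
by have := ler_wpM2l l1' (ltW ax); rewrite -/s; lra.
Qed.

Let pt_lip l0 t0 l t : 0 <= l0 <= 1 ->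
  cabs (pt l t - pt l0 t0) <= 2 * s * (`|l - l0| + `|t - t0|).
Proof.
move=> /andP[l00 l01].
rewrite (_ : _ - _ = ofR (l - l0) * eta t + ofR l0 * (xi t - xi t0)); last first.
  rewrite ofRD (_ : ofR (- l0) = - ofR l0); last by apply: Cplx_eq; rewrite /= ?oppr0.
  by rewrite /pt /eta; ring.
rewrite (le_trans (cabsD _ _)) // (cabsM _ (eta t)) (cabsM _ (_ - _)) !cabs_ofR mulrDr lerD //.
  by rewrite mulrC ler_wpM2r.
by rewrite (le_trans _ (xi_lip t0 t)) // ler_piMl ?cabs_ge0 // ger0_norm.
Qed.

Let fcts z e : cabs z <= s -> 0 < e -> exists2 r, 0 < r &
  forall w, cabs (w - z) < r -> cabs (f w - f z) <= e.
Proof. by move=> /df; exact: derivable_cabs_continuous. Qed.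

Let g_ccts_t (b c l : R) : 0 <= l <= 1 -> ccts b c (g l).
Proof.
move=> l01 t e _ e0; have [r r0 H] := fcts (pt_le t l01) e0.
exists (r / (2 * s)) => [|y _ yt]; first by rewrite divr_gt0 // mulr_gt0.
apply: H; rewrite (le_lt_trans (pt_lip _ _ _ l01)) // subrr normr0 add0r.
by rewrite mulrC -ltr_pdivlMr // mulr_gt0.
Qed.

Let g_ccts_l (b c t : R) : 0 <= b -> c <= 1 -> ccts b c (g^~ t).
Proof.
move=> b0 c1 l e /andP[bl lc] e0.
have l01 : 0 <= l <= 1 by rewrite (le_trans b0) // (le_trans lc).
have [r r0 H] := fcts (pt_le t l01) e0.
exists (r / (2 * s)) => [|y _ yt]; first by rewrite divr_gt0 // mulr_gt0.
apply: H; rewrite (le_lt_trans (pt_lip _ _ _ l01)) // subrr normr0 addr0.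
by rewrite mulrC -ltr_pdivlMr // mulr_gt0.
Qed.

Let k_ccts (b c : R) : ccts b c k.
Proof. by apply: ccts_lip => ? ? _ _; exact: k_lip. Qed.

Let ofRV_ccts (b c : R) : 0 < b -> ccts b c (fun l => ofR l^-1).
Proof.
move=> b0; apply: (@ccts_lip _ _ _ (b^-1 ^+ 2)) => u v /andP[bu _] /andP[bv _].
have u0 : 0 < u by exact: lt_le_trans bu.
have v0 : 0 < v by exact: lt_le_trans bv.
rewrite (_ : _ - _ = ofR (v^-1 - u^-1)); last by apply: Cplx_eq; rewrite ?ReD ?ImD ?ReN ?ImN /= ?subrr.
rewrite cabs_ofR (_ : _ - _ = (u^-1 * v^-1) * (u - v)); last by field; rewrite !gt_eqF.
rewrite normrM distrC ler_wpM2r // ger0_norm ?mulr_ge0 ?invr_ge0 ?(ltW u0) ?(ltW v0) // expr2.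
by rewrite ler_pM ?invr_ge0 ?(ltW u0) ?(ltW v0) // lef_pV2.
Qed.

(** Up to sign, the real part of the integral of f(z) dz / (z - a) along the boundary of the image
    of the rectangle under [pt]: on radial edges dz / (z - a) is dl / l, on arcs it is k dt. *)
Let J l1 l2 t1 t2 := RI l1 l2 (fun l => Re (ofR l^-1 * (g l t2 - g l t1)))
  - RI t1 t2 (fun t => Re ((g l2 t - g l1 t) * k t)).

Let RI_xi (c : C) t1 t2 : t1 <= t2 ->
  RI t1 t2 (fun t => Re (c * (Ci * xi t))) = Re (c * (xi t2 - xi t1)).
Proof.
move=> t12; pose F t : R := Re (c * x) * cos t - Im (c * x) * sin t.
have dF t : is_derive t 1 F (Re (c * (Ci * xi t))).
  have dF := is_deriveB (is_deriveZ (Re (c * x)) (is_derive_cos t))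
    (is_deriveZ (Im (c * x)) (is_derive_sin t)).
  by apply: is_derive_eq dF _; rewrite /xi !(ReM, ImM) /= /GRing.scale /=; ring.
have cF : continuous (fun t => Re (c * (Ci * xi t))).
  have -> : (fun t => Re (c * (Ci * xi t))) =
    (fun t => - Re (c * x) * sin t - Im (c * x) * cos t).
    by apply: funext => t; rewrite /xi !(ReM, ImM) /=; ring.
  move=> t; apply: cvgB; apply: cvgM; try exact: cvg_cst.
    exact: continuous_sin.
  exact: continuous_cos.
rewrite (RI_FTC t12 dF cF) /F /xi -mulrBr mulrA.
by rewrite (ReM (c * x)) ReD ReN ImD ImN /=; ring.
Qed.

(** Near z0 = [pt l0 t0] replace [f] by f(z0) + D (z - z0). For this affine part both integrals
    equal (l2 - l1) Re (D (xi t2 - xi t1)) and cancel in [J]; the differentiability error [E] is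
    integrated in [A1] and [A2]. The bound d <= l keeps 1 / l under control. *)
Let J_small (d l0 t0 e : R) : 0 < d -> d <= l0 <= 1 -> 0 < e ->
  exists2 r, 0 < r & forall l1 l2 t1 t2, d <= l1 -> l1 <= l0 -> l0 <= l2 -> l2 <= 1 ->
    t1 <= t0 -> t0 <= t2 -> l2 - l1 < r -> t2 - t1 < r ->
    `|J l1 l2 t1 t2| <= e * ((l2 - l1) + (t2 - t1)) ^+ 2.
Proof.
move=> d0 /andP[dl0 l01] e0; pose M := 4 * s / d + 4 * s * K.
have K0 : 0 < K by rewrite divr_gt0.
have s4 : 0 < 4 * s by rewrite mulr_gt0.
have M0 : 0 < M by exact: addr_gt0 (divr_gt0 s4 d0) (mulr_gt0 s4 K0).
have l00 : 0 <= l0 <= 1 by rewrite l01 (le_trans _ dl0) // ltW.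
pose z0 := pt l0 t0; have z0s : cabs z0 <= s by exact: pt_le.
have [r1 r10 H] := derivable_has_cderiv (df z0s) (divr_gt0 e0 M0).
set D := cderiv f z0 in H.
exists (r1 / (4 * s)) => [|l1 l2 t1 t2 dl1 l10 l02 l21 t10 t02]; first by rewrite divr_gt0 // mulr_gt0.
rewrite !ltr_pdivlMr ?mulr_gt0 // => lr tr.
set L := l2 - l1 + (t2 - t1).
have L0 : 0 <= L by rewrite /L; lra.
pose E l t := g l t - f z0 - D * (pt l t - z0).
have E_le l t : l1 <= l <= l2 -> t1 <= t <= t2 -> cabs (E l t) <= e / M * (2 * s * L).
  move=> /andP[ll1 ll2] /andP[tt1 tt2].
  have pl : cabs (pt l t - z0) <= 2 * s * L.
    rewrite (le_trans (pt_lip _ _ _ l00)) // ler_pM2l ?mulr_gt0 // lerD //.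
      by rewrite ler_norml; apply/andP; split; lra.
    by rewrite ler_norml; apply/andP; split; lra.
  have Lr : 2 * s * L < r1 by rewrite /L; lra.
  have := H _ (le_lt_trans pl Lr); rewrite (addrC z0) subrK => /le_trans; apply.
  by rewrite ler_wpM2l // ltW // divr_gt0.
have gB l t l' t' : g l t - g l' t' = D * (pt l t - pt l' t') + (E l t - E l' t').
  by rewrite /E; ring.
have l10' : 0 <= l1 <= 1 by lra.
have l20' : 0 <= l2 <= 1 by lra.
have l1p : 0 < l1 by lra.
have l12 : l1 <= l2 by lra.
have t12 : t1 <= t2 by lra.
have A1 : `|RI l1 l2 (fun l => Re (ofR l^-1 * (g l t2 - g l t1))) -
            (l2 - l1) * Re (D * (xi t2 - xi t1))| <= d^-1 * (2 * (e / M * (2 * s * L))) * (l2 - l1).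
  rewrite mulrC -RI_cst // -RIB; last exact: ctson_cst.
    apply: RI_norm_le => // [|l ll].
      apply: ctsonB; last exact: ctson_cst.
      by apply: ctson_ReM; [exact: ofRV_ccts|apply: cctsB; apply: g_ccts_l; lra].
    have lp : 0 < l by lra.
    rewrite gB -ReN -ReD (_ : _ - _ = ofR l^-1 * (E l t2 - E l t1)).
      rewrite (le_trans (Re_le_cabs _)) // cabsM cabs_ofR; apply: ler_pM => //; first exact: cabs_ge0.
        rewrite ger0_norm ?invr_ge0 ?(ltW lp) // lef_pV2 //; lra.
      by rewrite (le_trans (cabsB _ _)) // mulrDl mul1r lerD // E_le //; lra.
    rewrite mulrDr addrAC; apply/eqP; rewrite -subr_eq0 addrK; apply/eqP.
    rewrite /pt /eta.
    have -> : ofR l^-1 * (D * (a + ofR l * (xi t2 - a) - (a + ofR l * (xi t1 - a)))) =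
       (ofR l^-1 * ofR l) * (D * (xi t2 - xi t1)) by ring.
    by rewrite -ofRM mulVf ?gt_eqF // mul1r subrr.
  by apply: ctson_ReM; [exact: ofRV_ccts|apply: cctsB; apply: g_ccts_l; lra].
have A2 : `|RI t1 t2 (fun t => Re ((g l2 t - g l1 t) * k t)) -
            (l2 - l1) * Re (D * (xi t2 - xi t1))| <= 2 * (e / M * (2 * s * L)) * K * (t2 - t1).
  have -> : (l2 - l1) * Re (D * (xi t2 - xi t1)) = Re ((ofR (l2 - l1) * D) * (xi t2 - xi t1)).
    by rewrite -mulrA [in RHS]ReM /= mul0r subr0.
  rewrite -RI_xi //.
  have cix : ccts t1 t2 (fun t => Ci * xi t).
    by apply: (@ccts_lip _ _ _ (2 * s)) => u v _ _; rewrite -mulrBr cabsM cabs_Ci mul1r.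
  have cst (c : C) : ccts t1 t2 (fun=> c).
    by apply: (@ccts_lip _ _ _ 0) => u v _ _; rewrite subrr cabs0 mul0r.
  have cg : ctson t1 t2 (fun t => Re ((g l2 t - g l1 t) * k t)).
    by apply: ctson_ReM; [apply: cctsB; apply: g_ccts_t|exact: k_ccts].
  rewrite -RIB //; last by apply: ctson_ReM.
  apply: RI_norm_le => // [|t tt]; first by apply: ctsonB => //; apply: ctson_ReM.
  rewrite gB -ReN -ReD (_ : _ - _ = (E l2 t - E l1 t) * k t).
    rewrite (le_trans (Re_le_cabs _)) // cabsM; apply: ler_pM => //; [exact: cabs_ge0|exact: cabs_ge0|].
    by rewrite (le_trans (cabsB _ _)) // mulrDl mul1r lerD // E_le //; lra.
  rewrite mulrDl addrAC; apply/eqP; rewrite -subr_eq0 addrK; apply/eqP.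
  rewrite ofRD (_ : ofR (- l1) = - ofR l1); last by apply: Cplx_eq; rewrite /= ?oppr0.
  by rewrite -eta_k /pt; ring.
have -> : J l1 l2 t1 t2 = RI l1 l2 (fun l => Re (ofR l^-1 * (g l t2 - g l t1))) -
            (l2 - l1) * Re (D * (xi t2 - xi t1)) -
  (RI t1 t2 (fun t => Re ((g l2 t - g l1 t) * k t)) - (l2 - l1) * Re (D * (xi t2 - xi t1))).
  by rewrite /J; ring.
rewrite (le_trans (ler_normB _ _)) // (le_trans (lerD A1 A2)) //.
have P0 : 0 <= e / M * L by rewrite mulr_ge0 // ltW // divr_gt0.
apply: (@le_trans _ _ (4 * s / d * (e / M * L) * L + 4 * s * K * (e / M * L) * L)); last first.
  by rewrite -!mulrDl -/M !mulrA [M * e]mulrC mulfK ?gt_eqF // -mulrA -expr2.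
apply: lerD.
  rewrite (_ : d^-1 * _ = 4 * s / d * (e / M * L)); last by ring.
  apply: ler_wpM2l; first exact: mulr_ge0 (ltW (divr_gt0 s4 d0)) P0.
  by rewrite /L; lra.
rewrite (_ : 2 * _ * K = 4 * s * K * (e / M * L)); last by ring.
apply: ler_wpM2l; first exact: mulr_ge0 (ltW (mulr_gt0 s4 K0)) P0.
by rewrite /L; lra.
Qed.

Let J_addl l1 l2 l3 t1 t2 : 0 < l1 -> l1 <= l2 -> l2 <= l3 -> l3 <= 1 -> t1 <= t2 ->
  J l1 l3 t1 t2 = J l1 l2 t1 t2 + J l2 l3 t1 t2.
Proof.
move=> l10 l12 l23 l31 t12.
have l1p : 0 <= l1 <= 1 by rewrite ltW // (le_trans l12) // (le_trans l23).
have l2p : 0 <= l2 <= 1 by rewrite (le_trans l23) // andbT (le_trans (ltW l10)).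
have l3p : 0 <= l3 <= 1 by rewrite l31 andbT (le_trans (ltW l10)) // (le_trans l12).
rewrite /J (RI_chasles l12 l23); last first.
  by apply: ctson_ReM; [exact: ofRV_ccts|apply: cctsB; apply: g_ccts_l => //; exact: ltW].
rewrite (_ : RI t1 t2 (fun t => Re ((g l3 t - g l1 t) * k t)) =
   RI t1 t2 (fun t => Re ((g l2 t - g l1 t) * k t)) +
   RI t1 t2 (fun t => Re ((g l3 t - g l2 t) * k t))); first by ring.
have cg l l' : 0 <= l <= 1 -> 0 <= l' <= 1 -> ctson t1 t2 (fun t => Re ((g l t - g l' t) * k t)).
  by move=> *; apply: ctson_ReM; [apply: cctsB; exact: g_ccts_t|exact: k_ccts].
rewrite -RID; [|exact: cg|exact: cg]; apply: RI_eq => t _.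
by rewrite -ReD -mulrDl; congr (Re (_ * _)); ring.
Qed.

Let J_addt l1 l2 t1 t2 t3 : 0 < l1 -> l1 <= l2 -> l2 <= 1 -> t1 <= t2 -> t2 <= t3 ->
  J l1 l2 t1 t3 = J l1 l2 t1 t2 + J l1 l2 t2 t3.
Proof.
move=> l10 l12 l21 t12 t23.
have l1p : 0 <= l1 <= 1 by rewrite ltW // (le_trans l12).
have l2p : 0 <= l2 <= 1 by rewrite l21 andbT (le_trans (ltW l10)).
rewrite /J (RI_chasles t12 t23); last first.
  by apply: ctson_ReM; [apply: cctsB; exact: g_ccts_t|exact: k_ccts].
rewrite (_ : RI l1 l2 (fun l => Re (ofR l^-1 * (g l t3 - g l t1))) =
   RI l1 l2 (fun l => Re (ofR l^-1 * (g l t2 - g l t1))) +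
   RI l1 l2 (fun l => Re (ofR l^-1 * (g l t3 - g l t2)))); first by ring.
have cg t t' : ctson l1 l2 (fun l => Re (ofR l^-1 * (g l t - g l t'))).
  by apply: ctson_ReM; [exact: ofRV_ccts|apply: cctsB; apply: g_ccts_l => //; exact: ltW].
rewrite -RID; [|exact: cg|exact: cg]; apply: RI_eq => t _.
by rewrite -ReD -mulrDr; congr (Re (_ * _)); ring.
Qed.

Let tp : R := pi *+ 2.
Let tp0 : 0 <= tp. Proof. by rewrite /tp mulrn_wge0 // pi_ge0. Qed.
Let m l := RI 0 tp (fun t => Re (g l t * k t)).

Let m_ccts l : 0 <= l <= 1 -> ctson 0 tp (fun t => Re (g l t * k t)).
Proof. by move=> lp; apply: ctson_ReM; [exact: g_ccts_t|exact: k_ccts]. Qed.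

(** The radial edges at t = 0 and t = 2 pi coincide, so the vanishing of [J] on [d, 1] x [0, 2 pi]
    leaves the difference of the two circular integrals. The singularity of 1 / l at 0 excludes d =
    0. *)
Let m_cst d : 0 < d -> d <= 1 -> m d = m 1.
Proof.
move=> d0 d1.
have dp : 0 <= d <= 1 by rewrite ltW.
have : J d 1 0 tp = 0.
  apply: rectangle_function_eq0 => //.
  - by move=> l1 l2 l3 t1 t2 dl1 l12 l23 l31 _ t12 _; apply: J_addl => //; exact: lt_le_trans dl1.
  - by move=> l1 l2 t1 t2 t3 dl1 l12 l21 _ t12 t23 _; apply: J_addt => //; exact: lt_le_trans dl1.
  - move=> l t e dl1 _ e0; have [r r0 H] := J_small t d0 dl1 e0.
    by exists r => // l1 l2 t1 t2 h1 h2 h3 h4 _ h5 h6 _; exact: H.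
rewrite /J (_ : RI d 1 _ = 0); last first.
  rewrite (_ : RI d 1 _ = RI d 1 (fun=> 0)); first by rewrite RI_cst // mul0r.
  by apply: RI_eq => l _; rewrite /g /pt /eta /xi /tp cis2pi cis0 subrr mulr0.
rewrite (_ : RI 0 tp _ = m 1 - m d); first lra.
rewrite /m -RIB; [|by apply: m_ccts; rewrite ler01 lexx|exact: m_ccts].
by apply: RI_eq => t _; rewrite -ReN -ReD -mulrBl.
Qed.

(** By [m_cst] the circle can be contracted so far that [f] is within any prescribed error of [f a]
    on it, while the kernel stays bounded by [K]. *)
Lemma circle_integral_eq :
  RI 0 (pi *+ 2) (fun t => Re (f (x * cis t) * (Ci * (x * cis t) / (x * cis t - a)))) =
  RI 0 (pi *+ 2) (fun t => Re (f a * (Ci * (x * cis t) / (x * cis t - a)))).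
Proof.
rewrite -/tp (_ : RI 0 tp _ = m 1); last first.
  apply: RI_eq => t _; rewrite /g (_ : pt 1 t = xi t) //.
  by rewrite /pt /eta (_ : ofR 1 = 1) // mul1r addrC subrK.
have K0 : 0 < K by rewrite divr_gt0.
have cfa : ctson 0 tp (fun t => Re (f a * k t)).
  apply: ctson_ReM; last exact: k_ccts.
  by apply: (@ccts_lip _ _ _ 0) => *; rewrite subrr cabs0 mul0r.
apply/eqP; rewrite -subr_eq0 -normr_le0; apply/ler_addgt0Pl => e e0; rewrite addr0.
have e'0 : 0 < e / (K * tp + 1) by rewrite divr_gt0 // ltr_wpDl // mulr_ge0 // ltW.
have [r r0 H] := fcts (ltW ax) e'0.
pose d := Num.min 1 (r / (4 * s)).
have d0 : 0 < d by rewrite /d lt_min ltr01 divr_gt0 // mulr_gt0.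
have d1 : d <= 1 by rewrite /d ge_min lexx.
have dp : 0 <= d <= 1 by rewrite ltW.
rewrite -(m_cst d0 d1) /m -RIB //; last exact: m_ccts.
apply: (@le_trans _ _ (e / (K * tp + 1) * K * (tp - 0))).
  apply: RI_norm_le => // [|t _]; first by apply: ctsonB => //; exact: m_ccts.
  rewrite -ReN -ReD -mulrBl (le_trans (Re_le_cabs _)) // cabsM.
  apply: ler_pM => //; [exact: cabs_ge0|exact: cabs_ge0|]; apply: H.
  rewrite /pt addrC addKr cabsM cabs_ofR ger0_norm ?(ltW d0) //.
  have : d <= r / (4 * s) by rewrite /d ge_min lexx orbT.
  rewrite ler_pdivlMr ?mulr_gt0 // => dr.
  have := ler_wpM2l (ltW d0) (eta_le t); have := mulr_gt0 d0 s0; lra.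
have q0 : 0 <= K * tp by rewrite mulr_ge0 // ltW.
by rewrite subr0 -mulrA mulrAC ler_pdivrMr ?ltr_wpDl // ler_pM2l // lerDl.
Qed.

End CauchyFormula.

(** * Differentiation rules in pointwise form *)

Section NumFieldDerivatives.
Variable K : numFieldType.
Implicit Types (f g : K -> K) (c b z : K).

Lemma derivable_mull c f z : derivable f z 1 -> derivable (fun w => c * f w) z 1.
Proof.
move=> df; exact: (@derivableM K _ (fun=> c) f z 1 (@derivable_cst K _ _ c _ _) df).
Qed.

Lemma derivable_mul f g z : derivable f z 1 -> derivable g z 1 ->
  derivable (fun w => f w * g w) z 1.
Proof. exact: derivableM. Qed.

Lemma derivable_add f g z : derivable f z 1 -> derivable g z 1 ->
  derivable (fun w => f w + g w) z 1.
Proof. exact: derivableD. Qed.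

Lemma derivable_affine c b z : derivable (fun w : K => c + b * w) z 1.
Proof.
apply: derivable_add; first exact: derivable_cst.
by apply: derivable_mull; exact: derivable_id.
Qed.

Lemma derivable_inv f z : f z != 0 -> derivable f z 1 -> derivable (fun w => (f w)^-1) z 1.
Proof. exact: derivableV. Qed.

Lemma derivable_pow f n z : derivable f z 1 -> derivable (fun w => f w ^+ n) z 1.
Proof.
move=> df; elim: n => [|n IH].
  under [X in derivable X]eq_fun do rewrite expr0; exact: derivable_cst.
under [X in derivable X]eq_fun do rewrite exprS; exact: derivable_mul.
Qed.

Lemma derive_pow f n z : derivable f z 1 ->
  'D_1 (fun w => f w ^+ n.+1) z = n.+1%:R * f z ^+ n * 'D_1 f z.
Proof.
move=> df; elim: n => [|n IH].
  by rewrite expr0 !mul1r; congr ('D_1 _ z); apply: funext => w; rewrite expr1.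
have -> : (fun w => f w ^+ n.+2) = f * (fun w => f w ^+ n.+1).
  by apply: funext => w; rewrite exprS.
rewrite deriveM //; last exact: derivable_pow.
rewrite IH /GRing.scale /= [in RHS]mulrS.
by rewrite !exprS; ring.
Qed.

Lemma derivable_mobius d b z : 1 - b * z != 0 ->
  derivable (fun w => d / (1 - b * w)) z 1.
Proof.
move=> nz; apply: derivable_mull; exact: derivable_inv.
Qed.

End NumFieldDerivatives.

(** * Mean values, Cauchy and Poisson kernels on circles *)

Section CircleMeans.
Variable R : realType.
Local Notation C := (Cplx R).
Local Notation Re := (@complex.Re R).
Local Notation Im := (@complex.Im R).
Implicit Types (z w x a c : C) (f : C -> C) (t e : R).

Lemma circle_ccts (b d : R) x f : (forall z, cabs z <= cabs x -> derivable f z 1) ->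
  ccts b d (fun t => f (x * cis t)).
Proof.
move=> df t e _ e0.
have xt : cabs (x * cis t) <= cabs x by rewrite cabsM cabs_cis mulr1.
have [r r0 H] := derivable_cabs_continuous (df _ xt) e0.
pose L := 2 * cabs x + 1; have L0 : 0 < L by rewrite ltr_wpDl // mulr_ge0 ?cabs_ge0.
exists (r / L) => [|y _]; first by rewrite divr_gt0.
rewrite ltr_pdivlMr // => yt; apply: H.
rewrite -mulrBr cabsM (le_lt_trans (ler_wpM2l (cabs_ge0 _) (cis_lip t y))) //.
by apply: le_lt_trans yt; rewrite /L; have := normr_ge0 (y - t); lra.
Qed.

Lemma ReV z : Re z^-1 = Re z / cabs z ^+ 2.
Proof. by rewrite cabs_sqr; case: z. Qed.

Lemma ImV z : Im z^-1 = - Im z / cabs z ^+ 2.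
Proof. by rewrite cabs_sqr mulNr; case: z. Qed.

Lemma CiCi : Ci R * Ci R = -1.
Proof. by apply: Cplx_eq; rewrite ?ReM ?ImM ?ReN ?ImN /=; ring. Qed.

(** The case a = 0 of the contraction, where the kernel is the constant [Ci]; applying it to - i f
    removes that factor. *)
Lemma mean_value x f : (forall z, cabs z <= cabs x -> derivable f z 1) ->
  RI 0 (pi *+ 2) (fun t => Re (f (x * cis t))) = pi *+ 2 * Re (f 0).
Proof.
move=> df; have pi20 : 0 <= pi *+ 2 :> R by rewrite mulrn_wge0 // pi_ge0.
have [x0|x0] := eqVneq x 0.
  rewrite (_ : RI _ _ _ = RI 0 (pi *+ 2) (fun=> Re (f 0))).
    by rewrite RI_cst // subr0 mulrC.
  by apply: RI_eq => t _; rewrite x0 mul0r.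
have cx : cabs (0 : C) < cabs x by rewrite cabs0 cabs_gt0.
have := circle_integral_eq cx (fun z zx => @derivable_mull C (- Ci R) f z (df z zx)).
have E t : Ci R * (x * cis t) / (x * cis t - 0) = Ci R.
  by rewrite subr0 mulfK // -cabs_eq0 cabsM cabs_cis mulr1 cabs_eq0.
under RI_eq do rewrite E mulrC mulrA mulrN CiCi opprK mul1r.
under [RHS]RI_eq do rewrite E mulrC mulrA mulrN CiCi opprK mul1r.
by move=> ->; rewrite RI_cst // subr0 mulrC.
Qed.

(** The kernel is not analytic inside the circle, but on it conj z = |x|^2 / z turns its conjugate
    into 1 / (1 - conj a z / |x|^2), which is analytic with value 1 at 0. The mean value property
    replaces a residue computation. *)
Lemma cauchy_kernel_mean a x c : cabs a < cabs x ->
  RI 0 (pi *+ 2) (fun t => Re (c * (x * cis t / (x * cis t - a)))) = pi *+ 2 * Re c.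
Proof.
move=> ax; have s0 : 0 < cabs x by exact: le_lt_trans (cabs_ge0 _) ax.
pose s2 := ofR (cabs x ^+ 2).
have s20 : s2 != 0 by rewrite -cabs_gt0 cabs_ofR normr_gt0 expf_neq0 // gt_eqF.
pose f z := conj c * (1 - conj a / s2 * z)^-1.
have den z : cabs z <= cabs x -> 1 - conj a / s2 * z != 0.
  move=> zx; rewrite -cabs_gt0.
  apply: lt_le_trans (cabs_dist _ _); rewrite cabs1 subr_gt0.
  rewrite !cabsM cabsV cabs_conj cabs_ofR ger0_norm ?sqr_ge0 //.
  rewrite mulrAC ltr_pdivrMr ?exprn_gt0 // mul1r expr2.
  by rewrite (@le_lt_trans _ _ (cabs a * cabs x)) ?ler_wpM2l ?cabs_ge0 // ltr_pM2r.
have df z : cabs z <= cabs x -> derivable f z 1.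
  by move=> /den zx; exact: derivable_mobius.
have := mean_value df; rewrite {2}/f mulr0 subr0 invr1 mulr1 Re_conj => <-.
apply: RI_eq => t _; rewrite -[LHS]Re_conj /f; congr (Re _).
have xt0 : x * cis t != 0 by rewrite -cabs_eq0 cabsM cabs_cis mulr1 gt_eqF.
have xta : x * cis t - a != 0.
  by rewrite -cabs_gt0 (lt_le_trans _ (cabs_dist _ _)) // subr_gt0 cabsM cabs_cis mulr1.
rewrite !conjM conjV conjB.
have E : x * cis t * conj (x * cis t) = s2 by rewrite mul_conj cabsM cabs_cis mulr1.
rewrite -conjM; congr (_ * _).
have cxt : conj (x * cis t) != 0 by rewrite -cabs_eq0 cabs_conj cabs_eq0.
have cxa : conj (x * cis t) - conj a != 0 by rewrite -conjB -cabs_eq0 cabs_conj cabs_eq0.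
move: (x * cis t) (conj (x * cis t)) (conj a) xt0 E cxt cxa => u v b u0 E v0 vb.
by rewrite -E; field; rewrite u0 v0 vb.
Qed.

Lemma cauchy_formula a x f : cabs a < cabs x ->
  (forall z, cabs z <= cabs x -> derivable f z 1) ->
  RI 0 (pi *+ 2) (fun t => Re (f (x * cis t) * (x * cis t / (x * cis t - a)))) =
  pi *+ 2 * Re (f a).
Proof.
move=> ax df; rewrite -(cauchy_kernel_mean (f a) ax).
have := circle_integral_eq ax (fun z zx => @derivable_mull C (- Ci R) f z (df z zx)).
have E (u v : C) : - Ci R * u * (Ci R * v / (v - a)) = u * (v / (v - a)).
  rewrite -[RHS]mul1r -[X in _ = X * _]opprK -CiCi; ring.
by under RI_eq do rewrite E; under [RHS]RI_eq do rewrite E.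
Qed.

(** Up to the constant 1 - |a x|^2 the integrand is the real part of (1 + w) / (1 - w) with w = conj
    a z, whose value at the centre is 1. *)
Lemma poisson_kernel_mean a x : cabs a * cabs x < 1 ->
  RI 0 (pi *+ 2) (fun t => (cabs (1 - conj a * (x * cis t)) ^+ 2)^-1) =
  pi *+ 2 / (1 - (cabs a * cabs x) ^+ 2).
Proof.
move=> ax; pose f z := (1 + conj a * z) * (1 - conj a * z)^-1.
have den z : cabs z <= cabs x -> 1 - conj a * z != 0.
  move=> zx; rewrite -cabs_gt0; apply: lt_le_trans (cabs_dist _ _).
  rewrite cabs1 subr_gt0 cabsM cabs_conj (le_lt_trans _ ax) //.
  by rewrite ler_wpM2l ?cabs_ge0.
have df z : cabs z <= cabs x -> derivable f z 1.
  move=> /den zx; apply: derivable_mul; first exact: derivable_affine.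
  by have := @derivable_mobius C 1 _ _ zx; under eq_fun do rewrite mul1r.
have r0 : 0 < 1 - (cabs a * cabs x) ^+ 2.
  by rewrite subr_gt0 expr_lt1 // mulr_ge0 ?cabs_ge0.
rewrite (_ : pi *+ 2 / _ = (1 - (cabs a * cabs x) ^+ 2)^-1 * (pi *+ 2 * Re (f 0))); last first.
  by rewrite /f mulr0 addr0 subr0 invr1 mulr1 [Re 1]/= mulr1 mulrC.
rewrite -(mean_value df) -RIZ; last by apply: ccts_Re; exact: circle_ccts.
apply: RI_eq => t _; rewrite /f.
have xt : cabs (x * cis t) <= cabs x by rewrite cabsM cabs_cis mulr1.
have : cabs (conj a * (x * cis t)) ^+ 2 = (cabs a * cabs x) ^+ 2.
  by rewrite !cabsM cabs_conj cabs_cis mulr1.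
have := den _ xt; move: r0; rewrite -[X in ~~ X -> _]cabs_eq0 => r0 dn0 E.
rewrite -E in r0 *; move: dn0 r0; case: (conj a * (x * cis t)) => p q.
rewrite -sqrf_eq0 ReM ReV ImV !cabs_sqr !(ReD, ImD, ReN, ImN) /=.
set D := (X in _ = _ * (_ * (_ / X) - _)) => D0 h2.
rewrite [X in _ = _ * X](_ : _ = (1 - (p ^+ 2 + q ^+ 2)) / D).
  by rewrite mulrA mulVf ?mul1r // gt_eqF.
by rewrite !mulrA -mulrBl; congr (_ / _); ring.
Qed.

End CircleMeans.

(** * The area measure in polar coordinates *)

Section AreaMeasure.
Variable R : realType.
Local Notation mu := (@lebesgue_measure R).
Local Notation area := (@area R).
Local Notation rad := (@Defs.rad R).
Local Open Scope ereal_scope.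
Implicit Types (G : R -> \bar R) (F : R * R -> \bar R).

Lemma integral_shift G (c : R) : measurable_fun setT G -> (forall x, 0 <= G x) ->
  \int[mu]_y G (y + c)%R = \int[mu]_y G y.
Proof.
move=> mG G0.
have mphi : measurable_fun setT (fun y : R => y + c : measurableTypeR R)%R.
  exact: measurable_funD.
transitivity (\int[pushforward mu (fun y : R => y + c : measurableTypeR R)%R]_y G y).
  by rewrite ge0_integral_pushforward.
apply: eq_measure_integral => A mA _; apply/esym/lebesgue_measure_unique => //= _ [[a b]] _ <-.
rewrite /pushforward (_ : _ @^-1` _ = `](a - c)%R, (b - c)%R]%classic); last first.
  by apply/seteqP; split=> y /=; rewrite !in_itv /= ltrBlDr lerBrDr.
rewrite !lebesgue_measure_itv /= !lte_fin ltrD2r; case: ifPn => // _.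
by rewrite -!EFinB; congr (_%:E); ring.
Qed.

Lemma integral_scale G (c : R) : (0 < c)%R -> measurable_fun setT G -> (forall x, 0 <= G x) ->
  \int[mu]_y G y = c%:E * \int[mu]_y G (c * y)%R.
Proof.
move=> c0 mG G0.
have mphi : measurable_fun [set: measurableTypeR R]
    (fun y : measurableTypeR R => c * y : measurableTypeR R)%R.
  exact: (@measurable_funM _ R R).
have mG' : measurable_fun [set: measurableTypeR R] G by exact: mG.
have c0' : (0 <= c)%R by exact: ltW.
have G0' : {in setT, forall y, 0 <= G y} by move=> y _.
have := ge0_integral_pushforward mphi mu measurableT mG' G0'; rewrite preimage_setT => <-.
rewrite -(ge0_integral_mscale _ measurableT (NngNum c0')) //; apply: eq_measure_integral => A mA _.
apply: lebesgue_measure_unique => //= _ [[a b]] _ <-.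
rewrite /mscale /= /pushforward (_ : _ @^-1` _ = `](a / c)%R, (b / c)%R]%classic); last first.
  by apply/seteqP; split=> y /=; rewrite !in_itv /= ltr_pdivrMr // ler_pdivlMr // (mulrC c).
rewrite !lebesgue_measure_itv /= !lte_fin ltr_pM2r ?invr_gt0 //; case: ifPn => // _; last first.
  by rewrite mule0.
by rewrite -!EFinB -EFinM -mulrBl mulrCA divff ?gt_eqF // mulr1.
Qed.

Lemma measurable_pair (f g : R * R -> R) :
  measurable_fun setT f -> measurable_fun setT g ->
  measurable_fun setT (fun x => (f x, g x)).
Proof. exact: measurable_fun_pair. Qed.

Lemma area_shear1 F (k : R) : measurable_fun setT F -> (forall x, 0 <= F x) ->
  \int[area]_x F (x.1, x.2 + k * x.1)%R = \int[area]_x F x.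
Proof.
move=> mF F0.
have mS : measurable_fun setT (fun x : R * R => (x.1, x.2 + k * x.1)%R).
  apply: measurable_pair => //; apply: measurable_funD => //; exact: measurable_funM.
rewrite /area !fubini_tonelli1 //; last exact: (measurableT_comp mF mS).
apply: eq_integral => x _; rewrite /fubini_F /=.
rewrite (integral_shift (G := fun y => F (x, y))) //.
exact: (measurableT_comp mF (@measurable_pair1 _ _ _ _ _)).
Qed.

Lemma area_shear2 F (k : R) : measurable_fun setT F -> (forall x, 0 <= F x) ->
  \int[area]_x F (x.1 + k * x.2, x.2)%R = \int[area]_x F x.
Proof.
move=> mF F0.
have mS : measurable_fun setT (fun x : R * R => (x.1 + k * x.2, x.2)%R).
  apply: measurable_pair => //; apply: measurable_funD => //; exact: measurable_funM.
rewrite /area !fubini_tonelli2 //; last exact: (measurableT_comp mF mS).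
apply: eq_integral => y _; rewrite /fubini_G /=.
rewrite (integral_shift (G := fun x => F (x, y))) //.
exact: (measurableT_comp mF (@measurable_pair2 _ _ _ _ _)).
Qed.

Definition rot (c s : R) (x : R * R) : R * R := (c * x.1 - s * x.2, s * x.1 + c * x.2)%R.

Lemma measurable_rot c s : measurable_fun setT (rot c s).
Proof.
apply: measurable_pair; first by apply: measurable_funB; exact: measurable_funM.
by apply: measurable_funD; exact: measurable_funM.
Qed.

(* A rotation other than the half-turn is a product of three shears. *)
Lemma area_rot F (c s : R) : (c ^+ 2 + s ^+ 2 = 1)%R ->
  measurable_fun setT F -> (forall x, 0 <= F x) ->
  \int[area]_x F (rot c s x) = \int[area]_x F x.
Proof.
move=> cs1 mF F0.
have gen d t H : (d != -1)%R -> (d ^+ 2 + t ^+ 2 = 1)%R -> measurable_fun setT H ->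
    (forall x, 0 <= H x) -> \int[area]_x H (rot d t x) = \int[area]_x H x.
  move=> d1 dt mH H0; have d10 : (1 + d != 0)%R by rewrite addrC -[1%R]opprK subr_eq0.
  (* With d the cosine and t the sine, this is minus the tangent of the half angle; the shears have
     coefficients k, t, k. *)
  pose k := (- t / (1 + d))%R.
  have k1 : (k * (1 + d) = - t)%R by rewrite /k divfK.
  have kt : (t * k = d - 1)%R.
    by apply: (mulIf d10); rewrite -mulrA k1 mulrN -expr2 -[X in (- X)%R](addKr (d ^+ 2)%R) dt; ring.
  pose G1 x := H (x.1 + k * x.2, x.2)%R.
  pose G2 x := G1 (x.1, x.2 + t * x.1)%R.
  have mG1 : measurable_fun setT G1.
    apply: (measurableT_comp mH); apply: measurable_pair => //.
    by apply: measurable_funD => //; exact: measurable_funM.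
  have mG2 : measurable_fun setT G2.
    apply: (measurableT_comp mG1); apply: measurable_pair => //.
    by apply: measurable_funD => //; exact: measurable_funM.
  have G10 x : 0 <= G1 x by exact: H0.
  have G20 x : 0 <= G2 x by exact: G10.
  rewrite -(area_shear2 k mH H0) -/G1 -(area_shear1 t mG1 G10) -/G2 -(area_shear2 k mG2 G20).
  apply: eq_integral => -[x y] _; rewrite /G2 /G1 /rot /=; congr (H (_, _)).
    rewrite (_ : (x + k * y + k * (y + t * (x + k * y)) = x + t * k * x + k * (1 + (1 + t * k)) * y)%R).
      by rewrite kt (addrC 1%R (d - 1)%R) subrK k1; ring.
    by ring.
  rewrite (_ : (y + t * (x + k * y) = t * x + (1 + t * k) * y)%R); last by ring.
  by rewrite kt; ring.
(* The half-turn, where [k] is undefined, is the square of the quarter-turn [rot 0 1]. *)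
have [c1|] := eqVneq c (-1)%R; last by move=> /gen; exact.
have s0 : s = 0%R.
  by move: cs1; rewrite c1 sqrrN expr1n => /(canRL (addKr _)); rewrite addNr => /eqP; rewrite sqrf_eq0 => /eqP.
have q1 : (0 != -1 :> R)%R by rewrite eq_sym oppr_eq0 oner_eq0.
have q2 : ((0 : R) ^+ 2 + 1 ^+ 2 = 1)%R by rewrite expr0n expr1n add0r.
have mF' : measurable_fun setT (F \o rot 0 1) by apply: measurableT_comp => //; exact: measurable_rot.
rewrite -(gen _ _ _ q1 q2 mF F0) -(gen _ _ _ q1 q2 mF' (fun x => F0 _)).
apply: eq_integral => -[x y] _; rewrite /rot /= c1 s0; congr (F (_, _)); by ring.
Qed.

Lemma measurable_rad : measurable_fun setT rad.
Proof.
apply: (measurableT_comp (f := @Num.sqrt R)).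
  by apply: continuous_measurable_fun; exact: sqrt_continuous.
by apply: measurable_funD; apply: measurable_funX.
Qed.

Lemma ge0_integral_halves G : measurable_fun setT G -> (forall x, 0 <= G x) ->
  (forall x, G (- x)%R = G x) -> \int[mu]_x G x = 2%:E * \int[mu]_(x in `[0%R, +oo[) G x.
Proof.
move=> mG G0 Gev.
have -> : [set: R] = `]-oo, 0%R] `|` `]0%R, +oo[.
  by rewrite -itv_bndbnd_setU //= -set_itvNyy.
rewrite ge0_integral_setU //=.
- rewrite integral_itv_obnd_cbnd; last exact: measurable_funTS.
  have := ge0_integration_by_substitution0 mG G0.
  by under [X in _ = X]eq_integral do rewrite Gev; move=> <-; rewrite mule_natl mule2n.
- exact: measurable_funTS.
- by apply/disj_setPS => x [] /=; rewrite !in_itv /= andbT => x0 /(le_lt_trans x0); rewrite ltxx.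
Qed.

Lemma integral_inv_oneDsqr : \int[mu]_u ((1 + u ^+ 2)^-1)%:E = pi%:E.
Proof.
rewrite ge0_integral_halves.
- have := @integral0y_oneDsqr R; rewrite /oneDsqr => ->.
  by rewrite -EFinM mulrCA mulfV ?mulr1 // gt_eqF.
- apply/measurable_EFinP; apply: continuous_measurable_fun => u.
  exact: continuous_oneDsqrV.
- by move=> u; rewrite lee_fin invr_ge0 addr_ge0 // sqr_ge0.
- by move=> u; rewrite sqrrN.
Qed.

(* Polar coordinates without angles: in each fibre substitute y = |x| u, swap the
   integrals, and rescale x by (1 + u^2)^(1/2). *)
Lemma area_radial G : measurable_fun setT G -> (forall x, 0 <= G x) ->
  \int[area]_x G (rad x) = (2 * pi)%:E * \int[mu]_(r in `[0%R, +oo[) (r%:E * G r).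
Proof.
move=> mG G0.
pose H (r : R) := `|r|%:E * G `|r|%R.
have mabs : measurable_fun [set: R] (fun r : R => `|r|%R).
  by apply: measurableT_comp.
have mH : measurable_fun setT H.
  by apply: emeasurable_funM; [exact/measurable_EFinP|exact: measurableT_comp].
have H0 r : 0 <= H r by rewrite mule_ge0 // lee_fin.
have -> : (2 * pi)%:E * \int[mu]_(r in `[0%R, +oo[) (r%:E * G r) = pi%:E * \int[mu]_r H r.
  rewrite ge0_integral_halves //; last by move=> r; rewrite /H normrN.
  rewrite EFinM -muleA muleCA; congr (_ * (_ * _)); apply: eq_integral => r.
  by rewrite inE /= in_itv /= andbT => r0; rewrite /H ger0_norm.
pose K (p : R * R) := `|p.1|%:E * G (rad (p.1, `|p.1| * p.2)%R).
have mK : measurable_fun setT K.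
  apply: emeasurable_funM.
    by apply/measurable_EFinP; exact: (measurableT_comp mabs).
  apply: (measurableT_comp mG); apply: (measurableT_comp measurable_rad).
  apply: measurable_pair => //; apply: measurable_funM => //.
  exact: (measurableT_comp mabs).
have K0 p : 0 <= K p by rewrite mule_ge0 // lee_fin.
have mGr : measurable_fun setT (G \o rad) by exact: (measurableT_comp mG measurable_rad).
rewrite /area fubini_tonelli1 //.
have mKF : measurable_fun setT (fun x => \int[mu]_u K (x, u)).
  exact: (@measurable_fun_fubini_tonelli_F _ _ _ _ _ mu K mK K0).
transitivity (\int[mu]_x \int[mu]_u K (x, u)).
  rewrite -[LHS](@integral_setD1 _ _ 0%R); last 2 first.
  - exact: measurableD.
  - by apply: measurable_funTS; exact: measurable_fun_fubini_tonelli_F.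
  rewrite -[RHS](@integral_setD1 _ _ 0%R); last 2 first.
  - exact: measurableD.
  - by apply: measurable_funTS; exact: mKF.
  apply: eq_integral => x; rewrite inE /= => -[_ /eqP x0].
  rewrite /fubini_F /=.
  have mGx : measurable_fun setT (fun y => G (rad (x, y))).
    exact: (measurableT_comp mGr (@measurable_pair1 _ _ _ _ _)).
  have mGx' : measurable_fun setT (fun y => G (rad (x, `|x| * y)%R)).
    by apply: (measurableT_comp mGx); exact: measurable_funM.
  by rewrite (integral_scale (c := `|x|%R)) ?normr_gt0 // /K /= ge0_integralZl.
rewrite (@fubini_tonelli _ _ _ _ _ mu mu K) //.
transitivity (\int[mu]_u (((1 + u ^+ 2)^-1)%:E * \int[mu]_r H r)).
  apply: eq_integral => u _; pose s := Num.sqrt (1 + u ^+ 2).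
  have u0 : (0 < 1 + u ^+ 2)%R by rewrite ltr_pwDl // sqr_ge0.
  have s0 : (0 < s)%R by rewrite sqrtr_gt0.
  have Ks x : H (s * x)%R = s%:E * K (x, u).
    rewrite /H /K /= normrM (gtr0_norm s0) EFinM muleA; congr (_ * G _).
    rewrite /rad /= exprMn real_normK ?num_real // (_ : (_ + _ = (1 + u ^+ 2) * x ^+ 2)%R); last by ring.
    by rewrite sqrtrM ?(ltW u0) // sqrtr_sqr.
  have mKu : measurable_fun setT (fun x => K (x, u)).
    exact: (measurableT_comp mK (@measurable_pair2 _ _ _ _ _)).
  rewrite (integral_scale s0 mH H0); under [X in _ = _ * (_ * X)]eq_integral do rewrite Ks.
  rewrite ge0_integralZl ?lee_fin ?(ltW s0) // !muleA -!EFinM.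
  by rewrite -mulrA -expr2 sqr_sqrtr ?(ltW u0) // mulVf ?gt_eqF // mul1e.
rewrite ge0_integralZr //; first by rewrite integral_inv_oneDsqr.
- apply/measurable_EFinP; apply: continuous_measurable_fun => u; exact: continuous_oneDsqrV.
- by move=> u _; rewrite lee_fin invr_ge0 addr_ge0 // sqr_ge0.
- exact: integral_ge0.
Qed.

Lemma area_sigma_finite : sigma_finite setT area.
Proof.
have /sigma_finiteP[F [TF ndF Foo]] := sigma_finiteT mu.
exists (fun n => F n `*` F n).
 rewrite -setXTT TF predeqE => -[x y]; split.
    move=> [/= [n _ Fnx] [k _ Fky]]; exists (maxn n k) => //; split.
    - by move: x Fnx; exact/subsetPset/ndF/leq_maxl.
    - by move: y Fky; exact/subsetPset/ndF/leq_maxr.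
  by move=> [n _ []/= ? ?]; split; exists n.
move=> k; have [? ?] := Foo k; split; first exact: measurableX.
by rewrite /Defs.area product_measure1E // lte_mul_pinfty // ge0_fin_numE.
Qed.

HB.instance Definition _ := Measure.on area.
HB.instance Definition _ := Measure_isSigmaFinite.Build _ _ R area area_sigma_finite.

(** The angular half of polar coordinates: rotation invariance averaged over the angle, with the
    integrals exchanged. It reduces estimates of area integrals to estimates on single circles. *)
Lemma area_circle_mean F : measurable_fun setT F -> (forall x, 0 <= F x) ->
  (pi *+ 2)%:E * \int[area]_x F x =
  \int[area]_x \int[mu]_(t in `[0%R, (pi *+ 2)%R]) F (rot (cos t) (sin t) x).
Proof.
move=> mF F0; pose D := `[0%R, (pi *+ 2)%R]%classic : set R.
have mD : measurable D by exact: measurable_itv.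
pose H (p : R * R * R) := F (rot (cos p.2) (sin p.2) p.1) * (\1_D p.2)%:E.
have mcos : measurable_fun setT (fun p : R * R * R => cos p.2).
  apply: (measurableT_comp (f := @cos R)) => //.
  by apply: continuous_measurable_fun; exact: continuous_cos.
have msin : measurable_fun setT (fun p : R * R * R => sin p.2).
  apply: (measurableT_comp (f := @sin R)) => //.
  by apply: continuous_measurable_fun; exact: continuous_sin.
have m1 : measurable_fun setT (fun p : R * R * R => p.1.1).
  exact: (measurableT_comp (f := fst) (g := fst)).
have m2 : measurable_fun setT (fun p : R * R * R => p.1.2).
  exact: (measurableT_comp (f := snd) (g := fst)).
have mH : measurable_fun setT H.
  apply: emeasurable_funM.
    apply: (measurableT_comp mF); apply: measurable_fun_pair.
      by apply: measurable_funB; apply: measurable_funM.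
    by apply: measurable_funD; apply: measurable_funM.
  have m1D : measurable_fun setT (\1_D : R -> R) by exact: measurable_indic.
  by apply/measurable_EFinP; exact: (measurableT_comp m1D).
have H0 p : 0 <= H p by rewrite mule_ge0 // lee_fin.
transitivity (\int[area]_x \int[mu]_t H (x, t)); last first.
  apply: eq_integral => x _; rewrite [RHS]integral_mkcond; apply: eq_integral => t _.
  rewrite /H patchE indicE; case: ifPn => tD; rewrite ?mule1 ?mule0 //.
have -> : \int[area]_x \int[mu]_t H (x, t) = \int[mu]_t \int[area]_x H (x, t).
  exact: (@fubini_tonelli _ _ _ _ _ area mu H mH H0).
transitivity (\int[mu]_t ((\int[area]_x F x) * (\1_D t)%:E)).
  have m1D : measurable_fun setT (EFin \o (\1_D : R -> R)).
    by apply/measurable_EFinP; exact: measurable_indic.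
  have i0 : 0 <= \int[area]_x F x by exact: integral_ge0.
  have muD : mu D = (pi *+ 2)%:E.
    by rewrite lebesgue_measure_itv /= lte_fin pmulrn_lgt0 // pi_gt0 sube0.
  by rewrite ge0_integralZl // integral_indic // setIT -muD muleC.
apply: eq_integral => t _; rewrite /H /=.
have mFr : measurable_fun setT (fun x => F (rot (cos t) (sin t) x)).
  by apply: (measurableT_comp mF); exact: measurable_rot.
by rewrite ge0_integralZr // area_rot // cos2Dsin2.
Qed.

End AreaMeasure.

(** * Radial weights *)

Section Weight.
Variable R : realType.
Local Notation mu := (@lebesgue_measure R).
Variable omega : R -> R.
Hypothesis rw : radial_weight omega.
Implicit Types (r t d : R).

(** A radial weight is constrained on [0, 1] only, so it is replaced by 0 elsewhere. Leaving out 1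
    as well makes [om (rad x)] vanish off the open disc, and integrals can range over the whole
    plane. *)
Definition om t : R := if 0 <= t < 1 then omega t else 0.

Lemma om_ge0 t : 0 <= om t.
Proof.
rewrite /om; case: ifPn => // /andP[t0 t1]; have [H _ _] := rw.
by rewrite H // t0 ltW.
Qed.

Lemma measurable_om : measurable_fun setT om.
Proof.
have [_ /measurable_int mw _] := rw.
have -> : om = omega \_ `[0, 1[.
  by apply: funext => t; rewrite patchE mem_setE in_itv.
apply/(measurable_restrictT omega) => //.
move/measurable_EFinP: mw; apply: measurable_funS => //.
by apply: subset_itvl; rewrite bnd_simp.
Qed.

Definition hat r : R := fine (omega_hat omega r).

Lemma omega_hatE r : 0 <= r <= 1 -> omega_hat omega r = (hat r)%:E.
Proof.
move=> /andP[r0 r1]; rewrite /hat fineK //; apply: integrable_fin_num => //.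
have [_ iw _] := rw; apply: integrableS iw => //.
by apply: subset_itvr; rewrite bnd_simp.
Qed.

Lemma om_tail r : 0 <= r <= 1 -> (\int[mu]_t (om t * (r <= t)%R%:R)%:E = (hat r)%:E)%E.
Proof.
move=> /[dup] /omega_hatE <- /andP[r0 r1].
rewrite /omega_hat -integral_itv_bndo_bndc; last first.
  have [_ /measurable_int mw _] := rw; apply: measurable_funS mw => //.
  by move=> t /=; rewrite !in_itv /= => /andP[/(le_trans r0) -> /ltW ->].
rewrite [RHS]integral_mkcond; apply: eq_integral => t _; rewrite patchE mem_setE in_itv /= /om.
case: (leP r t) => rt /=; last by rewrite mulr0.
by rewrite (le_trans r0 rt) /= mulr1; case: ifP.
Qed.

Lemma om_int_ge0 (f : R -> R) : (forall t, 0 <= f t) -> (0 <= \int[mu]_t (om t * f t)%:E)%E.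
Proof. by move=> f0; apply: integral_ge0 => t _; rewrite lee_fin mulr_ge0 // om_ge0. Qed.

Lemma om_int_le (f g : R -> R) : measurable_fun setT f -> measurable_fun setT g ->
  (forall t, 0 <= t < 1 -> 0 <= f t <= g t) ->
  (\int[mu]_t (om t * f t)%:E <= \int[mu]_t (om t * g t)%:E)%E.
Proof.
move=> mf mg fg; apply: ge0_le_integral => //.
- move=> t _; rewrite lee_fin /om; case: ifPn => [/[dup] t01 /fg /andP[f0 _]|]; last by rewrite mul0r.
  by have := om_ge0 t; rewrite /om t01 => /mulr_ge0; apply.
- by apply/measurable_EFinP; apply: measurable_funM => //; exact: measurable_om.
- by apply/measurable_EFinP; apply: measurable_funM => //; exact: measurable_om.
- move=> t _; rewrite lee_fin /om; case: ifPn => [/[dup] t01 /fg /andP[f0 fgt]|]; last by rewrite !mul0r.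
  by have := om_ge0 t; rewrite /om t01 => ?; rewrite ler_wpM2l.
Qed.

Lemma measurable_step r : measurable_fun setT (fun t => (r <= t)%R%:R : R).
Proof.
apply: nondecreasing_measurable => // s t st; case: (leP r s) => [rs|_]; last by rewrite ler0n.
by rewrite (le_trans rs st).
Qed.

Lemma hat_ge0 r : 0 <= r <= 1 -> 0 <= hat r.
Proof. by move=> /om_tail; rewrite -lee_fin => <-; apply: om_int_ge0 => t. Qed.

Lemma hat_le r t : 0 <= r -> r <= t -> t <= 1 -> hat t <= hat r.
Proof.
move=> r0 rt t1; rewrite -lee_fin -!om_tail ?r0 ?(le_trans rt) ?(le_trans r0 rt) //.
apply: om_int_le; [exact: measurable_step|exact: measurable_step|].
move=> s _; rewrite ler0n /= ler_nat; case: (leP t s) => // ts.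
by rewrite (le_trans rt ts).
Qed.

Lemma hat_gt0 r : 0 <= r < 1 -> 0 < hat r.
Proof.
move=> /[dup] r01 /andP[r0 r1]; have [_ _ /(_ _ r01)] := rw.
by rewrite omega_hatE ?lte_fin // r0 ltW.
Qed.

(** Radial majorant of the kernel: for d = 1 - |z| and t = |w| it bounds |b_z(w)|. *)
Definition decay d t := d / Num.max d (1 - t).

Lemma decay_ge0_le1 d t : 0 < d -> 0 <= decay d t <= 1.
Proof.
move=> d0; have m0 : 0 < Num.max d (1 - t) by rewrite lt_max d0.
by rewrite /decay divr_ge0 ?(ltW d0) ?(ltW m0) //= ler_pdivrMr // mul1r le_max lexx.
Qed.

Lemma measurable_decay (L : nat) d : 0 < d -> measurable_fun setT (fun t => decay d t ^+ L).
Proof.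
move=> d0; apply: measurable_funX; apply: nondecreasing_measurable => // s t st.
rewrite /decay ler_pM2l // lef_pV2 ?posrE ?lt_max ?d0 //.
by rewrite ge_max le_max lexx /= le_max lerD2l lerN2 st orbT.
Qed.

(* The tail beyond distance 2d from the boundary contributes 2^-L of the same integral at 2d. *)
Lemma weight_decay : (exists C : R, 1 <= C /\ forall r, 0 <= r < 1 ->
    (omega_hat omega r <= C%:E * omega_hat omega ((1 + r) / 2))%E) ->
  exists (L : nat) (A : R), 0 < A /\ forall d, 0 < d <= 1 ->
    (\int[mu]_t (om t * decay d t ^+ L)%:E <= (A * hat (1 - d))%:E)%E.
Proof.
move=> [C [C1 dbl]]; have C0 : 0 < C by exact: lt_le_trans C1.
have dblr r : 0 <= r < 1 -> hat r <= C * hat ((1 + r) / 2).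
  move=> /[dup] r01 /andP[r0 r1]; have := dbl _ r01.
  by rewrite !omega_hatE ?lee_fin //; lra.
(* As L < 2^L, this gives C / 2^L <= 1/2, and the constant 2 C reproduces itself when [d] is
   doubled. *)
pose L := (Num.truncn (2 * C)).+1.
have LC : C / 2 ^+ L <= 1 / 2.
  have : 2 * C < L%:R by exact: truncnS_gt.
  have : L%:R <= 2 ^+ L :> R by rewrite -natrX ler_nat ltnW // ltn_expl.
  by rewrite ler_pdivrMr ?exprn_gt0 //; lra.
exists L, (2 * C); split; first by rewrite mulr_gt0.
pose S d := (\int[mu]_t (om t * decay d t ^+ L)%:E)%E.
(* Induction on a bound for the number of doublings that bring [d] up to 1; for k = 0 the two
   hypotheses contradict each other. *)
suff H k d : (1 / 2) ^+ k < d -> d <= 1 -> (S d <= (2 * C * hat (1 - d))%:E)%E.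
  move=> d /andP[d0 d1].
  have [k kd] : exists k, d^-1 < k%:R by exists (Num.truncn d^-1).+1; exact: truncnS_gt.
  apply: (H k) => //; rewrite expr_div_n expr1n.
  have k2 : k%:R <= 2 ^+ k :> R by rewrite -natrX ler_nat ltnW // ltn_expl.
  rewrite div1r -[ltRHS]invrK ltf_pV2 ?posrE ?exprn_gt0 ?invr_gt0 //.
  exact: lt_le_trans kd k2.
elim: k d => [|k IH] d; first by rewrite expr0 => /lt_le_trans/[apply]; rewrite ltxx.
rewrite exprS => kd d1; have d0 : 0 < d by apply: lt_trans kd; rewrite mulr_gt0 ?exprn_gt0.
have hd0 : 0 <= hat (1 - d) by apply: hat_ge0; lra.
have [d2|d2] := ltP (1 / 2) d.
  apply: (@le_trans _ _ (hat 0)%:E).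
    rewrite -om_tail ?lexx ?ler01 //; apply: om_int_le.
    - exact: measurable_decay.
    - exact: measurable_step.
    - move=> t /andP[t0 t1]; rewrite t0; have /andP[m0 m1] := decay_ge0_le1 t d0.
      by rewrite exprn_ge0 //= exprn_ile1.
  rewrite lee_fin; have := @dblr 0; rewrite lexx ltr01 addr0 => /(_ isT).
  have : hat (1 / 2) <= hat (1 - d) by apply: hat_le; lra.
  move=> h1 h2; have := ler_wpM2l (ltW C0) h1; have := mulr_ge0 (ltW C0) hd0; lra.
have d20 : 0 <= 1 - 2 * d < 1 by lra.
have dd0 : 0 < 2 * d by lra.
have p0 : 0 <= (1 / 2) ^+ L :> R by rewrite exprn_ge0 // divr_ge0.
have mS : measurable_fun setT (EFin \o (fun t => om t * decay (2 * d) t ^+ L)).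
  by apply/measurable_EFinP; apply: measurable_funM; [exact: measurable_om|exact: measurable_decay].
have mT : measurable_fun setT (EFin \o (fun t => om t * (1 - 2 * d <= t)%R%:R)).
  by apply/measurable_EFinP; apply: measurable_funM; [exact: measurable_om|exact: measurable_step].
have S0 t : (0 <= (om t * decay (2 * d) t ^+ L)%:E)%E.
  by rewrite lee_fin mulr_ge0 ?om_ge0 // exprn_ge0 //; have /andP[] := decay_ge0_le1 t dd0.
have st1 : (S d <= (hat (1 - 2 * d)%R)%:E + ((1 / 2) ^+ L)%:E * S (2 * d)%R)%E.
  rewrite -om_tail; last by lra.
  rewrite /S -ge0_integralZl //.
  rewrite -ge0_integralD //; first last.
  - by apply: emeasurable_funM => //; exact: measurable_cst.
  - by move=> t _; rewrite mule_ge0.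
  - by move=> t _; rewrite lee_fin mulr_ge0 ?om_ge0.
  apply: (@le_trans _ _ (\int[mu]_t (om t * ((1 - 2 * d <= t)%R%:R + (1 / 2) ^+ L * decay (2 * d) t ^+ L))%:E)%E).
    apply: om_int_le; first exact: measurable_decay.
      apply: measurable_funD; first exact: measurable_step.
      by apply: measurable_funM => //; exact: measurable_decay.
    move=> t /andP[t0 t1]; have /andP[m0 m1] := decay_ge0_le1 t d0.
    rewrite exprn_ge0 //=; have /andP[m2 m3] := decay_ge0_le1 t dd0.
    case: (leP (1 - 2 * d) t) => td /=.
      have e1 : decay d t ^+ L <= 1 by rewrite exprn_ile1.
      by rewrite (le_trans e1) // lerDl mulr_ge0 // exprn_ge0.
    have half0 : 0 <= 1 / 2 * decay (2 * d) t by rewrite mulr_ge0 // divr_ge0.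
    rewrite add0r -exprMn lerXn2r ?nnegrE // /decay !max_r; [|lra|lra].
    by set x := (1 - t)^-1; lra.
  rewrite le_eqVlt; apply/orP; left; apply/eqP; apply: eq_integral => t _.
  by rewrite -EFinM -EFinD; congr EFin; ring.
have st2 : ((hat (1 - 2 * d)%R)%:E + ((1 / 2) ^+ L)%:E * S (2 * d)%R <=
    (C * hat (1 - d))%:E + ((1 / 2) ^+ L)%:E * (2 * C * hat (1 - 2 * d))%:E)%E.
  apply: leeD.
    rewrite lee_fin; have := dblr _ d20; suff -> : (1 + (1 - 2 * d)) / 2 = 1 - d by [].
    by field.
  rewrite lee_wpmul2l ?lee_fin //; apply: IH; last by lra.
  by move: kd; rewrite div1r; lra.
apply: le_trans st1 (le_trans st2 _); rewrite -EFinM -EFinD lee_fin.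
have h1 : hat (1 - 2 * d) <= C * hat (1 - d).
  have := dblr _ d20; suff -> : (1 + (1 - 2 * d)) / 2 = 1 - d by [].
  by field.
have h2 : (1 / 2) ^+ L * C <= 1 / 2 by rewrite expr_div_n expr1n mulrC mulrA mulr1.
have h3 : 0 <= hat (1 - 2 * d) by apply: hat_ge0; lra.
have := ler_wpM2r h3 h2; lra.
Qed.

End Weight.

(** * Measurability of analytic functions and the test kernels *)

Section ComplexMeasurability.
Variable R : realType.
Local Notation C := (Cplx R).
Local Notation Re := (@complex.Re R).
Local Notation Im := (@complex.Im R).
Local Notation rad := (@Defs.rad R).
Context d (T : measurableType d).
Implicit Types (D : set T) (g h : T -> C).

Definition cmeas D g := measurable_fun D (fun x => Re (g x)) /\ measurable_fun D (fun x => Im (g x)).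

Lemma cmeas_cst D (c : C) : cmeas D (fun=> c).
Proof. by split; exact: measurable_cst. Qed.

Lemma cmeasD D g h : cmeas D g -> cmeas D h -> cmeas D (fun x => g x + h x).
Proof.
move=> [g1 g2] [h1 h2]; split.
  by under eq_fun do rewrite ReD; exact: measurable_funD.
by under eq_fun do rewrite ImD; exact: measurable_funD.
Qed.

Lemma cmeasN D g : cmeas D g -> cmeas D (fun x => - g x).
Proof.
move=> [g1 g2]; split.
  by under eq_fun do rewrite ReN; exact: measurable_funN.
by under eq_fun do rewrite ImN; exact: measurable_funN.
Qed.

Lemma cmeasB D g h : cmeas D g -> cmeas D h -> cmeas D (fun x => g x - h x).
Proof. by move=> mg mh; apply: cmeasD => //; exact: cmeasN. Qed.

Lemma cmeasM D g h : cmeas D g -> cmeas D h -> cmeas D (fun x => g x * h x).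
Proof.
move=> [g1 g2] [h1 h2]; split.
  by under eq_fun do rewrite ReM; apply: measurable_funB; exact: measurable_funM.
by under eq_fun do rewrite ImM; apply: measurable_funD; exact: measurable_funM.
Qed.

Lemma cmeas_conj D g : cmeas D g -> cmeas D (fun x => conj (g x)).
Proof. by move=> [g1 g2]; split=> //=; exact: measurable_funN. Qed.

Lemma measurable_cabs D g : cmeas D g -> measurable_fun D (fun x => cabs (g x)).
Proof.
move=> [g1 g2]; apply: (measurableT_comp (f := @Num.sqrt R)).
  by apply: continuous_measurable_fun; exact: sqrt_continuous.
by apply: measurable_funD; exact: measurable_funX.
Qed.

Lemma measurable_inv_ge0 D (f : T -> R) : (forall x, 0 <= f x) ->
  measurable_fun D f -> measurable_fun D (fun x => (f x)^-1).
Proof.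
move=> f0 mf; under eq_fun do rewrite -powR_inv1 //.
exact: (measurableT_comp (@measurable_powR R _)).
Qed.

Definition rnd (n : nat) (r : R) : R := (Num.floor (r * n.+1%:R))%:~R / n.+1%:R.
(** Rounding serves twice: it takes countably many values, which gives measurability of
    compositions, and finitely many on the unit disc, which gives compact approximations. *)
Definition grd n (z : C) : C := (rnd n (Re z) +i* rnd n (Im z))%C.

Lemma rnd_dist n r : `|rnd n r - r| <= n.+1%:R^-1.
Proof.
have n0 : 0 < n.+1%:R :> R by rewrite ltr0n.
rewrite /rnd -[X in `|_ - X|](mulfK (lt0r_neq0 n0)) -mulrBl normrM.
rewrite [X in _ * X]ger0_norm ?invr_ge0 ?(ltW n0) // ler_piMl ?invr_ge0 ?(ltW n0) //.
have /andP[h1 h2] := floor_itv (r * n.+1%:R).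
by rewrite ler_norml; move: h2; rewrite intrD; lra.
Qed.

Lemma grd_dist n (z : C) : cabs (grd n z - z) <= 2 / n.+1%:R.
Proof.
rewrite (le_trans (cabs_leD _)) // ReD ImD ReN ImN /=.
by rewrite mulrDl mul1r lerD // rnd_dist.
Qed.

(** Holds for arbitrary [h]: the preimage is a countable union, indexed by coded pairs of integers,
    of measurable cells on which the rounded value is constant. *)
Lemma measurable_grd D n (h : C -> R) g : measurable D -> cmeas D g ->
  measurable_fun D (fun x => h (grd n (g x))).
Proof.
move=> mD [g1 g2] _ Y mY.
pose A (f : T -> R) (i : int) := D `&` [set x | Num.floor (f x * n.+1%:R) = i].
have mA f i : measurable_fun D f -> measurable (A f i).
  move=> mf; rewrite /A (_ : [set _ | _] = (fun x => f x * n.+1%:R) @^-1` `[i%:~R, (i + 1)%:~R[).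
    by apply: measurable_funM => //; exact: measurable_itv.
  by apply/seteqP; split=> x /=; rewrite in_itv /= -floor_eq => /eqP.
pose pt (ij : int * int) : C := (ij.1%:~R / n.+1%:R +i* (ij.2%:~R / n.+1%:R))%C.
pose B k := if unpickle k is Some ij then
  if h (pt ij) \in Y then A (fun x => Re (g x)) ij.1 `&` A (fun x => Im (g x)) ij.2 else set0
  else set0.
rewrite (_ : _ `&` _ = \bigcup_k B k).
  apply: bigcup_measurable => k _; rewrite /B; case: unpickle => [ij|//].
  by case: ifP => // _; apply: measurableI; exact: mA.
apply/seteqP; split=> x.
  move=> [Dx Yx]; exists (pickle (Num.floor (Re (g x) * n.+1%:R), Num.floor (Im (g x) * n.+1%:R))); first exact: I.
  by rewrite /B pickleK ifT ?inE.
move=> [k _]; rewrite /B; case: unpickle => [[i j]|//]; case: ifP => // hY [[Dx /= ix] [_ /= jx]].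
split=> //=; move: hY; rewrite inE /pt /= /grd /rnd.
by rewrite -ix -jx.
Qed.

(** [f] is controlled only at points of the disc; continuity at g(x) shows that its values at the
    rounded points, which are measurable, converge to f(g(x)). *)
Lemma cmeas_analytic D g (f : C -> C) : measurable D -> cmeas D g ->
  (forall x, D x -> cabs (g x) < 1) -> analytic_on_disc f -> cmeas D (fun x => f (g x)).
Proof.
move=> mD mg gD af.
have cv (p : C -> R) x : D x -> (forall z w, `|p z - p w| <= cabs (z - w)) ->
    (fun n => p (f (grd n (g x)))) @ \oo --> p (f (g x)).
  move=> Dx pl; apply/cvgrPdist_le => e e0.
  have dgx : derivable f (g x) 1 by apply: af; rewrite inE; exact: gD.
  have [r r0 H] := derivable_cabs_continuous dgx e0.
  exists (Num.truncn (2 / r)) => // n /= nr.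
  rewrite distrC (le_trans (pl _ _)) // H // (le_lt_trans (grd_dist _ _)) //.
  rewrite ltr_pdivrMr ?ltr0n // mulrC -ltr_pdivrMr //.
  by rewrite (lt_le_trans (truncnS_gt _)) // ler_nat ltnS.
split.
  apply: (@measurable_fun_cvg _ _ _ D (fun n x => Re (f (grd n (g x))))) => [n|x Dx].
    exact: (@measurable_grd D n (fun z => Re (f z))).
  by apply: (cv Re) => // z w; rewrite -ReN -ReD Re_le_cabs.
apply: (@measurable_fun_cvg _ _ _ D (fun n x => Im (f (grd n (g x))))) => [n|x Dx].
  exact: (@measurable_grd D n (fun z => Im (f z))).
by apply: (cv Im) => // z w; rewrite -ImN -ImD Im_le_cabs.
Qed.

End ComplexMeasurability.

(** * The disc in the real plane and the kernel b_z *)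

Section DiscGeometry.
Variable R : realType.
Local Notation C := (Cplx R).
Local Notation Re := (@complex.Re R).
Local Notation Im := (@complex.Im R).
Local Notation rad := (@Defs.rad R).
Implicit Types (z w : C) (x : R * R).

Lemma cabs_toC x : cabs (toC x) = rad x. Proof. by []. Qed.

Lemma rad_ge0 x : 0 <= rad x. Proof. exact: sqrtr_ge0. Qed.

Lemma toC_rot x (t : R) : toC (rot (cos t) (sin t) x) = toC x * cis t.
Proof. by apply: Cplx_eq; rewrite ?ReM ?ImM /=; ring. Qed.

Lemma rad_rot x (t : R) : rad (rot (cos t) (sin t) x) = rad x.
Proof. by rewrite -!cabs_toC toC_rot cabsM cabs_cis mulr1. Qed.

Lemma cmeas_toC : cmeas setT (@toC R).
Proof. by split=> /=; [exact: measurable_fst|exact: measurable_snd]. Qed.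

Lemma measurable_discR : measurable (@discR R).
Proof.
rewrite (_ : @discR R = setT `&` rad @^-1` `]-oo, 1[).
  by apply: measurable_rad => //; exact: measurable_itv.
by rewrite setTI; apply/seteqP; split=> x /=; rewrite in_itv.
Qed.

Lemma cmeas_cut (g : R * R -> C) : cmeas (@discR R) g ->
  cmeasurable (fun x => if x \in @discR R then g x else 0).
Proof.
have mD := measurable_discR => -[g1 g2]; split.
  rewrite (_ : (fun x => _) = (fun x => Re (g x)) \_ (@discR R)).
    exact/(measurable_restrictT _ mD).
  by apply: funext => x; rewrite patchE; case: ifP.
rewrite (_ : (fun x => _) = (fun x => Im (g x)) \_ (@discR R)).
  exact/(measurable_restrictT _ mD).
by apply: funext => x; rewrite patchE; case: ifP.
Qed.

(** The numerator is scaled so that the modulus is at most 1 on the closed disc and at least 1/2 at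
    w = z. *)
Definition bk z w : C := ofR (1 - cabs z) / (1 - conj z * w).

Lemma bk_den z w : cabs z < 1 -> cabs w <= 1 ->
  Num.max (1 - cabs z) (1 - cabs w) <= cabs (1 - conj z * w).
Proof.
move=> z1 w1; apply: (@le_trans _ _ (1 - cabs z * cabs w)).
  have z0 := cabs_ge0 z; have w0 := cabs_ge0 w; rewrite ge_max !lerD2l !lerN2.
  by rewrite ler_piMr // ler_piMl // ltW.
by rewrite -(cabs_conj z) -cabsM -{1}(cabs1 R) cabs_dist.
Qed.

Lemma bk_den_gt0 z w : cabs z < 1 -> cabs w <= 1 -> 0 < cabs (1 - conj z * w).
Proof.
by move=> z1 w1; apply: lt_le_trans (bk_den z1 w1); rewrite lt_max subr_gt0 z1.
Qed.

Lemma bk_den_neq0 z w : cabs z < 1 -> cabs w <= 1 -> 1 - conj z * w != 0.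
Proof. by move=> z1 w1; rewrite -cabs_gt0 bk_den_gt0. Qed.

Lemma cabs_bk z w : cabs z < 1 -> cabs (bk z w) = (1 - cabs z) / cabs (1 - conj z * w).
Proof.
by move=> z1; rewrite cabsM cabsV cabs_ofR ger0_norm // subr_ge0 ltW.
Qed.

Lemma cabs_bk_le z w : cabs z < 1 -> cabs w <= 1 -> cabs (bk z w) <= decay (1 - cabs z) (cabs w).
Proof.
move=> z1 w1; rewrite cabs_bk // /decay ler_wpM2l ?subr_ge0 ?(ltW z1) //.
by rewrite lef_pV2 ?bk_den // posrE ?bk_den_gt0 // lt_max subr_gt0 z1.
Qed.

Lemma cabs_bk_le1 z w : cabs z < 1 -> cabs w <= 1 -> cabs (bk z w) <= 1.
Proof.
move=> z1 w1; apply: le_trans (cabs_bk_le z1 w1) _.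
by have /andP[] : 0 <= decay (1 - cabs z) (cabs w) <= 1 by rewrite decay_ge0_le1 // subr_gt0.
Qed.

Lemma derivable_bk z w : cabs z < 1 -> cabs w <= 1 -> derivable (bk z) w 1.
Proof. by move=> z1 w1; apply: derivable_mobius; exact: bk_den_neq0. Qed.

End DiscGeometry.

Section MonotoneIntegral.
Local Open Scope ereal_scope.
Context d (T : measurableType d) (R : realType) (mu : {measure set T -> \bar R}).

(* Unlike [ge0_le_integral], no measurability is assumed. *)
Lemma le_ge0_integral (D : set T) (f g : T -> \bar R) :
  (forall x, D x -> 0 <= f x) -> (forall x, D x -> f x <= g x) ->
  \int[mu]_(x in D) f x <= \int[mu]_(x in D) g x.
Proof.
move=> f0 fg; rewrite !ge0_integralE //; last by move=> x Dx; exact: le_trans (f0 _ Dx) (fg _ Dx).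
apply: ereal_sup_le => _ [h hf <-]; exists h => // x; apply: le_trans (hf x) _.
by rewrite !patchE; case: ifPn => // /set_mem; exact: fg.
Qed.

End MonotoneIntegral.

(** * Integrals of kernel powers over circles and over the disc *)

Section KernelEstimates.
Variable R : realType.
Local Notation C := (Cplx R).
Local Notation Re := (@complex.Re R).
Local Notation rad := (@Defs.rad R).
Local Notation mu := (@lebesgue_measure R).
Local Notation area := (@area R).
Local Notation pi2 := (pi *+ 2 : R).
Local Notation circ := (`[0%R, pi2]%classic).
Variable omega : R -> R.
Hypothesis rw : radial_weight omega.
Local Notation om := (om omega).
Local Notation hat := (hat omega).
Implicit Types (z w : C) (x : R * R) (p : R).

Lemma pi2_gt0 : 0 < pi2. Proof. by rewrite pmulrn_lgt0 // pi_gt0. Qed.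

(** The real-valued integral is a [fine], which sends both infinities to 0; as the mean is positive,
    the extended integral must be finite. *)
Lemma poisson_integral z w : cabs z * cabs w < 1 ->
  (\int[mu]_(t in circ) (((cabs (1 - conj z * (w * cis t))) ^+ 2)^-1)%:E =
   (pi2 / (1 - (cabs z * cabs w) ^+ 2))%:E)%E.
Proof.
move=> zw; have := poisson_kernel_mean zw; rewrite /RI /Rintegral.
have r0 : 0 < 1 - (cabs z * cabs w) ^+ 2.
  by rewrite subr_gt0 expr_lt1 // mulr_ge0 ?cabs_ge0.
move: (integral _ _ _) => [r|/esym/eqP|/esym/eqP] /=; first by move=> ->.
  by rewrite gt_eqF // divr_gt0 // pi2_gt0.
by rewrite gt_eqF // divr_gt0 // pi2_gt0.
Qed.

Lemma cmeas_circle (D : set R) w : cmeas D (fun t => w * cis t).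
Proof.
apply: cmeasM; first exact: cmeas_cst.
split=> /=; apply: measurable_funTS; apply: continuous_measurable_fun.
  exact: continuous_cos.
exact: continuous_sin.
Qed.

Lemma measurable_bk_circle (D : set R) z w n : cabs z < 1 ->
  measurable_fun D (fun t => cabs (bk z (w * cis t)) ^+ n).
Proof.
move=> z1; apply: measurable_funX; under eq_fun do rewrite cabs_bk //.
apply: measurable_funM => //; apply: measurable_inv_ge0; first by move=> ?; exact: cabs_ge0.
apply: measurable_cabs; apply: cmeasB; first exact: cmeas_cst.
by apply: cmeasM; [exact: cmeas_cst|exact: cmeas_circle].
Qed.

Lemma measurable_bk z n : cabs z < 1 ->
  measurable_fun setT (fun x => cabs (bk z (toC x)) ^+ n).
Proof.
move=> z1; apply: measurable_funX; under eq_fun do rewrite cabs_bk //.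
apply: measurable_funM => //; apply: measurable_inv_ge0; first by move=> ?; exact: cabs_ge0.
apply: measurable_cabs; apply: cmeasB; first exact: cmeas_cst.
by apply: cmeasM; [exact: cmeas_cst|exact: cmeas_toC].
Qed.

(** The Poisson integral gives 2 pi (1 - |z|)^2 / (1 - |z w|^2), and the denominator is at least 1 -
    |z|. *)
Lemma bk_circle_integral_le z w : cabs z < 1 -> cabs w < 1 ->
  (\int[mu]_(t in circ) (cabs (bk z (w * cis t)) ^+ 2)%:E <= (pi2 * (1 - cabs z))%:E)%E.
Proof.
move=> z1 w1; have zw : cabs z * cabs w < 1 by rewrite mulr_ilt1 ?cabs_ge0.
have d0 : 0 < 1 - cabs z by rewrite subr_gt0.
have E t : (cabs (bk z (w * cis t)) ^+ 2)%:E =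
    (((1 - cabs z) ^+ 2)%:E * (((cabs (1 - conj z * (w * cis t))) ^+ 2)^-1)%:E)%E.
  by rewrite cabs_bk // exprMn exprVn EFinM.
under eq_integral do rewrite E.
rewrite ge0_integralZl //; first last.
- by rewrite lee_fin sqr_ge0.
- by move=> t _; rewrite lee_fin invr_ge0 sqr_ge0.
- apply/measurable_EFinP; apply: measurable_inv_ge0; first by move=> t; rewrite sqr_ge0.
  apply: measurable_funX; apply: measurable_cabs; apply: cmeasB; first exact: cmeas_cst.
  by apply: cmeasM; [exact: cmeas_cst|exact: cmeas_circle].
rewrite poisson_integral // -EFinM lee_fin mulrCA ler_pM2l ?pi2_gt0 //.
have s0 : 0 < 1 - (cabs z * cabs w) ^+ 2.
  by rewrite subr_gt0 expr_lt1 // mulr_ge0 ?cabs_ge0.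
rewrite ler_pdivrMr // expr2 ler_pM2l // lerD2l lerN2 expr2.
have z0 := cabs_ge0 z; have w0 := cabs_ge0 w.
apply: (@le_trans _ _ (cabs z * 1)); last by rewrite mulr1.
apply: ler_pM; [exact: mulr_ge0|exact: mulr_ge0|by rewrite ler_piMr // ltW|exact: ltW].
Qed.

Lemma measurable_om_rad : measurable_fun setT (fun x => om (rad x)).
Proof. exact: (measurableT_comp (measurable_om rw) (@measurable_rad R)). Qed.

(** Two of the L + 2 powers are integrated along circles and yield the factor 1 - |z|; the remaining
    L are bounded by [decay] and leave a radial integral, which [weight_decay] estimates. *)
Lemma kernel_integral_le : (exists K : R, 1 <= K /\ forall r, 0 <= r < 1 ->
    (omega_hat omega r <= K%:E * omega_hat omega ((1 + r) / 2))%E) ->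
  exists (L : nat) (A : R), 0 < A /\ forall z, cabs z < 1 ->
    (\int[area]_x (om (rad x) * cabs (bk z (toC x)) ^+ L)%:E <=
      (A * ((1 - cabs z) * hat (cabs z)))%:E)%E.
Proof.
move=> /(weight_decay rw)[L [A [A0 HA]]]; exists (L + 2)%N, (pi2 * A).
split=> [|z z1]; first by rewrite mulr_gt0 // pi2_gt0.
pose d := 1 - cabs z; have d0 : 0 < d by rewrite subr_gt0.
have d1 : 0 < d <= 1 by rewrite d0 /d gerDl oppr_le0 cabs_ge0.
pose F x := (om (rad x) * cabs (bk z (toC x)) ^+ (L + 2))%:E.
have mF : measurable_fun setT F.
  apply/measurable_EFinP; apply: measurable_funM; first exact: measurable_om_rad.
  exact: measurable_bk.
have F0 x : (0 <= F x)%E by rewrite lee_fin mulr_ge0 ?om_ge0 // exprn_ge0 ?cabs_ge0.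
pose G r := ((pi2 * d) * (om r * decay d r ^+ L))%:E.
have mG0 : measurable_fun setT (fun r => om r * decay d r ^+ L).
  by apply: measurable_funM; [exact: measurable_om|exact: measurable_decay].
have mG : measurable_fun setT G by apply/measurable_EFinP; apply: measurable_funM.
have dec0 r : 0 <= decay d r by have /andP[] := decay_ge0_le1 r d0.
have G0 r : (0 <= G r)%E.
  by rewrite lee_fin !mulr_ge0 ?om_ge0 ?exprn_ge0 ?(ltW pi2_gt0) ?(ltW d0).
suff : (pi2%:E * \int[area]_x F x <= pi2%:E * (pi2 * A * (d * hat (cabs z)))%:E)%E.
  by rewrite lee_pmul2l // lte_fin pi2_gt0.
rewrite area_circle_mean //.
apply: (@le_trans _ _ (\int[area]_x G (rad x))%E).
  apply: le_ge0_integral => [x _|x _]; first exact: integral_ge0.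
  - rewrite /F; under eq_integral do rewrite rad_rot toC_rot.
    have [x1|x1] := ltP (rad x) 1; last first.
      rewrite /G (_ : om (rad x) = 0) ?mul0r ?mulr0; last first.
        by rewrite /om ifF // rad_ge0 /= ltNge x1.
      by under eq_integral do rewrite mul0r; rewrite integral0.
    apply: (@le_trans _ _ (\int[mu]_(t in circ) ((om (rad x) * decay d (rad x) ^+ L)%:E *
        (cabs (bk z (toC x * cis t)) ^+ 2)%:E))%E).
      apply: ge0_le_integral => //.
      - by move=> t _; rewrite lee_fin mulr_ge0 ?om_ge0 // exprn_ge0 ?cabs_ge0.
      - apply/measurable_EFinP; apply: measurable_funM => //; exact: measurable_bk_circle.
      - apply/measurable_EFinP; apply: measurable_funM => //; exact: measurable_bk_circle.
      - move=> t _; rewrite -EFinM lee_fin -mulrA ler_wpM2l ?om_ge0 // exprD.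
        rewrite ler_wpM2r ?exprn_ge0 ?cabs_ge0 //.
        rewrite lerXn2r ?nnegrE ?cabs_ge0 //.
        have xt : cabs (toC x * cis t) = rad x by rewrite cabsM cabs_cis mulr1.
        by rewrite -xt cabs_bk_le // xt ltW.
    rewrite ge0_integralZl //; first last.
    - by rewrite lee_fin mulr_ge0 ?om_ge0 ?exprn_ge0.
    - by move=> t _; rewrite lee_fin exprn_ge0 ?cabs_ge0.
    - apply/measurable_EFinP; exact: measurable_bk_circle.
    have -> : G (rad x) = ((om (rad x) * decay d (rad x) ^+ L)%:E * (pi2 * d)%:E)%E.
      by rewrite -EFinM /G mulrC.
    rewrite lee_wpmul2l ?lee_fin ?mulr_ge0 ?om_ge0 ?exprn_ge0 //.
    exact: bk_circle_integral_le.
rewrite area_radial // mulr_natl.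
(* The polar factor [r] is at most 1 wherever [om] is nonzero. *)
apply: (@le_trans _ _ (pi2%:E * \int[mu]_r G r)%E).
  rewrite lee_pmul2l ?lte_fin ?pi2_gt0 //.
  apply: (@le_trans _ _ (\int[mu]_(r in `[0%R, +oo[) G r)%E); last first.
    by apply: ge0_subset_integral.
  apply: ge0_le_integral => //.
  - by move=> r; rewrite /= in_itv /= andbT => r0; rewrite mule_ge0.
  - by apply: measurable_funTS; apply: emeasurable_funM.
  - exact: measurable_funTS.
  - move=> r _; have [/andP[r0 r1]|r01] := boolP (0 <= r < 1).
      by rewrite -[leRHS]mul1e lee_wpmul2r // lee_fin ltW.
    by rewrite /G /om (negbTE r01) mul0r mulr0 mule0.
rewrite lee_pmul2l ?lte_fin ?pi2_gt0 // /G.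
under eq_integral do rewrite EFinM.
rewrite ge0_integralZl //; first last.
- by rewrite lee_fin mulr_ge0 ?(ltW pi2_gt0) ?(ltW d0).
- by move=> r _; rewrite lee_fin mulr_ge0 ?om_ge0 ?exprn_ge0.
- exact/measurable_EFinP.
rewrite (_ : pi2 * A * (d * hat (cabs z)) = (pi2 * d) * (A * hat (cabs z))); last by ring.
rewrite [leRHS]EFinM lee_pmul2l // ?lte_fin ?mulr_gt0 ?pi2_gt0 //.
have := HA _ d1; rewrite (_ : 1 - d = cabs z) // /d; ring.
Qed.

End KernelEstimates.

(** * Sub-mean value estimates *)

Section SubMean.
Variable R : realType.
Local Notation C := (Cplx R).
Local Notation Re := (@complex.Re R).
Local Notation rad := (@Defs.rad R).
Local Notation mu := (@lebesgue_measure R).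
Local Notation area := (@area R).
Local Notation pi2 := (pi *+ 2 : R).
Local Notation circ := (`[0%R, pi2]%classic).
Implicit Types (z w X : C) (x : R * R) (p : R) (f : C -> C).

(** On the diagonal the modulus is 1 / (1 + |w|). *)
Lemma cabs_bk_diag w : cabs w < 1 -> 1 / 2 <= cabs (bk w w).
Proof.
move=> w1; have w0 := cabs_ge0 w; rewrite cabs_bk //.
have -> : 1 - conj w * w = ofR (1 - cabs w ^+ 2).
  by rewrite mulrC mul_conj; apply: Cplx_eq; rewrite ?ReD ?ImD ?ReN ?ImN /= ?subr0.
have s0 : 0 < 1 - cabs w ^+ 2 by rewrite subr_gt0 expr_lt1.
rewrite cabs_ofR ger0_norm ?(ltW s0) // ler_pdivlMr // expr2.
have : cabs w * cabs w <= 1 * cabs w by rewrite ler_wpM2r // ltW.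
have : 0 <= (1 - cabs w) * (1 - cabs w) by rewrite mulr_ge0 // subr_ge0 ltW.
lra.
Qed.

Lemma bk_sym z w : cabs (1 - conj z * w) = cabs (1 - conj w * z).
Proof. by rewrite -cabs_conj conjB conjM; congr (cabs (_ - _)); apply: Cplx_eq; rewrite ?ReM ?ImM /=; ring. Qed.

(* On the circle |X| = s with 1 - s at most half of 1 - |w|, the Cauchy kernel is comparable to bk w. *)
Lemma cauchy_kernel_le w X : cabs w < 1 -> (1 + cabs w) / 2 <= cabs X -> cabs X < 1 ->
  cabs (X / (X - w)) <= 3 / (1 - cabs w) * cabs (bk w X).
Proof.
move=> w1 wX X1; have d0 : 0 < 1 - cabs w by rewrite subr_gt0.
have Xw : (1 - cabs w) / 2 <= cabs (X - w) by have := cabs_dist X w; lra.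
have e0 : 0 < cabs (1 - conj w * X) by apply: bk_den_gt0 => //; exact: ltW.
have Xw0 : 0 < cabs (X - w) by lra.
have H : cabs (1 - conj w * X) <= 3 * cabs (X - w).
  rewrite (_ : 1 - _ = (1 - conj X * X) + conj (X - w) * X); last by rewrite conjB; ring.
  rewrite (le_trans (cabsD _ _)) // cabsM cabs_conj.
  have -> : 1 - conj X * X = ofR (1 - cabs X ^+ 2).
    by rewrite mulrC mul_conj; apply: Cplx_eq; rewrite ?ReD ?ImD ?ReN ?ImN /= ?subr0.
  have X0 := cabs_ge0 X.
  rewrite cabs_ofR ger0_norm ?subr_ge0 ?exprn_ile1 ?(ltW X1) //.
  have : cabs (X - w) * cabs X <= cabs (X - w) * 1 by rewrite ler_pM2l // ltW.
  have : 0 <= (1 - cabs X) * (1 - cabs X) by rewrite mulr_ge0 // subr_ge0 ltW.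
  rewrite expr2; lra.
rewrite cabsM cabsV cabs_bk // mulrA divfK ?gt_eqF //.
rewrite ler_pdivrMr // mulrAC ler_pdivlMr // (le_trans _ H) //.
by rewrite ler_piMl ?ltW.
Qed.

Lemma cmeasV d (T : measurableType d) (D : set T) (g : T -> C) :
  cmeas D g -> cmeas D (fun u => (g u)^-1).
Proof.
move=> mg; have mi : measurable_fun D (fun u => (cabs (g u) ^+ 2)^-1).
  apply: measurable_inv_ge0; first by move=> u; rewrite sqr_ge0.
  by apply: measurable_funX; exact: measurable_cabs.
have [g1 g2] := mg; split.
  by under eq_fun do rewrite ReV; exact: measurable_funM.
by under eq_fun do rewrite ImV; apply: measurable_funM => //; exact: measurable_funN.
Qed.

Lemma cmeasX d (T : measurableType d) (D : set T) (g : T -> C) n :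
  cmeas D g -> cmeas D (fun u => g u ^+ n).
Proof.
move=> mg; elim: n => [|n IH].
  by under eq_fun do rewrite expr0; exact: cmeas_cst.
by under eq_fun do rewrite exprS; exact: cmeasM.
Qed.

Lemma EFin_fine_le (y : \bar R) : ((fine y)%:E <= `|y|)%E.
Proof. by case: y => [r| |] /=; rewrite ?leey // lee_fin ler_norm. Qed.

Lemma cmeas_analytic_circle f X : analytic_on_disc f -> cabs X < 1 ->
  cmeas circ (fun t => f (X * cis t)).
Proof.
move=> af X1; apply: (@cmeas_analytic R _ _ circ (fun t => X * cis t)) => //.
  exact: cmeas_circle.
by move=> t _; rewrite cabsM cabs_cis mulr1.
Qed.

(** Either a <= tau, or a / tau <= (a / tau)^p. It passes from |f| to |f|^p, with [tau] free so that
    the last summand can be absorbed. *)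
Lemma powR_young (a tau p : R) : 1 <= p -> 0 <= a -> 0 < tau ->
  a <= tau * tau^-1 `^ p * a `^ p + tau.
Proof.
move=> p1 a0 t0; rewrite -mulrA -powRM ?invr_ge0 ?(ltW t0) // -[X in _ + X]mulr1 -mulrDr.
rewrite -ler_pdivrMl //; set y := tau^-1 * a.
have y0 : 0 <= y by rewrite mulr_ge0 // invr_ge0 ltW.
have [y1|y1] := leP y 1; first by rewrite (le_trans y1) // lerDr powR_ge0.
by rewrite (@le_trans _ _ (y `^ p)) ?lerDl // -[leLHS]powRr1 // ler_powR // ltW.
Qed.

(** Cauchy's formula at w for G = f b_w^(N+1): the Cauchy kernel contributes one more power of b_w
    and the factor 3 / (1 - |w|). [powR_young] replaces |f| by |f|^p, and the term without [f] is a
    Poisson integral small enough to be absorbed on the left. *)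
Lemma circle_submean p (N : nat) : 1 <= p -> exists K : R, 0 < K /\
  forall f w X, analytic_on_disc f -> cabs w < 1 -> (1 + cabs w) / 2 <= cabs X -> cabs X < 1 ->
  ((cabs (f w) `^ p)%:E <= (K / (1 - cabs w))%:E *
     \int[mu]_(t in circ) (cabs (f (X * cis t)) `^ p * cabs (bk w (X * cis t)) ^+ N.+2)%:E)%E.
Proof.
move=> p1; have p0 : 0 < p by exact: lt_le_trans p1.
(* The power of 2 pays for |b_w(w)| >= 1/2, and the 6 matches [tau] below: |f(w)| kap <= tau. *)
pose kap : R := (6 * 2 ^+ N.+1)^-1.
have kap0 : 0 < kap by rewrite invr_gt0 mulr_gt0 ?exprn_gt0.
have pi20 := pi2_gt0 R.
exists (pi2 * kap `^ p)^-1; split=> [|f w X af w1 wX X1].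
  by rewrite invr_gt0 mulr_gt0 // powR_gt0.
have d0 : 0 < 1 - cabs w by rewrite subr_gt0.
set I := integral _ _ _.
have I0 : (0 <= I)%E.
  by apply: integral_ge0 => t _; rewrite lee_fin mulr_ge0 ?powR_ge0 ?exprn_ge0 ?cabs_ge0.
have [fw0|fw0] := eqVneq (f w) 0.
  rewrite fw0 cabs0 powR0 ?gt_eqF // mule_ge0 // lee_fin divr_ge0 ?(ltW d0) //.
  by rewrite invr_ge0 mulr_ge0 ?(ltW pi20) ?powR_ge0.
pose G z := f z * bk w z ^+ N.+1.
have Gw0 : 0 < cabs (G w).
  rewrite cabsM cabsX mulr_gt0 ?cabs_gt0 // exprn_gt0 //.
  by apply: lt_le_trans (cabs_bk_diag w1); rewrite divr_gt0.
have fwG : cabs (f w) * kap <= cabs (G w) / 6.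
  rewrite cabsM cabsX /kap invfM mulrCA mulrC ler_wpM2r ?invr_ge0 // ler_wpM2l ?cabs_ge0 //.
  rewrite -exprVn lerXn2r ?nnegrE ?invr_ge0 ?cabs_ge0 //.
  by rewrite -div1r cabs_bk_diag.
(* Unimodular constant making [c * G w] a positive real, since Cauchy's formula speaks of real
   parts. *)
pose c := conj (G w) * ofR (cabs (G w))^-1.
have c1 : cabs c = 1.
  rewrite cabsM cabs_conj cabs_ofR ger0_norm ?invr_ge0 ?cabs_ge0 //.
  by rewrite mulfV // gt_eqF.
have cG : Re (c * G w) = cabs (G w).
  rewrite /c mulrAC [conj _ * _]mulrC mul_conj -ofRM /= expr2 mulfK // gt_eqF //.
have wX' : cabs w < cabs X by lra.
have dG z : cabs z <= cabs X -> derivable (fun z => c * G z) z 1.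
  move=> zX; have z1 : cabs z < 1 by exact: le_lt_trans X1.
  apply: derivable_mull; apply: derivable_mul; first by apply: af; rewrite inE.
  by apply: derivable_pow; apply: derivable_bk => //; exact: ltW.
have Xt t : cabs (X * cis t) = cabs X by rewrite cabsM cabs_cis mulr1.
(* One sixth, because the term with [tau] comes back as 3 tau 2 pi, exactly half of the left-hand
   side. *)
pose tau := cabs (G w) / 6; have tau0 : 0 < tau by rewrite divr_gt0.
pose T1 := tau * tau^-1 `^ p; have T10 : 0 <= T1 by rewrite mulr_ge0 ?powR_ge0 // ltW.
have mfX := cmeas_analytic_circle af X1.
have mpf : measurable_fun circ (fun t => cabs (f (X * cis t)) `^ p).
  by apply: (measurableT_comp (@measurable_powR R p)); exact: measurable_cabs.
have mb n : measurable_fun circ (fun t => cabs (bk w (X * cis t)) ^+ n).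
  exact: measurable_bk_circle.
pose h t := Re (c * G (X * cis t) * (X * cis t / (X * cis t - w))).
have mh : measurable_fun circ h.
  have mX := cmeas_circle circ X.
  apply: (cmeasM _ _).1.
    apply: cmeasM; first exact: cmeas_cst.
    apply: cmeasM => //; apply: cmeasX; apply: cmeasM; first exact: cmeas_cst.
    by apply: cmeasV; apply: cmeasB; [exact: cmeas_cst|apply: cmeasM => //; exact: cmeas_cst].
  by apply: cmeasM => //; apply: cmeasV; apply: cmeasB => //; exact: cmeas_cst.
have h_le t : `|h t| <= 3 / (1 - cabs w) * (T1 * (cabs (f (X * cis t)) `^ p * cabs (bk w (X * cis t)) ^+ N.+2)
      + tau * cabs (bk w (X * cis t)) ^+ 2).
  have b1 : cabs (bk w (X * cis t)) <= 1 by apply: cabs_bk_le1 => //; rewrite Xt ltW.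
  have b0 := cabs_ge0 (bk w (X * cis t)).
  have f0 := cabs_ge0 (f (X * cis t)).
  rewrite (le_trans (Re_le_cabs _)) // (cabsM (c * _)) (cabsM c) c1 mul1r /G (cabsM (f _)) cabsX.
  have ck : cabs (X * cis t / (X * cis t - w)) <= 3 / (1 - cabs w) * cabs (bk w (X * cis t)).
    by apply: cauchy_kernel_le; rewrite ?Xt.
  move: ck b1 b0 f0; set F := cabs (f _); set B := cabs (bk _ _); set Q := cabs (_ / _).
  move=> ck b1 b0 f0; apply: (@le_trans _ _ (F * B ^+ N.+1 * (3 / (1 - cabs w) * B))).
    by rewrite ler_wpM2l // mulr_ge0 // exprn_ge0.
  rewrite (_ : F * _ * _ = 3 / (1 - cabs w) * (F * B ^+ N.+2)); last by rewrite [B ^+ N.+2]exprSr; ring.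
  rewrite ler_wpM2l ?divr_ge0 ?(ltW d0) //.
  apply: (@le_trans _ _ ((T1 * F `^ p + tau) * B ^+ N.+2)).
    by rewrite ler_wpM2r ?exprn_ge0 // powR_young.
  rewrite mulrDl mulrA lerD2l ler_wpM2l ?(ltW tau0) //.
  by rewrite -[N.+2]addn2 exprD ler_piMl ?exprn_ge0 // exprn_ile1.
have mI : measurable_fun circ (fun t => (cabs (f (X * cis t)) `^ p * cabs (bk w (X * cis t)) ^+ N.+2)%:E).
  by apply/measurable_EFinP; apply: measurable_funM.
have mB : measurable_fun circ (fun t => (cabs (bk w (X * cis t)) ^+ 2)%:E) by exact/measurable_EFinP.
have nI t : (0 <= (cabs (f (X * cis t)) `^ p * cabs (bk w (X * cis t)) ^+ N.+2)%:E)%E.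
  by rewrite lee_fin mulr_ge0 ?powR_ge0 ?exprn_ge0 ?cabs_ge0.
have nB t : (0 <= (cabs (bk w (X * cis t)) ^+ 2)%:E)%E by rewrite lee_fin exprn_ge0 ?cabs_ge0.
have k0 : 0 <= 3 / (1 - cabs w) by rewrite divr_ge0 // ltW.
have main : ((pi2 * cabs (G w))%:E <= (3 / (1 - cabs w))%:E * (T1%:E * I + tau%:E * (pi2 * (1 - cabs w))%:E))%E.
  rewrite -cG -(cauchy_formula wX' dG) /RI /Rintegral.
  apply: le_trans (EFin_fine_le _) _.
  apply: le_trans (le_abse_integral _ _ _) _ => //; first exact/measurable_EFinP.
  apply: (@le_trans _ _ (\int[mu]_(t in circ) ((3 / (1 - cabs w))%:E *
     (T1%:E * (cabs (f (X * cis t)) `^ p * cabs (bk w (X * cis t)) ^+ N.+2)%:E +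
      tau%:E * (cabs (bk w (X * cis t)) ^+ 2)%:E)))%E).
    apply: le_ge0_integral => t _; first exact: abse_ge0.
    by rewrite -!EFinM; exact: h_le.
  rewrite ge0_integralZl //; first last.
  - by move=> t _; rewrite adde_ge0 // mule_ge0 // lee_fin // ltW.
  - by apply: emeasurable_funD; apply: emeasurable_funM.
  rewrite lee_wpmul2l ?lee_fin // ge0_integralD //; first last.
  - by apply: emeasurable_funM.
  - by move=> t _; rewrite mule_ge0 // lee_fin // ltW.
  - by apply: emeasurable_funM.
  - by move=> t _; rewrite mule_ge0 // lee_fin.
  rewrite ge0_integralZl ?lee_fin // ge0_integralZl ?lee_fin ?(ltW tau0) //.
  rewrite leeD2l // lee_wpmul2l ?lee_fin ?(ltW tau0) //.
  exact: bk_circle_integral_le.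
move: I0 main; rewrite -/I; clearbody I; case: I => [i| |] // i0 main; last first.
  by rewrite gt0_muley ?leey // lte_fin divr_gt0 // invr_gt0 mulr_gt0 // powR_gt0.
rewrite -EFinM lee_fin; rewrite -!EFinM lee_fin in main; rewrite lee_fin in i0.
have {main} main : pi2 * (tau * 6) - 3 * tau * pi2 <= 3 / (1 - cabs w) * (T1 * i).
  rewrite lerBlDr /tau divfK // (le_trans main) // mulrDr lerD2l -/tau.
  by rewrite le_eqVlt; apply/orP; left; apply/eqP; field; rewrite gt_eqF.
have {}main : pi2 * tau `^ p <= i / (1 - cabs w).
  have t1 : tau^-1 `^ p * tau `^ p = 1.
    by rewrite -powRM ?invr_ge0 ?(ltW tau0) // mulVf ?gt_eqF // powR1.
  have tp0 : 0 < tau `^ p by rewrite powR_gt0.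
  have e1 : 3 * tau * pi2 <= 3 * tau * (tau^-1 `^ p * (i / (1 - cabs w))).
    by move: main; rewrite /T1; set y := (1 - cabs w)^-1; lra.
  move: e1; rewrite ler_pM2l ?mulr_gt0 // => e1.
  by have := ler_wpM2r (ltW tp0) e1; rewrite mulrAC t1 mul1r.
have kp0 : 0 < kap `^ p by rewrite powR_gt0.
have e : cabs (f w) `^ p * kap `^ p <= tau `^ p.
  rewrite -powRM ?cabs_ge0 ?(ltW kap0) // ge0_ler_powR ?nnegrE ?(ltW p0) ?(ltW tau0) //.
  by rewrite mulr_ge0 ?cabs_ge0 // ltW.
rewrite (_ : _ * i = i / (1 - cabs w) / (pi2 * kap `^ p)); last first.
  by rewrite [LHS]mulrC mulrCA mulrC.
rewrite ler_pdivlMr ?mulr_gt0 // mulrCA (le_trans _ main) //.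
by rewrite ler_pM2l.
Qed.

End SubMean.

(** * Sub-mean value estimate for weights of class D *)

Section AreaSubMean.
Variable R : realType.
Local Notation C := (Cplx R).
Local Notation rad := (@Defs.rad R).
Local Notation mu := (@lebesgue_measure R).
Local Notation area := (@area R).
Local Notation pi2 := (pi *+ 2 : R).
Local Notation circ := (`[0%R, pi2]%classic).
Variable omega : R -> R.
Hypothesis cD : classD omega.
Let rw : radial_weight omega := cD.1.1.
Local Notation om := (om omega).
Local Notation hat := (hat omega).
Implicit Types (z w : C) (x : R * R) (p q : R) (f : C -> C).

Lemma measurable_om_pow p f : analytic_on_disc f ->
  measurable_fun setT (fun x => om (rad x) * cabs (f (toC x)) `^ p).
Proof.
move=> af; have mD := @measurable_discR R.
have mt : cmeas (@discR R) (@toC R).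
  by have [t1 t2] := @cmeas_toC R; split; exact: measurable_funTS.
have [c1 c2] : cmeas setT (fun x => if x \in @discR R then f (toC x) else 0).
  by apply: cmeas_cut; apply: cmeas_analytic => // x; rewrite cabs_toC.
rewrite (_ : (fun x => _) = fun x => om (rad x) * cabs (if x \in @discR R then f (toC x) else 0) `^ p).
  apply: measurable_funM; first exact: measurable_om_rad.
  by apply: (measurableT_comp (@measurable_powR R p)); exact: measurable_cabs.
apply: funext => x; case: ifPn => //; rewrite notin_setE /discR /= => /negP; rewrite -leNgt => x1.
by rewrite /om ifF ?mul0r // rad_ge0 /= ltNge x1.
Qed.

Lemma measurable_bk_param w n :
  measurable_fun setT (fun x => cabs (bk (toC x) w) ^+ n).
Proof.
apply: measurable_funX; under eq_fun do rewrite cabsM cabsV cabs_ofR cabs_toC.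
apply: measurable_funM.
  apply: measurableT_comp => //.
  by apply: measurable_funB => //; exact: measurable_rad.
apply: measurable_inv_ge0; first by move=> ?; exact: cabs_ge0.
apply: measurable_cabs; apply: cmeasB; first exact: cmeas_cst.
by apply: cmeasM; [apply: cmeas_conj; exact: cmeas_toC|exact: cmeas_cst].
Qed.

Definition chi (a b r : R) : R := ((a <= r) && (r < b))%:R.

Lemma chi_ge0 a b r : 0 <= chi a b r. Proof. exact: ler0n. Qed.

Lemma measurable_chi a b : measurable_fun setT (chi a b).
Proof.
rewrite (_ : chi a b = fun r => (a <= r)%R%:R * (1 - (b <= r)%R%:R)).
  by apply: measurable_funM; [exact: measurable_step|apply: measurable_funB => //; exact: measurable_step].
apply: funext => r; rewrite /chi ltNge; case: (a <= r); case: (b <= r) => /=; ring.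
Qed.

Lemma om_chi_integral a b : 0 <= a -> a <= b -> b <= 1 ->
  (\int[mu]_r (om r * chi a b r)%:E = (hat a - hat b)%:E)%E.
Proof.
move=> a0 ab b1; have b0 := le_trans a0 ab; have a1 := le_trans ab b1.
have mo := measurable_om rw; have o0 := om_ge0 rw.
have ha : (hat a)%:E = (\int[mu]_r (om r * chi a b r)%:E + (hat b)%:E)%E.
  rewrite -(om_tail rw (r := a)) ?a0 // -(om_tail rw (r := b)) ?b0 // -ge0_integralD //; first last.
  - by apply/measurable_EFinP; apply: measurable_funM => //; exact: measurable_step.
  - by move=> r _; rewrite lee_fin mulr_ge0.
  - by apply/measurable_EFinP; apply: measurable_funM => //; exact: measurable_chi.
  - by move=> r _; rewrite lee_fin mulr_ge0 ?chi_ge0.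
  apply: eq_integral => r _; rewrite -EFinD -mulrDr /chi ltNge; congr (_ * _)%:E.
  by case: (leP b r) => br; rewrite ?andbF ?andbT ?add0r ?addr0 // (le_trans ab br).
by rewrite EFinB ha addeK.
Qed.

(** With a = (1 + r) / 2, doubling compares the tail at r with the tail at a, and the reverse
    condition places at least the fraction 1 - 1 / C2 of the latter before 1 - (1 - a) / K. *)
Lemma hat_annulus_ge : exists K c : R, [/\ 1 < K, 0 < c & forall r, 0 <= r < 1 ->
  c * hat r <= hat ((1 + r) / 2) - hat (1 - (1 - (1 + r) / 2) / K)].
Proof.
have [[_ [C1 [C11 H1]]] [K [C2 [K1 C21 H2]]]] := cD.
have C10 : 0 < C1 by exact: lt_le_trans C11.
have C20 : 0 < C2 by exact: lt_trans C21.
exists K, ((1 - C2^-1) / C1); split=> //.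
  by rewrite divr_gt0 // subr_gt0 invf_lt1.
move=> r /[dup] r01 /andP[r0 r1].
have a01 : 0 <= (1 + r) / 2 < 1 by apply/andP; split; lra.
have K0 : 0 < K by exact: lt_trans K1.
have dK : 0 <= (1 - (1 + r) / 2) / K <= 1.
  by rewrite divr_ge0 ?(ltW K0) ?ler_pdivrMr ?mul1r //; lra.
have := H1 _ r01; have := H2 _ a01; rewrite !omega_hatE ?r0 ?(ltW r1) //; try lra.
rewrite !lee_fin => h2 h1.
have h3 : hat (1 - (1 - (1 + r) / 2) / K) <= C2^-1 * hat ((1 + r) / 2).
  by rewrite ler_pdivlMl.
have h4 : C1^-1 * hat r <= hat ((1 + r) / 2) by rewrite ler_pdivrMl.
have k0 : 0 <= 1 - C2^-1 by rewrite subr_ge0 invf_le1 // ltW.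
have := ler_wpM2l k0 h4; lra.
Qed.

(** The circle estimate averaged over the annulus of [hat_annulus_ge]: its mass is comparable to
    hat(|w|), and the factor 1 / (1 - |w|) moves to the left. The kernel at w evaluated at x is
    exchanged for the kernel at x evaluated at w, so that the integration variable can later be the
    parameter of a test function. *)
Lemma area_submean p N : 1 <= p -> exists K : R, 0 < K /\
  forall f w, analytic_on_disc f -> cabs w < 1 ->
  ((cabs (f w) `^ p * ((1 - cabs w) * hat (cabs w)))%:E <=
    K%:E * \int[area]_x (om (rad x) * (cabs w <= rad x)%R%:R * cabs (f (toC x)) `^ p *
       cabs (bk (toC x) w) ^+ N.+2)%:E)%E.
Proof.
move=> p1; have [K1 [K10 HK1]] := circle_submean N p1.
have [K [c [K1' c0 Hc]]] := hat_annulus_ge.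
have K0 : 0 < K by exact: lt_trans K1'.
have pi20 := pi2_gt0 R.
exists (2 * K1 / c * (2 * K) ^+ N.+2); split.
  exact: mulr_gt0 (divr_gt0 (mulr_gt0 (ltr0Sn R 1) K10) c0) (exprn_gt0 _ (mulr_gt0 (ltr0Sn R 1) K0)).
move=> f w af w1; have w0 := cabs_ge0 w; have d0 : 0 < 1 - cabs w by rewrite subr_gt0.
pose a := (1 + cabs w) / 2; pose b := 1 - (1 - a) / K.
(* This keeps the polar factor at least 1/2 on the annulus. *)
have a12 : 1 / 2 <= a by rewrite /a; lra.
have a1 : a < 1 by rewrite /a; lra.
have ab : a <= b by rewrite /b lerBrDr -lerBrDl ler_pdivrMr //; nra.
have b1 : b < 1 by rewrite /b ltrBlDr ltrDl divr_gt0 // subr_gt0.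
pose F x := (om (rad x) * chi a b (rad x) * (cabs (f (toC x)) `^ p * cabs (bk w (toC x)) ^+ N.+2))%:E.
have F0 x : (0 <= F x)%E.
  rewrite lee_fin; apply: mulr_ge0; first exact: mulr_ge0 (om_ge0 rw _) (chi_ge0 _ _ _).
  exact: mulr_ge0 (powR_ge0 _ _) (exprn_ge0 _ (cabs_ge0 _)).
have mF : measurable_fun setT F.
  apply/measurable_EFinP.
  rewrite (_ : (fun x => _) = fun x => (om (rad x) * cabs (f (toC x)) `^ p) * (chi a b (rad x) * cabs (bk w (toC x)) ^+ N.+2)).
    apply: measurable_funM; first exact: measurable_om_pow.
    apply: measurable_funM; last exact: measurable_bk.
    exact: (measurableT_comp (@measurable_chi a b) (@measurable_rad R)).
  by apply: funext => x; ring.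
have step1 : ((cabs (f w) `^ p * ((1 - cabs w) * hat (cabs w)))%:E <= (2 * K1 / c)%:E * \int[area]_x F x)%E.
  pose E := ((1 - cabs w) / K1 * cabs (f w) `^ p).
  have E0 : 0 <= E by rewrite mulr_ge0 ?powR_ge0 // divr_ge0 // ltW.
  have mg : measurable_fun setT (fun r => om r * chi a b r).
    by apply: measurable_funM; [exact: measurable_om|exact: measurable_chi].
  have g0 r : 0 <= om r * chi a b r by rewrite mulr_ge0 ?om_ge0 ?chi_ge0.
  have mG : measurable_fun setT (fun r => (om r * chi a b r)%:E) by exact/measurable_EFinP.
  have gE r : (0 <= (om r * chi a b r)%:E)%E by rewrite lee_fin.
  have h1 : (\int[area]_x (E%:E * (om (rad x) * chi a b (rad x))%:E) <= pi2%:E * \int[area]_x F x)%E.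
    rewrite area_circle_mean //; apply: le_ge0_integral => [x _|x _].
      by rewrite mule_ge0 // lee_fin.
    rewrite /F; under eq_integral do rewrite rad_rot toC_rot EFinM.
    have [x01|x01] := boolP ((a <= rad x) && (rad x < b)); last first.
      by rewrite /chi (negbTE x01) mulr0 mule0; apply: integral_ge0 => t _; rewrite mul0e.
    have /andP[ax xb] := x01; have x1 := lt_trans xb b1.
    rewrite ge0_integralZl ?lee_fin //; first last.
    - by move=> t _; rewrite lee_fin mulr_ge0 ?powR_ge0 ?exprn_ge0 ?cabs_ge0.
    - apply/measurable_EFinP; apply: measurable_funM; last exact: measurable_bk_circle.
      apply: (measurableT_comp (@measurable_powR R p)); apply: measurable_cabs.
      exact: cmeas_analytic_circle.
    rewrite muleC lee_wpmul2l ?lee_fin // /E.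
    have := HK1 f w (toC x) af w1 ax x1.
    set I := integral _ _ _ => H.
    have k0 : (0 <= ((1 - cabs w) / K1)%:E)%E by rewrite lee_fin divr_ge0 // ltW.
    rewrite EFinM; apply: le_trans (lee_wpmul2l k0 H) _.
    by rewrite muleA -EFinM mulrA divfK ?gt_eqF // mulfV ?gt_eqF // mul1e.
  have h2 : (\int[area]_x (E%:E * (om (rad x) * chi a b (rad x))%:E) =
      E%:E * (pi2%:E * \int[mu]_(r in `[0%R, +oo[) (r%:E * (om r * chi a b r)%:E)))%E.
    rewrite ge0_integralZl ?lee_fin //; last exact: (measurableT_comp mG (@measurable_rad R)).
    by rewrite (area_radial mG) // mulr_natl.
  have h3 : ((1 / 2 * (c * hat (cabs w)))%:E <=
      \int[mu]_(r in `[0%R, +oo[) (r%:E * (om r * chi a b r)%:E))%E.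
    apply: (@le_trans _ _ (\int[mu]_r ((1 / 2)%:E * (om r * chi a b r)%:E))%E).
      rewrite ge0_integralZl ?lee_fin ?divr_ge0 //.
      rewrite om_chi_integral ?(ltW b1) //; last lra.
      rewrite EFinM lee_wpmul2l ?lee_fin ?divr_ge0 //.
      by apply: Hc; rewrite w0.
    rewrite [X in (_ <= X)%E]integral_mkcond; apply: le_ge0_integral => [r _|r _].
      by rewrite mule_ge0 // lee_fin ?divr_ge0.
    rewrite patchE mem_setE in_itv /= andbT; have [ar|ar] := boolP ((a <= r) && (r < b)); last first.
      by rewrite /chi (negbTE ar) mulr0 !mule0; case: ifP.
    have /andP[ar' _] := ar; rewrite ifT; last by lra.
    by rewrite lee_wpmul2r ?lee_fin //; lra.
  have h4 : ((E * (1 / 2 * (c * hat (cabs w))))%:E <= \int[area]_x F x)%E.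
    move: h1; rewrite h2 muleCA lee_pmul2l ?lte_fin // => h1; apply: le_trans h1.
    by rewrite EFinM lee_wpmul2l ?lee_fin.
  have k0 : 0 < 2 * K1 / c by rewrite divr_gt0 ?mulr_gt0.
  move: h4; rewrite -(lee_pmul2l (x := (2 * K1 / c)%:E)) ?lte_fin // => /(le_trans _); apply.
  rewrite -EFinM lee_fin /E le_eqVlt; apply/orP; left; apply/eqP.
  by field; rewrite !gt_eqF.
have H0 x : 0 <= om (rad x) * (cabs w <= rad x)%R%:R * cabs (f (toC x)) `^ p * cabs (bk (toC x) w) ^+ N.+2.
  apply: mulr_ge0; last exact: exprn_ge0 (cabs_ge0 _).
  by apply: mulr_ge0 (powR_ge0 _ _); apply: mulr_ge0; [exact: om_ge0|exact: ler0n].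
apply: le_trans step1 _; rewrite (EFinM (2 * K1 / c)) -muleA.
rewrite lee_wpmul2l ?lee_fin ?divr_ge0 ?mulr_ge0 ?(ltW K10) ?(ltW c0) //.
rewrite -ge0_integralZl ?lee_fin ?exprn_ge0 ?mulr_ge0 ?(ltW K0) //; first last.
- by move=> x _; rewrite lee_fin.
- apply/measurable_EFinP; apply: measurable_funM; last exact: measurable_bk_param.
  rewrite (_ : (fun x => _) = fun x => (om (rad x) * cabs (f (toC x)) `^ p) * (cabs w <= rad x)%R%:R).
    apply: measurable_funM; first exact: measurable_om_pow.
    exact: (measurableT_comp (@measurable_step R (cabs w)) (@measurable_rad R)).
  by apply: funext => x; ring.
apply: le_ge0_integral => // x _.
rewrite /F -EFinM lee_fin.
have [x01|x01] := boolP ((a <= rad x) && (rad x < b)); last first.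
  rewrite /chi (negbTE x01) mulr0 mul0r.
  by apply: mulr_ge0 (H0 x); rewrite exprn_ge0 // mulr_ge0 // ltW.
have /andP[ax xb] := x01; have x1 := lt_trans xb b1.
(* The two kernels have denominators of equal modulus, and 1 - |w| <= 2 K (1 - |x|) on the
   annulus. *)
have key : cabs (bk w (toC x)) ^+ N.+2 <= (2 * K) ^+ N.+2 * cabs (bk (toC x) w) ^+ N.+2.
  rewrite -exprMn lerXn2r ?nnegrE ?mulr_ge0 ?cabs_ge0 ?(ltW K0) //.
  rewrite !cabs_bk // bk_sym mulrA ler_wpM2r ?invr_ge0 ?cabs_ge0 //.
  rewrite cabs_toC; move: xb; rewrite /b /a; set r := rad x => xb.
  have e1 : (1 - (1 + cabs w) / 2) / K * K = 1 - (1 + cabs w) / 2 by rewrite divfK // gt_eqF.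
  have : (1 - (1 + cabs w) / 2) / K * K <= (1 - r) * K by rewrite ler_pM2r //; lra.
  by rewrite e1; lra.
rewrite /chi x01 (_ : cabs w <= rad x); last by rewrite /a in ax; lra.
rewrite !mulr1; move: key; set B := _ ^+ _; set B' := cabs (bk (toC x) w) ^+ _ => key.
rewrite (_ : _ ^+ N.+2 * _ = om (rad x) * (cabs (f (toC x)) `^ p * ((2 * K) ^+ N.+2 * B'))); last by ring.
by rewrite ler_wpM2l ?om_ge0 // ler_wpM2l ?powR_ge0.
Qed.

End AreaSubMean.

Lemma powRN_le (R : realType) (a x y s : R) :
  0 <= a -> 0 < x -> x <= y -> 0 <= s -> a * y `^ (- s) <= a * x `^ (- s).
Proof.
move=> a0 x0 xy s0; have y0 := lt_le_trans x0 xy.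
rewrite !powRN ler_wpM2l // lef_pV2 ?posrE ?powR_gt0 //.
by rewrite ge0_ler_powR // nnegrE ltW.
Qed.

(** * The unit ball of the weighted Bergman space and point evaluations *)

Section WeightedBergman.
Variable R : realType.
Local Notation C := (Cplx R).
Local Notation rad := (@Defs.rad R).
Local Notation area := (@area R).
Variable omega : R -> R.
Hypothesis cD : classD omega.
Let rw : radial_weight omega := cD.1.1.
Local Notation om := (om omega).
Local Notation hat := (hat omega).
Implicit Types (z w : C) (x : R * R) (p q : R) (f : C -> C).

Definition Jint p f : \bar R := (\int[area]_x (om (rad x) * cabs (f (toC x)) `^ p)%:E)%E.

Lemma Jint_ge0 p f : (0 <= Jint p f)%E.
Proof. by apply: integral_ge0 => x _; rewrite lee_fin mulr_ge0 ?om_ge0 ?powR_ge0. Qed.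

Lemma ge0_lty_EFin (y : \bar R) : (0 <= y)%E -> (y < +oo)%E -> exists2 j : R, 0 <= j & y = j%:E.
Proof. by case: y => [r| |] //; rewrite ?ltxx // lee_fin => r0 _; exists r. Qed.

Lemma om_out x : ~ discR x -> om (rad x) = 0.
Proof. by move=> /negP; rewrite /discR /= -leNgt => x1; rewrite /om ifF // rad_ge0 /= ltNge x1. Qed.

Lemma ApnormE p f : analytic_on_disc f -> Apnorm p omega f = ((((pi : R)^-1)%:E * Jint p f) `^ p^-1)%E.
Proof.
move=> af; rewrite /Apnorm; congr (_ `^ _)%E.
rewrite /Jint -ge0_integralZl ?lee_fin ?invr_ge0 ?pi_ge0 //; first last.
- by move=> x _; rewrite lee_fin mulr_ge0 ?om_ge0 ?powR_ge0.
- by apply/measurable_EFinP; exact: measurable_om_pow.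
rewrite [LHS]integral_mkcond; apply: eq_integral => x _; rewrite patchE -EFinM.
case: ifPn => [/set_mem xD|]; last by rewrite notin_setE => /om_out ->; rewrite mul0r mulr0.
by rewrite /om rad_ge0 /= ifT // mulrA.
Qed.

(** As dA is area divided by pi, norm at most 1 means that [Jint] is at most pi. *)
Definition Ap_ball p f := analytic_on_disc f /\ (Jint p f <= pi%:E)%E.

Lemma in_ApE p f : 0 < p -> analytic_on_disc f -> in_Ap p omega f <-> (Jint p f < +oo)%E.
Proof.
move=> p0 af; have J0 := Jint_ge0 p f; rewrite /in_Ap ApnormE //.
split=> [[_]|Jo].
  move=> /lty_poweRy; rewrite invr_neq0 ?gt_eqF // => /(_ isT).
  by case: (Jint p f) J0 => [r _ _|_|//]; rewrite ?ltry // gt0_muley ?ltxx // lte_fin invr_gt0 pi_gt0.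
split=> //; apply: poweR_lty; rewrite lte_mul_pinfty // ?lee_fin ?invr_ge0 ?pi_ge0 //.
Qed.

Lemma Ap_ballE p f : 0 < p -> (in_Ap p omega f /\ (Apnorm p omega f <= 1)%E) <-> Ap_ball p f.
Proof.
move=> p0; have pi0 := pi_gt0 R; have r0 : 0 <= p^-1 by rewrite invr_ge0 ltW.
have J0 := Jint_ge0 p f; split=> [[[af fo] f1]|[af fJ]]; last first.
  have Jo : (Jint p f < +oo)%E by apply: le_lt_trans fJ _; rewrite ltry.
  split; first exact/in_ApE.
  rewrite ApnormE // -(poweR1r p^-1).
  rewrite gt0_ler_poweR ?in_itv /= ?leey ?andbT ?lee_fin ?ler01 //.
    by rewrite mule_ge0 // lee_fin invr_ge0 ltW.
  have [j j0 Jj] := ge0_lty_EFin J0 Jo.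
  by move: fJ; rewrite Jj -EFinM !lee_fin ler_pdivrMl // mulr1.
split=> //; move: f1; rewrite ApnormE // => f1.
have Jo : (Jint p f < +oo)%E by apply/in_ApE.
have [j _ Jj] := ge0_lty_EFin J0 Jo.
rewrite Jj lee_fin; move: f1 J0; rewrite Jj -EFinM poweR_EFin !lee_fin => f1 j0.
have i0 : 0 <= pi^-1 * j by rewrite mulr_ge0 // invr_ge0 ltW.
have := @ge0_ler_powR _ p (ltW p0) ((pi^-1 * j) `^ p^-1) 1.
rewrite !nnegrE powR_ge0 ler01 => /(_ isT isT f1).
by rewrite -powRrM mulVf ?gt_eqF // powRr1 // powR1 ler_pdivrMl // mulr1.
Qed.

(** Of the order of the omega-mass of a Carleson square of side 1 - r. *)
Definition Nw (r : R) := (1 - r) * hat r.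

Lemma Nw_gt0 r : 0 <= r < 1 -> 0 < Nw r.
Proof. by move=> /[dup] /andP[_ r1] r01; rewrite mulr_gt0 ?subr_gt0 ?hat_gt0. Qed.

Lemma Nw_le r t : 0 <= r -> r <= t -> t < 1 -> Nw t <= Nw r.
Proof.
move=> r0 rt t1; apply: ler_pM; [by rewrite subr_ge0 ltW| |by rewrite lerD2l lerN2|].
  by apply: hat_ge0 => //; rewrite (le_trans r0 rt) ltW.
by apply: hat_le => //; exact: ltW.
Qed.

(** [area_submean] with the indicator and the kernel, both at most 1, dropped from the integral. *)
Lemma point_eval p : 1 <= p -> exists K : R, 0 < K /\ forall f w, Ap_ball p f -> cabs w < 1 ->
  cabs (f w) `^ p * Nw (cabs w) <= K.
Proof.
move=> p1; have [K [K0 HK]] := area_submean cD 0 p1.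
exists (K * pi); split=> [|f w [af fJ] w1]; first by rewrite mulr_gt0 // pi_gt0.
have := HK f w af w1; rewrite -lee_fin => /le_trans; apply.
rewrite EFinM lee_pmul2l ?lte_fin //; apply: le_trans fJ.
apply: le_ge0_integral => x _.
  rewrite lee_fin; apply: mulr_ge0; last exact: exprn_ge0 (cabs_ge0 _).
  by apply: mulr_ge0 (powR_ge0 _ _); apply: mulr_ge0; [exact: om_ge0|exact: ler0n].
rewrite lee_fin; have [xD|/om_out ->] := pselect (discR x); last by rewrite !mul0r.
have b1 : cabs (bk (toC x) w) ^+ 2 <= 1 by rewrite exprn_ile1 ?cabs_ge0 // cabs_bk_le1 // ltW.
have o0 := om_ge0 rw (rad x).
have c1 : (cabs w <= rad x)%R%:R <= 1 :> R by rewrite (ler_nat R _ 1) leq_b1.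
rewrite (_ : _ * _ = (om (rad x) * cabs (f (toC x)) `^ p) *
  ((cabs w <= rad x)%R%:R * cabs (bk (toC x) w) ^+ 2)); last by ring.
rewrite ler_piMr ?mulr_ge0 ?powR_ge0 // mulr_ile1 ?ler0n ?exprn_ge0 ?cabs_ge0 //.
Qed.

(** Clamping [r] to [0, 1] makes the base monotone on the whole line, hence measurable. *)
Definition Ww (s r : R) := Nw (Num.max 0 (Num.min r 1)) `^ s.

Lemma measurable_Ww (s : R) : measurable_fun setT (Ww s).
Proof.
apply: (measurableT_comp (@measurable_powR R s)).
apply: nonincreasing_measurable => // r t rt.
have m01 (u : R) : 0 <= Num.max 0 (Num.min u 1) <= 1.
  by rewrite le_max lexx /= ge_max ler01 ge_min lexx orbT.
have mm : Num.max 0 (Num.min r 1) <= Num.max 0 (Num.min t 1).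
  have mn : Num.min r 1 <= Num.min t 1 by rewrite le_min !ge_min rt lexx orbT.
  by rewrite ge_max !le_max lexx mn orbT.
have /andP[r0 r1] := m01 r; have /andP[t0 t1] := m01 t.
apply: ler_pM; [by rewrite subr_ge0|exact: hat_ge0|by rewrite lerD2l lerN2|exact: hat_le].
Qed.

Lemma WwE s r : 0 <= r <= 1 -> Ww s r = Nw r `^ s.
Proof.
move=> /andP[r0 r1]; rewrite /Ww.
have -> : Num.min r 1 = r by exact/min_idPl.
by have -> : Num.max 0 r = r by exact/max_idPr.
Qed.

(** In |f|^q = |f|^p |f|^(q-p) point evaluation bounds the second factor by a power of 1 / Nw. The
    collected weight Nw(|w|)^(-q/p) passes to the integration variable because |w| <= |x| and [Nw]
    decreases; there it will cancel the norms of the kernels. *)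
Lemma carleson_pointwise p q n : 1 < p -> p <= q -> exists K : R, 0 < K /\
  forall f w, Ap_ball p f -> cabs w < 1 ->
  ((cabs (f w) `^ q)%:E <= K%:E * \int[area]_x
    (om (rad x) * cabs (f (toC x)) `^ p * ((cabs w <= rad x)%R%:R * Ww (- (q / p)) (rad x)) *
       cabs (bk (toC x) w) ^+ n.+2)%:E)%E.
Proof.
move=> p1 pq; have p0 : 0 < p by exact: lt_trans p1.
have [K [K0 HK]] := area_submean cD n (ltW p1).
have [K' [K'0 HK']] := point_eval (ltW p1).
pose s := (q - p) / p; have s0 : 0 <= s by rewrite divr_ge0 ?subr_ge0 // ltW.
exists (K * K' `^ s); split=> [|f w fb w1]; first by rewrite mulr_gt0 ?powR_gt0.
have w0 := cabs_ge0 w; have Nw0 : 0 < Nw (cabs w) by apply: Nw_gt0; rewrite w0.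
have af := fb.1.
pose F x := om (rad x) * (cabs w <= rad x)%R%:R * cabs (f (toC x)) `^ p * cabs (bk (toC x) w) ^+ n.+2.
have F0 x : 0 <= F x.
  apply: mulr_ge0; last exact: exprn_ge0 (cabs_ge0 _).
  by apply: mulr_ge0 (powR_ge0 _ _); apply: mulr_ge0; [exact: om_ge0|exact: ler0n].
have mF : measurable_fun setT (EFin \o F).
  apply/measurable_EFinP; apply: measurable_funM; last exact: measurable_bk_param.
  rewrite (_ : (fun x => _) = fun x => (om (rad x) * cabs (f (toC x)) `^ p) * (cabs w <= rad x)%R%:R).
    apply: measurable_funM; first exact: measurable_om_pow.
    exact: (measurableT_comp (@measurable_step R (cabs w)) (@measurable_rad R)).
  by apply: funext => x; ring.
have qE : cabs (f w) `^ q <= cabs (f w) `^ p * Nw (cabs w) * (K' `^ s * Nw (cabs w) `^ (- (q / p))).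
  have [fw0|fw0] := eqVneq (cabs (f w)) 0.
    rewrite fw0 [X in X <= _]powR0 ?gt_eqF ?(lt_le_trans p0) //.
    by apply: mulr_ge0; apply: mulr_ge0; rewrite ?powR_ge0 ?(ltW Nw0).
  have fw : 0 < cabs (f w) by rewrite lt_neqAle eq_sym fw0 cabs_ge0.
  have -> : q = p + p * s by rewrite /s mulrC divfK ?gt_eqF // addrC subrK.
  rewrite powRD ?fw0 ?implybT // -mulrA ler_wpM2l ?powR_ge0 // powRrM.
  have -> : Nw (cabs w) * (K' `^ s * Nw (cabs w) `^ (- ((p + p * s) / p))) = (K' / Nw (cabs w)) `^ s.
    rewrite powRM ?invr_ge0 ?(ltW Nw0) ?(ltW K'0) // mulrCA; congr (_ * _).
    rewrite -[X in X * _]powRr1 ?(ltW Nw0) // -powRD ?(gt_eqF Nw0) ?implybT //.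
    rewrite -[RHS](_ : (Nw (cabs w) `^ (-1)) `^ s = _); last by rewrite powR_inv1 // ltW.
    by rewrite -powRrM; congr (_ `^ _); field; rewrite gt_eqF.
  rewrite ge0_ler_powR ?s0 ?nnegrE ?powR_ge0 ?divr_ge0 ?(ltW K'0) ?(ltW Nw0) //.
  by rewrite ler_pdivlMr // HK'.
apply: (@le_trans _ _ (cabs (f w) `^ p * Nw (cabs w) * (K' `^ s * Nw (cabs w) `^ (- (q / p))))%:E).
  by rewrite lee_fin.
have k0 : (0 <= (K' `^ s * Nw (cabs w) `^ (- (q / p)))%:E)%E by rewrite lee_fin mulr_ge0 ?powR_ge0.
rewrite EFinM muleC; apply: le_trans (lee_wpmul2l k0 (HK f w af w1)) _.
rewrite muleCA [X in (_ <= X * _)%E]EFinM -muleA lee_pmul2l ?lte_fin //.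
rewrite [X in (X * _ <= _)%E]EFinM -muleA lee_pmul2l ?lte_fin ?powR_gt0 //.
rewrite -ge0_integralZl ?lee_fin ?powR_ge0 //; last by move=> x _; rewrite lee_fin; exact: F0.
apply: le_ge0_integral => x _; first by rewrite -EFinM lee_fin; exact: mulr_ge0 (powR_ge0 _ _) (F0 x).
rewrite -EFinM lee_fin /F.
have [xD|/om_out ->] := pselect (discR x); last by rewrite !mul0r mulr0.
case: (leP (cabs w) (rad x)) => wx; last by rewrite /= !(mulr0, mul0r).
have x1 : rad x < 1 by [].
pose a := om (rad x) * cabs (f (toC x)) `^ p * cabs (bk (toC x) w) ^+ n.+2.
have a0 : 0 <= a.
  by apply: mulr_ge0 (exprn_ge0 _ (cabs_ge0 _)); apply: mulr_ge0 (om_ge0 rw _) (powR_ge0 _ _).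
have -> : Ww (- (q / p)) (rad x) = Nw (rad x) `^ (- (q / p)).
  by apply: WwE; rewrite rad_ge0 ltW.
rewrite [true%:R]/= [X in X <= _](_ : _ = a * Nw (cabs w) `^ (- (q / p))); last by rewrite /a; ring.
rewrite [X in _ <= X](_ : _ = a * Nw (rad x) `^ (- (q / p))); last by rewrite /a; ring.
have Nx : 0 < Nw (rad x) by apply: Nw_gt0; rewrite rad_ge0.
have qp : 0 <= q / p by apply: divr_ge0 (ltW p0); apply: le_trans (ltW p0) pq.
exact: powRN_le a0 Nx (Nw_le w0 wx x1) qp.
Qed.

End WeightedBergman.

(** * The space L^q *)

Lemma poweR_le (R : realType) (a b : \bar R) (s : R) :
  0 <= s -> (0 <= a)%E -> (a <= b)%E -> (a `^ s <= b `^ s)%E.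
Proof.
move=> s0 a0 ab; apply: gt0_ler_poweR => //; rewrite in_itv /= leey andbT //.
exact: le_trans a0 ab.
Qed.

Section LqNorm.
Variable R : realType.
Local Notation C := (Cplx R).
Local Notation D := (@discR R).
Variables (q : R) (ups : {measure set (R * R) -> \bar R}).
Hypothesis q1 : 1 <= q.
Hypothesis upsD : ups (~` D) = 0%E.
Local Notation Lq := (Lqnorm q ups).
Implicit Types (g h : R * R -> C) (x : R * R).

Let q0 : 0 < q. Proof. exact: lt_le_trans q1. Qed.

Let mD : measurable D. Proof. exact: measurable_discR. Qed.

Import HBNNSimple.

Lemma ge0_integral_disc (F : R * R -> \bar R) : (forall x, (0 <= F x)%E) ->
  (\int[ups]_x F x = \int[ups]_(x in D) F x)%E.
Proof.
move=> F0; apply/eqP; rewrite eq_le; apply/andP; split; last first.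
  rewrite [X in (X <= _)%E]integral_mkcond; apply: le_ge0_integral => x _.
    by rewrite patchE; case: ifP.
  by rewrite patchE; case: ifP.
rewrite ge0_integralTE //; apply: ge_ereal_sup => _ [h hF <-].
rewrite -integralT_nnsfun (@ge0_negligible_integral _ _ _ _ setT (~` D)) //; first last.
- by move=> x _; rewrite lee_fin.
- exact/measurable_EFinP.
- exact: measurableC.
rewrite setTD setCK; apply: le_ge0_integral => x _ //.
by rewrite lee_fin.
Qed.

Definition Eq g : \bar R := locked (\int[ups]_(x in D) (cabs (g x) `^ q)%:E)%E.

Lemma EqE g : Eq g = (\int[ups]_(x in D) (cabs (g x) `^ q)%:E)%E.
Proof. by rewrite /Eq -lock. Qed.

Lemma Eq_ge0 g : (0 <= Eq g)%E.
Proof. by rewrite EqE; apply: integral_ge0 => x _; rewrite lee_fin powR_ge0. Qed.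

Lemma LqE g : Lq g = (Eq g `^ q^-1)%E.
Proof.
rewrite /Lqnorm unlock EqE -ge0_integral_disc; last by move=> x; rewrite lee_fin powR_ge0.
congr (_ `^ _)%E.
by apply: eq_integral => x _; rewrite abse_EFin poweR_EFin ger0_norm ?cabs_ge0.
Qed.

Lemma Lq_ge0 g : (0 <= Lq g)%E.
Proof. by rewrite LqE poweR_ge0. Qed.

Lemma Lq_le g (B : R) : 0 <= B -> (Lq g <= B%:E)%E <-> (Eq g <= (B `^ q)%:E)%E.
Proof.
move=> B0; rewrite LqE; have E0 := Eq_ge0 g; split=> H; last first.
  have i0 : 0 <= q^-1 by rewrite invr_ge0 (ltW q0).
  apply: le_trans (poweR_le i0 E0 H) _.
  by rewrite poweR_EFin -powRrM mulfV ?gt_eqF // powRr1.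
rewrite -[Eq g]poweRe1 // -(mulVf (lt0r_neq0 q0)) poweRrM -poweR_EFin.
by apply: (poweR_le (ltW q0) _ H); exact: poweR_ge0.
Qed.

Lemma Lq_lty g : (Lq g < +oo)%E -> (Eq g < +oo)%E.
Proof. by rewrite LqE; apply: lty_poweRy; rewrite invr_neq0 // gt_eqF. Qed.

Lemma Eq_lty g : (Eq g < +oo)%E -> (Lq g < +oo)%E.
Proof. by rewrite LqE; exact: poweR_lty. Qed.

Lemma Lq_eq g h : (forall x, D x -> g x = h x) -> Lq g = Lq h.
Proof.
move=> gh.
have E : Eq g = Eq h by rewrite !EqE; apply: eq_integral => x /set_mem xD; rewrite gh.
by rewrite (LqE g) (LqE h) E.
Qed.

Lemma Lq_le_mono g h : (forall x, D x -> cabs (g x) <= cabs (h x)) -> (Lq g <= Lq h)%E.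
Proof.
move=> gh; rewrite (LqE g) (LqE h); have i0 : 0 <= q^-1 by rewrite invr_ge0 (ltW q0).
apply: (poweR_le i0 (Eq_ge0 g)); rewrite !EqE; apply: le_ge0_integral => x xD; rewrite lee_fin ?powR_ge0 //.
by rewrite ge0_ler_powR ?nnegrE ?cabs_ge0 ?gh // ltW.
Qed.

(** Measurability is known on the disc only; extension by zero makes it global, as Minkowski's
    inequality requires. *)
Definition cut g x : C := if x \in D then g x else 0.

Lemma cutE g x : D x -> cut g x = g x. Proof. by move=> xD; rewrite /cut mem_set. Qed.

Lemma measurable_cabs_powR g : cmeas D g -> measurable_fun D (fun x => cabs (g x) `^ q).
Proof.
by move=> mg; apply: (measurableT_comp (@measurable_powR R q)); exact: measurable_cabs.
Qed.

Lemma Lq_triangle g h : cmeas D g -> cmeas D h ->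
  (Lq (fun x => g x + h x)%R <= Lq g + Lq h)%E.
Proof.
move=> mg mh.
rewrite (@Lq_eq (fun x => g x + h x) (fun x => cut g x + cut h x)); last by move=> x xD; rewrite !cutE.
rewrite (@Lq_eq g (cut g)); last by move=> x xD; rewrite cutE.
rewrite (@Lq_eq h (cut h)); last by move=> x xD; rewrite cutE.
have mcg : measurable_fun setT (fun x => cabs (cut g x)) by apply: measurable_cabs; exact: cmeas_cut.
have mch : measurable_fun setT (fun x => cabs (cut h x)) by apply: measurable_cabs; exact: cmeas_cut.
apply: le_trans (minkowski_EFin ups mcg mch q1).
rewrite /Lqnorm unlock; apply: poweR_le.
- by rewrite invr_ge0 ltW.
- by apply: integral_ge0 => x _; exact: poweR_ge0.
apply: le_ge0_integral => x _; first exact: poweR_ge0.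
rewrite !abse_EFin !poweR_EFin lee_fin ge0_ler_powR ?nnegrE ?(ltW q0) //.
by rewrite ger0_norm ?cabs_ge0 // (le_trans (cabsD _ _)) // ler_norm.
Qed.

Lemma Lq_scale g (c : C) : cmeas D g -> Lq (fun x => c * g x) = ((cabs c)%:E * Lq g)%E.
Proof.
move=> mg; rewrite (LqE g) (LqE (fun x => c * g x)).
have -> : Eq (fun x => c * g x) = ((cabs c `^ q)%:E * Eq g)%E.
  rewrite !EqE -ge0_integralZl ?lee_fin ?powR_ge0 //; first last.
  - by move=> x _; rewrite lee_fin powR_ge0.
  - by apply/measurable_EFinP; exact: measurable_cabs_powR.
  by apply: eq_integral => x _; rewrite cabsM powRM ?cabs_ge0 // EFinM.
rewrite poweRM ?lee_fin ?powR_ge0 ?Eq_ge0 // poweR_EFin -powRrM mulfV ?gt_eqF //.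
by rewrite powRr1 // cabs_ge0.
Qed.

Lemma Lq0 : Lq (fun=> 0) = 0%E.
Proof.
rewrite LqE EqE; under eq_integral do rewrite cabs0 powR0 ?gt_eqF //.
by rewrite integral0 poweR0r // invr_neq0 // gt_eqF.
Qed.

Lemma Lq_triangleB g h : cmeas D g -> cmeas D h ->
  (Lq (fun x => g x - h x)%R <= Lq g + Lq h)%E.
Proof.
move=> mg mh; apply: le_trans (Lq_triangle mg (cmeasN mh)) _.
by rewrite leeD2l // Lq_le_mono // => x _; rewrite cabsN.
Qed.

End LqNorm.

(** * Compact operators and weakly null sequences *)

Lemma ofR_nat (R : realType) n : ofR n%:R = n%:R :> Cplx R.
Proof.
elim: n => // n; rewrite -!natr1 => <-.
by apply/eqP; rewrite eq_complex /= addr0 !eqxx.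
Qed.

Lemma cabs_nat (R : realType) n : cabs (n%:R : Cplx R) = n%:R.
Proof. by rewrite -ofR_nat cabs_ofR ger0_norm ?ler0n. Qed.

(** The coefficient of a^p is exactly 1, so that constants do not multiply up when many functions
    are added. For b <= a, convexity at t = b / a gives (1 + t)^p <= 1 + 2^p t; for a < b the sum is
    at most 2 b. *)
Lemma powR_addle (R : realType) (p a b : R) : 1 <= p -> 0 <= a -> 0 <= b ->
  (a + b) `^ p <= a `^ p + 2 `^ p * (a `^ (p - 1) * b + b `^ p).
Proof.
move=> p1 a0 b0; have p0 : 0 < p by exact: lt_le_trans p1.
have t0 : 0 <= 2 `^ p :> R := powR_ge0 _ _.
case: (ltP a b) => ab.
  apply: (@le_trans _ _ (2 `^ p * b `^ p)).
    rewrite -powRM // ge0_ler_powR ?nnegrE ?(ltW p0) //; lra.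
  have h1 := powR_ge0 a p; have h2 := mulr_ge0 t0 (mulr_ge0 (powR_ge0 a (p - 1)) b0).
  by rewrite mulrDr addrA lerDr addr_ge0.
have [a00|an0] := eqVneq a 0.
  have -> : b = 0 by apply/eqP; rewrite eq_le b0 -a00 ab.
  by rewrite addr0 lerDl mulr0 add0r mulr_ge0 ?powR_ge0.
have ap : 0 < a by rewrite lt_neqAle eq_sym an0.
set t := b / a; have tt : 0 <= t by rewrite divr_ge0.
have t1 : t <= 1 by rewrite ler_pdivrMr // mul1r.
have bE : b = t * a by rewrite /t divfK.
have conv : (1 + t) `^ p <= 1 + 2 `^ p * t.
  have := @convex_powR R p p1 (Itv01 tt t1) 2 1.
  rewrite !inE /= !in_itv /= ler0n ler01 !andbT => /(_ isT isT) h.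
  rewrite [X in X `^ _ <= _]convRE [X in _ <= X]convRE /= powR1 /unstable.onem in h.
  rewrite (_ : 1 + t = t * 2 + (1 - t) * 1); last by ring.
  apply: le_trans h _; rewrite [t * _]mulrC; lra.
have -> : a + b = a * (1 + t) by rewrite bE; ring.
rewrite powRM ?addr_ge0 //.
have aE : a `^ p = a `^ (p - 1) * a.
  by rewrite -{3}(powRr1 a0) -powRD ?subrK // (negPf an0) implybT.
apply: le_trans (ler_wpM2l (powR_ge0 _ _) conv) _.
rewrite mulrDr mulr1 lerD2l mulrDr mulrCA.
rewrite (_ : 2 `^ p * (a `^ p * t) = 2 `^ p * (a `^ (p - 1) * b)); last by rewrite aE bE; ring.
by rewrite lerDl mulr_ge0 ?powR_ge0.
Qed.

Lemma powR_add_le2 (R : realType) (p a b : R) : 0 < p -> 0 <= a -> 0 <= b ->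
  (a + b) `^ p <= 2 `^ p * (a `^ p + b `^ p).
Proof.
move=> p0; wlog ab : a b / a <= b.
  move=> H a0 b0; case: (leP a b) => [ab|/ltW ab]; first exact: H.
  by rewrite addrC [X in _ * X]addrC; exact: H.
move=> a0 b0; apply: (@le_trans _ _ (2 `^ p * b `^ p)).
  rewrite -powRM // ge0_ler_powR ?nnegrE ?(ltW p0) //; lra.
by rewrite ler_wpM2l ?powR_ge0 // lerDr powR_ge0.
Qed.

Lemma ge0_cvge0P (R : realType) (u : nat -> \bar R) : (forall n, (0 <= u n)%E) ->
  (u @ \oo --> 0%E) <->
  (forall e : R, 0 < e -> exists N, forall n, (N <= n)%N -> (u n <= e%:E)%E).
Proof.
move=> u0; split=> [uc e e0|H].
  have /fine_cvgP[[N1 _ fu] /cvgrPdist_le/(_ _ e0)[N2 _ h]] := uc.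
  exists (maxn N1 N2) => n; rewrite geq_max => /andP[n1 n2].
  have := h n n2; rewrite /= sub0r normrN => {}h.
  rewrite -(fineK (fu n n1)) lee_fin; exact: le_trans (ler_norm _) h.
apply/fine_cvgP; split.
  have [N HN] := H 1 ltr01; exists N => // n Nn.
  by rewrite ge0_fin_numE //; apply: le_lt_trans (HN n Nn) _; rewrite ltry.
apply/cvgrPdist_le => e e0; have [N HN] := H e e0; exists N => // n Nn.
have h := HN n Nn; have fu : u n \is a fin_num.
  by rewrite ge0_fin_numE //; apply: le_lt_trans h _; rewrite ltry.
by rewrite /= sub0r normrN ger0_norm ?fine_ge0 // -lee_fin fineK.
Qed.

Section CompactOperators.
Variable R : realType.
Local Notation C := (Cplx R).
Local Notation D := (@discR R).
Local Notation rad := (@Defs.rad R).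
Local Notation area := (@area R).
Variable omega : R -> R.
Hypothesis cD : classD omega.
Variables (p q : R) (ups : {measure set (R * R) -> \bar R}).
Hypothesis p1 : 1 < p.
Hypothesis q1 : 1 <= q.
Hypothesis upsD : ups (~` D) = 0%E.
Local Notation Lq := (Lqnorm q ups).
Local Notation ball := (Ap_ball omega p).
Local Notation J := (Jint omega).
Implicit Types (f : C -> C) (h : R * R -> C).

Let p0 : 0 < p. Proof. exact: lt_trans p1. Qed.

Let rw : radial_weight omega := cD.1.1.

Lemma cmeasurable_disc h : cmeasurable h -> cmeas D h.
Proof. by move=> [m1 m2]; split; apply: measurable_funTS. Qed.

Lemma ball_in_Ap f : ball f -> in_Ap p omega f.
Proof. by move=> /(Ap_ballE cD f p0)[]. Qed.

Lemma analytic_lin f f' (a b : C) : analytic_on_disc f -> analytic_on_disc f' ->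
  analytic_on_disc (fun z => a * f z + b * f' z).
Proof.
move=> af af' z zD.
exact: (@derivable_add C _ _ z (@derivable_mull C a f z (af z zD)) (@derivable_mull C b f' z (af' z zD))).
Qed.

Lemma analytic_cst (a : C) : analytic_on_disc (fun=> a).
Proof. by move=> z _; exact: derivable_cst. Qed.

Lemma measurable_om_powE (s : R) f : analytic_on_disc f ->
  measurable_fun setT (fun x => (om omega (rad x) * cabs (f (toC x)) `^ s)%:E).
Proof. by move=> af; apply/measurable_EFinP; exact: measurable_om_pow. Qed.

Lemma om_powE_ge0 (s : R) f x : (0 <= (om omega (rad x) * cabs (f (toC x)) `^ s)%:E)%E.
Proof. by rewrite lee_fin mulr_ge0 ?om_ge0 ?powR_ge0. Qed.

Lemma Jint_scale (s : R) (a : C) f : analytic_on_disc f ->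
  J s (fun z => a * f z) = ((cabs a `^ s)%:E * J s f)%E.
Proof.
move=> af; rewrite /Jint -ge0_integralZl ?lee_fin ?powR_ge0 //; first last.
- by move=> x _; exact: om_powE_ge0.
- exact: measurable_om_powE.
by apply: eq_integral => x _; rewrite -EFinM cabsM powRM ?cabs_ge0 //; congr EFin; ring.
Qed.

Lemma Jint_le2 (s c : R) f f' k : 0 <= c -> analytic_on_disc f' -> analytic_on_disc k ->
  (forall z, cabs z < 1 -> cabs (f z) `^ s <= c * (cabs (f' z) `^ s + cabs (k z) `^ s)) ->
  (J s f <= c%:E * (J s f' + J s k))%E.
Proof.
move=> c0 af' ak H; rewrite /Jint -ge0_integralD //; first last.
- exact: measurable_om_powE.
- by move=> x _; exact: om_powE_ge0.
- exact: measurable_om_powE.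
- by move=> x _; exact: om_powE_ge0.
rewrite -ge0_integralZl ?lee_fin //; first last.
- by move=> x _; apply: adde_ge0; exact: om_powE_ge0.
- by apply: emeasurable_funD; exact: measurable_om_powE.
apply: le_ge0_integral => x _; first exact: om_powE_ge0.
rewrite -EFinD -EFinM lee_fin -mulrDr mulrCA.
have [xD|/om_out ->] := pselect (D x); last by rewrite !mul0r.
by apply: (ler_wpM2l (om_ge0 rw _)); apply: H; rewrite cabs_toC.
Qed.

Lemma in_Ap_lin f f' (a b : C) : in_Ap p omega f -> in_Ap p omega f' ->
  in_Ap p omega (fun z => a * f z + b * f' z).
Proof.
move=> fA f'A; have [af af'] := (fA.1, f'A.1).
have al := @analytic_lin f f' a b af af'.
move/(in_ApE cD p0 af): fA => fJ; move/(in_ApE cD p0 af'): f'A => f'J.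
apply/(in_ApE cD p0 al).
have aZ (c : C) g : analytic_on_disc g -> analytic_on_disc (fun z => c * g z).
  by move=> ag z zD; exact: (@derivable_mull C c g z (ag z zD)).
have H := @Jint_le2 p (2 `^ p) _ _ _ (powR_ge0 _ _) (aZ a f af) (aZ b f' af').
apply: le_lt_trans (H _ _) _ => [z z1|].
  apply: le_trans _ (powR_add_le2 p0 (cabs_ge0 _) (cabs_ge0 _)).
  by rewrite ge0_ler_powR ?(ltW p0) ?nnegrE ?addr_ge0 ?cabs_ge0 // cabsD.
rewrite !Jint_scale //; have [j _ ->] := ge0_lty_EFin (Jint_ge0 cD p f) fJ.
have [j' _ ->] := ge0_lty_EFin (Jint_ge0 cD p f') f'J.
exact: ltry.
Qed.

Lemma ball_scale f (c : R) : analytic_on_disc f -> 0 < c -> (J p f <= (pi * c `^ p)%:E)%E ->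
  ball (fun z => ofR c^-1 * f z).
Proof.
move=> af c0 fJ; have c'0 : 0 <= c^-1 by rewrite invr_ge0 ltW.
split; first by move=> z zD; exact: (@derivable_mull C _ f z (af z zD)).
rewrite Jint_scale // cabs_ofR ger0_norm //.
apply: le_trans (lee_wpmul2l _ fJ) _; first by rewrite lee_fin powR_ge0.
by rewrite -EFinM lee_fin mulrCA -powRM ?(ltW c0) // mulVf ?gt_eqF // powR1 mulr1.
Qed.

Lemma area_intZ (c : R) (F : R * R -> R) : 0 <= c -> (forall x, 0 <= F x) ->
  measurable_fun setT F ->
  (\int[area]_x (c * F x)%:E = c%:E * \int[area]_x (F x)%:E)%E.
Proof.
move=> c0 F0 mF; rewrite -ge0_integralZl ?lee_fin //; first exact/measurable_EFinP.
by move=> x _; rewrite lee_fin.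
Qed.

Lemma area_intD (F G : R * R -> R) : (forall x, 0 <= F x) -> (forall x, 0 <= G x) ->
  measurable_fun setT F -> measurable_fun setT G ->
  (\int[area]_x (F x + G x)%:E = \int[area]_x (F x)%:E + \int[area]_x (G x)%:E)%E.
Proof.
move=> F0 G0 mF mG; rewrite -ge0_integralD //.
- by move=> x _; rewrite lee_fin.
- exact/measurable_EFinP.
- by move=> x _; rewrite lee_fin.
- exact/measurable_EFinP.
Qed.

(** [powR_addle] integrated: as |f| <= b, the cross term costs only the first power integral of
    [f'], which is small for the functions to be added. *)
Lemma Jint_add_bounded f f' (b : R) : analytic_on_disc f -> analytic_on_disc f' ->
  (forall z, cabs z < 1 -> cabs (f z) <= b) ->
  (J p (fun z => f z + f' z)%R <=
   J p f + (2 `^ p)%:E * ((b `^ (p - 1))%:E * J 1 f' + J p f'))%E.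
Proof.
move=> af af' fb; have om0 s g x : 0 <= om omega (rad x) * cabs (g (toC x)) `^ s :> R.
  by rewrite mulr_ge0 ?om_ge0 ?powR_ge0.
have mJ := @measurable_om_pow R omega cD.
rewrite /Jint -area_intZ ?powR_ge0 //; last exact: mJ.
rewrite -area_intD //; first last.
- exact: mJ.
- by apply: measurable_funM; [exact: measurable_cst|exact: mJ].
- by move=> x; rewrite mulr_ge0 ?powR_ge0.
have k0 x : 0 <= b `^ (p - 1) * (om omega (rad x) * cabs (f' (toC x)) `^ 1) +
    om omega (rad x) * cabs (f' (toC x)) `^ p.
  by apply: addr_ge0 => //; rewrite mulr_ge0 ?powR_ge0.
have mk : measurable_fun setT (fun x => b `^ (p - 1) * (om omega (rad x) * cabs (f' (toC x)) `^ 1) +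
    om omega (rad x) * cabs (f' (toC x)) `^ p).
  by apply: measurable_funD; [apply: measurable_funM; [exact: measurable_cst|]|]; exact: mJ.
rewrite -area_intZ ?powR_ge0 // -area_intD //; first last.
- by apply: measurable_funM; [exact: measurable_cst|exact: mk].
- exact: mJ.
- by move=> x; rewrite mulr_ge0 ?powR_ge0.
apply: le_ge0_integral => x _; first by rewrite lee_fin mulr_ge0 ?om_ge0 ?powR_ge0.
rewrite lee_fin; have [xD|/om_out ->] := pselect (D x); last by rewrite !mul0r !mulr0 !addr0 mulr0.
set o := om omega (rad x); set u := cabs (f (toC x)); set v := cabs (f' (toC x)).
have o0 : 0 <= o by exact: om_ge0.
have u0 : 0 <= u := cabs_ge0 _; have v0 : 0 <= v := cabs_ge0 _.
have ub : u <= b by apply: fb; rewrite cabs_toC.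
have p1' : 0 <= p - 1 by rewrite subr_ge0 ltW.
rewrite powRr1 //.
apply: (@le_trans _ _ (o * (u `^ p + 2 `^ p * (b `^ (p - 1) * v + v `^ p)))); last first.
  by rewrite le_eqVlt; apply/orP; left; apply/eqP; ring.
apply: (ler_wpM2l o0); apply: (@le_trans _ _ ((u + v) `^ p)).
  by rewrite ge0_ler_powR ?(ltW p0) ?nnegrE ?addr_ge0 ?cabsD ?cabs_ge0.
apply: le_trans (powR_addle (ltW p1) u0 v0) _.
rewrite lerD2l; apply: ler_wpM2l (powR_ge0 _ _) _ _ _; rewrite lerD2r.
apply: ler_wpM2r => //; rewrite ge0_ler_powR ?nnegrE //; exact: le_trans ub.
Qed.

Section OneCompact.
Variable K : operator R.
Hypothesis cK : compact_op p q omega ups K.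

Let Klin := let: And3 H _ _ := cK in H.
Let Kmeas f : in_Ap p omega f -> cmeas D (K f).
Proof. by case: cK => _ H _ /H; exact: cmeasurable_disc. Qed.

Lemma compact_scale (a : C) f : in_Ap p omega f -> K (fun z => a * f z) = (fun x => a * K f x).
Proof.
move=> fA; have := Klin a 0 fA fA.
rewrite (_ : (fun z => a * f z + 0 * f z) = (fun z => a * f z)).
  by move=> ->; apply: funext => x; rewrite mul0r addr0.
by apply: funext => x; rewrite mul0r addr0.
Qed.

Lemma compact_add f f' : in_Ap p omega f -> in_Ap p omega f' ->
  K (fun z => f z + f' z) = (fun x => K f x + K f' x).
Proof.
move=> fA f'A; have := Klin 1 1 fA f'A.
rewrite (_ : (fun z => 1 * f z + 1 * f' z) = (fun z => f z + f' z)).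
  by move=> ->; apply: funext => x; rewrite !mul1r.
by apply: funext => x; rewrite !mul1r.
Qed.

(** Otherwise some sequence in the ball has images of norm above n, and no subsequence of these can
    converge. *)
Lemma compact_bounded : exists2 B : R, 0 <= B & forall f, ball f -> (Lq (K f) <= B%:E)%E.
Proof.
apply: contrapT => nb.
have H (n : nat) : exists f, ball f /\ (n%:R%:E < Lq (K f))%E.
  apply: contrapT => nf; apply: nb; exists n%:R => // f fb; rewrite leNgt; apply/negP => h.
  by apply: nf; exists f.
have [F HF] := choice H.
have [_ _ /(_ F)] := cK; case=> [n|s [sS [g [mg gL cv]]]].
  by apply/(Ap_ballE cD _ p0); case: (HF n).
have [l l0 lE] := ge0_lty_EFin (Lq_ge0 q upsD g) gL.
move/ge0_cvge0P: cv => /(_ (fun n => Lq_ge0 q upsD _) 1 ltr01)[N HN].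
pose n := maxn N (Num.Def.trunc (1 + l)).+1.
have sn m : (m <= s m)%N by elim: m => // m IH; exact: leq_ltn_trans IH (sS m).
have Ln : (Lq (K (F (s n))) <= (1 + l)%:E)%E.
  rewrite (@Lq_eq _ _ _ upsD _ (fun x => (K (F (s n)) x - g x) + g x)); last first.
    by move=> x _; rewrite subrK.
  have mF : cmeas D (K (F (s n))) by apply: Kmeas; apply: ball_in_Ap; case: (HF (s n)).
  apply: le_trans (Lq_triangle q1 upsD (cmeasD mF (cmeasN (cmeasurable_disc mg))) (cmeasurable_disc mg)) _.
  by rewrite lE EFinD leeD2r // HN // leq_maxl.
have := lt_le_trans (HF (s n)).2 Ln; rewrite lte_fin ltNge => /negP; apply.
apply: le_trans (ltW (truncnS_gt _)) _; rewrite ler_nat.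
by apply: leq_trans (sn _); exact: leq_maxr.
Qed.

Lemma compact_bounded_scale B f (c : R) : (forall f, ball f -> (Lq (K f) <= B%:E)%E) ->
  in_Ap p omega f -> 0 < c -> (J p f <= (pi * c `^ p)%:E)%E -> (Lq (K f) <= (B * c)%:E)%E.
Proof.
move=> HB fA c0 fJ; have af := fA.1.
have c'0 : 0 <= c^-1 by rewrite invr_ge0 ltW.
have gb := ball_scale af c0 fJ.
have := HB _ gb; rewrite compact_scale // Lq_scale //; last exact: Kmeas.
rewrite cabs_ofR ger0_norm // => h.
have := lee_wpmul2l (_ : (0 <= c%:E)%E) h; rewrite lee_fin => /(_ (ltW c0)).
by rewrite muleA -EFinM mulfV ?gt_eqF // mul1e -EFinM mulrC.
Qed.


(* If K (G n) stayed away from 0, sums of N suitably spaced G n would have A^p norm O(N^(1/p)),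
   while their images, close to N times one limit, would have norm of order N. *)
Lemma weak_null (G : nat -> C -> C) (B : R) : 0 < B -> (forall n, ball (G n)) ->
  (forall n, exists b, forall z, cabs z < 1 -> cabs (G n z) <= b) ->
  (forall e : R, 0 < e -> exists N, forall n, (N <= n)%N -> (J 1 (G n) <= e%:E)%E) ->
  exists n, (Lq (K (G n)) <= B%:E)%E.
Proof.
move=> B0 Gb Gbd GJ; apply: contrapT => nE.
have KG n : (B%:E < Lq (K (G n)))%E.
  by rewrite ltNge; apply/negP => h; apply: nE; exists n.
have [bd bd0 Hbd] := compact_bounded.
have [_ _ /(_ G)] := cK; case=> [n|s [sS [g [mg gL cv]]]]; first exact/(Ap_ballE cD _ p0).
have mgD := cmeasurable_disc mg.
have sn m : (m <= s m)%N by elim: m => // m IH; exact: leq_ltn_trans IH (sS m).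
have [l l0 lE] := ge0_lty_EFin (Lq_ge0 q upsD g) gL.
(* The images past index [N] lie within [d] of [g], so its norm [l] is at least 3 d; in a sum of m
   images the errors reach m d at most, which leaves 2 m d. *)
pose d := B / 4; have d0 : 0 < d by rewrite divr_gt0.
move/ge0_cvge0P: cv => /(_ (fun n => Lq_ge0 q upsD _) d d0)[N HN].
have mKG n : cmeas D (K (G n)) by apply: Kmeas; exact: ball_in_Ap.
have ld : 3 * d <= l.
  have : (Lq (K (G (s N))) <= (d + l)%:E)%E.
    rewrite (@Lq_eq _ _ _ upsD _ (fun x => (K (G (s N)) x - g x) + g x)); last first.
      by move=> x _; rewrite subrK.
    apply: le_trans (Lq_triangle q1 upsD (cmeasD (mKG _) (cmeasN mgD)) mgD) _.
    by rewrite lE EFinD leeD2r // HN.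
  by move=> /(lt_le_trans (KG _)); rewrite lte_fin /d; lra.
pose c := 2 `^ p * (1 + pi : R); have pi0 := @pi_gt0 R.
have c0 : 0 < c by apply: mulr_gt0; [exact: powR_gt0|exact: addr_gt0].
have P (m : nat) : exists S, [/\ in_Ap p omega S,
    (exists b, forall z, cabs z < 1 -> cabs (S z) <= b), (J p S <= (c * m%:R)%:E)%E &
    (Lq (fun x => K S x - m%:R * g x)%R <= (m%:R * d)%:E)%E].
  elim: m => [|m [S [SA [b Sb] SJ SL]]].
    have aG := (Gb 0).1; have GA := ball_in_Ap (Gb 0).
    exists (fun z => 0 * G 0%N z).
    have J0 : J p (fun z => 0 * G 0%N z) = 0%E.
      by rewrite Jint_scale // cabs0 powR0 ?gt_eqF // mul0e.
    split.
    - apply/(in_ApE cD p0); last by rewrite J0 ltry.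
      by move=> z zD; exact: (@derivable_mull C _ _ z (aG z zD)).
    - by exists 0 => z _; rewrite mul0r cabs0.
    - by rewrite J0 mulr0.
    - rewrite compact_scale // (@Lq_eq _ _ _ upsD _ (fun=> 0)) ?Lq0 ?mul0r //.
      by move=> x _; rewrite !mul0r subr0.
  (* Chosen after [S], whose bound [b] enters: the cross term is then at most 1, and a new summand
     adds at most c = 2^p (1 + pi) to the p-th power integral. *)
  pose e := (`|b| `^ (p - 1) + 1)^-1.
  have e0 : 0 < e by rewrite invr_gt0 ltr_wpDl ?powR_ge0.
  have [N' HN'] := GJ e e0; pose n := maxn N N'.
  have Gn := Gb (s n); have GA := ball_in_Ap Gn; have [b' Gb'] := Gbd (s n).
  have SAn : in_Ap p omega (fun z => S z + G (s n) z).
    have := in_Ap_lin 1 1 SA GA; congr (in_Ap _ _ _).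
    by apply: funext => z; rewrite !mul1r.
  exists (fun z => S z + G (s n) z); split=> //.
  - exists (b + b') => z z1; apply: le_trans (cabsD _ _) _.
    by apply: lerD; [exact: Sb|exact: Gb'].
  - have Sb' z : cabs z < 1 -> cabs (S z) <= `|b|.
      by move=> /Sb h; apply: le_trans h (ler_norm _).
    apply: le_trans (Jint_add_bounded SA.1 Gn.1 Sb') _.
    have J1 : ((`|b| `^ (p - 1))%:E * J 1 (G (s n)) <= 1%:E)%E.
      have h : (J 1 (G (s n)) <= e%:E)%E by apply: HN'; exact: leq_trans (leq_maxr _ _) (sn _).
      apply: le_trans (lee_wpmul2l _ h) _; first by rewrite lee_fin powR_ge0.
      by rewrite -EFinM lee_fin ler_pdivrMr ?mul1r ?lerDl // ltr_wpDl ?powR_ge0.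
    have t0 : (0 <= (2 `^ p)%:E)%E by rewrite lee_fin powR_ge0.
    apply: (@le_trans _ _ ((c * m%:R)%:E + (2 `^ p)%:E * (1%:E + pi%:E))%E).
      by apply: leeD => //; apply: (lee_wpmul2l t0); apply: leeD => //; exact: Gn.2.
    by rewrite (_ : (_ + _)%E = (c * m%:R + 2 `^ p * (1 + pi))%:E) // lee_fin -[m.+1%:R]natr1 [c * (_ + 1)]mulrDr mulr1.
  - rewrite compact_add //.
    rewrite (@Lq_eq _ _ _ upsD _ (fun x => (K S x - m%:R * g x) + (K (G (s n)) x - g x))); last first.
      by move=> x _; rewrite -natr1; ring.
    have mKS := Kmeas SA.
    apply: le_trans (Lq_triangle q1 upsD (cmeasD mKS (cmeasN (cmeasM (cmeas_cst _ _) mgD)))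
      (cmeasD (mKG (s n)) (cmeasN mgD))) _.
    rewrite -natr1 mulrDl mul1r EFinD; apply: leeD => //; apply: HN; exact: leq_maxl.
pose X := bd * (c / pi) `^ p^-1.
have X0 : 0 <= X by rewrite mulr_ge0 ?powR_ge0.
pose t := 1 - p^-1; have t0 : 0 < t by rewrite subr_gt0 invf_lt1.
pose Y := X / (2 * d); have Y0 : 0 <= Y by rewrite divr_ge0 // mulr_ge0 // ltW.
(* As p > 1, t = 1 - 1/p is positive and m^t exceeds [Y] for this m; this means X m^(1/p) < 2 m
   d. *)
pose m := (Num.Def.trunc (Y `^ t^-1)).+1.
have mY : Y < m%:R `^ t.
  have YE : (Y `^ t^-1) `^ t = Y by rewrite -powRrM mulVf ?gt_eqF // powRr1.
  by rewrite -[X in X < _]YE gt0_ltr_powR ?nnegrE ?powR_ge0 // truncnS_gt.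
have m0 : 0 < m%:R :> R by rewrite ltr0n.
have [S [SA _ SJ SL]] := P m.
have cm0 : 0 < c * m%:R / pi by apply: divr_gt0 => //; exact: mulr_gt0.
have KS : (Lq (K S) <= (X * m%:R `^ p^-1)%:E)%E.
  have -> : X * m%:R `^ p^-1 = bd * (c * m%:R / pi) `^ p^-1.
    by rewrite /X -mulrA -powRM ?ler0n ?divr_ge0 ?(ltW c0) ?(ltW pi0) // mulrAC.
  apply: (compact_bounded_scale Hbd SA); first by rewrite powR_gt0.
  rewrite -powRrM mulVf ?gt_eqF // powRr1 ?(ltW cm0) //.
  by rewrite mulrC divfK ?gt_eqF.
have mKS := Kmeas SA.
have : (Lq (fun x => m%:R * g x)%R <= (X * m%:R `^ p^-1 + m%:R * d)%:E)%E.
  rewrite (@Lq_eq _ _ _ upsD _ (fun x => K S x - (K S x - m%:R * g x))); last first.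
    by move=> x _; rewrite opprB addrC subrK.
  apply: le_trans (Lq_triangleB q1 upsD mKS (cmeasD mKS (cmeasN (cmeasM (cmeas_cst _ _) mgD)))) _.
  by rewrite EFinD; apply: leeD.
rewrite Lq_scale // cabs_nat.
rewrite lE -EFinM lee_fin => H.
have mE : m%:R = m%:R `^ p^-1 * m%:R `^ t :> R.
  by rewrite -powRD ?(gt_eqF m0) ?implybT // addrC subrK powRr1 // ltW.
have h1 : m%:R * (3 * d) <= m%:R * l by rewrite ler_pM2l.
have h2 : m%:R `^ p^-1 * Y < m%:R :> R by rewrite [X in _ < X]mE ltr_pM2l // powR_gt0.
have h3 : m%:R `^ p^-1 * X < m%:R * (2 * d).
  by rewrite -ltr_pdivrMr ?mulr_gt0 // -mulrA.
by move: H h1 h3; rewrite [X * _]mulrC; lra.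
Qed.

End OneCompact.
End CompactOperators.

(** * Normalized kernels *)

Section NormalizedKernels.
Variable R : realType.
Local Notation C := (Cplx R).
Local Notation D := (@discR R).
Local Notation rad := (@Defs.rad R).
Local Notation area := (@area R).
Variable omega : R -> R.
Hypothesis cD : classD omega.
Variables (p : R) (L : nat) (A : R).
Hypothesis p1 : 1 < p.
Hypothesis A0 : 0 < A.
Hypothesis HL : forall z : C, cabs z < 1 ->
  (\int[area]_x (om omega (rad x) * cabs (bk z (toC x)) ^+ L)%:E <=
    (A * ((1 - cabs z) * hat omega (cabs z)))%:E)%E.
Implicit Types (z w : C).

Let p0 : 0 < p. Proof. exact: lt_trans p1. Qed.

Let rw : radial_weight omega := cD.1.1.

(** Upper bound for the A^p_omega norm of the kernel powers at z; division by it puts them into the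
    unit ball. *)
Definition kd z : R := (A * Nw omega (cabs z) / pi) `^ p^-1.

Lemma kd_gt0 z : cabs z < 1 -> 0 < kd z.
Proof.
move=> z1; apply: powR_gt0; apply: divr_gt0 (@pi_gt0 R); apply: mulr_gt0 => //.
by apply: Nw_gt0 => //; rewrite cabs_ge0.
Qed.

Lemma kdE z : cabs z < 1 -> pi * kd z `^ p = A * Nw omega (cabs z).
Proof.
move=> z1; have N0 : 0 < Nw omega (cabs z) by apply: Nw_gt0 => //; rewrite cabs_ge0.
have pi0 := @pi_gt0 R.
rewrite /kd -powRrM mulVf ?gt_eqF // powRr1; first by rewrite mulrC divfK ?gt_eqF.
by apply: ltW; apply: divr_gt0 => //; exact: mulr_gt0.
Qed.

Lemma kernel_analytic z n : cabs z < 1 -> analytic_on_disc (fun w => bk z w ^+ n).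
Proof.
move=> z1 w wD; have w1 : cabs w < 1 by move: wD; rewrite inE.
exact: (@derivable_pow C (bk z) n w (derivable_bk z1 (ltW w1))).
Qed.

(** As |b_z| <= 1, |b_z|^(n s) <= |b_z|^L. The bound is used for s = p, to enter the ball, and for s
    = 1, to obtain weak convergence. *)
Lemma kernel_Jint (s : R) n z : 1 <= s -> (L <= n)%N -> cabs z < 1 ->
  (Jint omega s (fun w => bk z w ^+ n)%R <= (pi * kd z `^ p)%:E)%E.
Proof.
move=> s1 Ln z1; rewrite kdE //; apply: le_trans (HL z1).
apply: le_ge0_integral => x _; first by rewrite lee_fin mulr_ge0 ?om_ge0 ?powR_ge0.
rewrite lee_fin; have [xD|/om_out ->] := pselect (D x); last by rewrite !mul0r.
apply: (ler_wpM2l (om_ge0 rw _)).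
have b1 : cabs (bk z (toC x)) <= 1 by apply: cabs_bk_le1 => //; rewrite cabs_toC ltW.
have b0 := cabs_ge0 (bk z (toC x)).
apply: le_trans (ler_wiXn2l b0 b1 Ln); rewrite cabsX.
have [->|n0] := eqVneq (cabs (bk z (toC x)) ^+ n) 0.
  by rewrite powR0 // gt_eqF // (lt_le_trans _ s1).
by apply: ge1r_powR => //; rewrite lt_neqAle eq_sym n0 exprn_ge0 ?exprn_ile1.
Qed.

Lemma kd_null (e : R) : 0 < e ->
  exists r : R, 0 <= r < 1 /\ forall z, r <= cabs z -> cabs z < 1 -> kd z <= e.
Proof.
move=> e0; have pi0 := @pi_gt0 R.
pose Y := A * hat omega 0 / pi.
have Y0 : 0 <= Y.
  by apply: divr_ge0 (ltW pi0); apply: mulr_ge0 (ltW A0) _; apply: hat_ge0 => //; rewrite lexx ler01.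
have ep : 0 < e `^ p by exact: powR_gt0.
have Y1 : 0 < Y + 1 by exact: ltr_wpDl.
exists (Num.max 0 (1 - e `^ p / (Y + 1))); split.
  by rewrite le_max lexx /= gt_max ltr01 /= gtrBl divr_gt0.
move=> z; rewrite ge_max => /andP[z0 rz] z1.
have -> : e = (e `^ p) `^ p^-1 by rewrite -powRrM mulfV ?gt_eqF // powRr1 // ltW.
have h0 : hat omega (cabs z) <= hat omega 0 by apply: hat_le => //; exact: ltW.
have h1 : 0 <= hat omega (cabs z) by apply: hat_ge0 => //; rewrite z0 ltW.
have d0 : 0 <= 1 - cabs z by rewrite subr_ge0 ltW.
have N0 : 0 <= Nw omega (cabs z) by exact: mulr_ge0.
have i0 : 0 <= p^-1 by rewrite invr_ge0 ltW.
have ANp : 0 <= A * Nw omega (cabs z) / pi by apply: divr_ge0 (ltW pi0); exact: mulr_ge0 (ltW A0) N0.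
have le1 : A * Nw omega (cabs z) / pi <= Y * (1 - cabs z).
  rewrite /Y [X in _ <= X]mulrAC; apply: ler_wpM2r; first by rewrite invr_ge0 ltW.
  by rewrite -mulrA; apply: (ler_wpM2l (ltW A0)); rewrite mulrC; exact: (ler_wpM2l d0).
have le2 : Y * (1 - cabs z) <= e `^ p.
  have : 1 - cabs z <= e `^ p / (Y + 1) by move: rz; lra.
  rewrite ler_pdivlMr // => h; apply: le_trans h.
  by rewrite mulrC; apply: (ler_wpM2l d0); lra.
by apply: ge0_ler_powR; rewrite ?nnegrE ?(ltW ep) //; exact: le_trans le1 le2.
Qed.

Variables (q : R) (ups : {measure set (R * R) -> \bar R}).
Hypothesis q1 : 1 <= q.
Hypothesis upsD : ups (~` D) = 0%E.
Local Notation Lq := (Lqnorm q ups).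

(** Otherwise there are points tending to the boundary whose kernel powers, divided by [kd], lie in
    the ball, are bounded functions, and have first power integral at most pi kd^(p-1). The latter
    tends to 0 as p > 1, which contradicts [weak_null]. *)
Lemma compact_kernel K n (B : R) : compact_op p q omega ups K -> (L <= n)%N -> 0 < B ->
  exists r : R, 0 <= r < 1 /\ forall z, r <= cabs z -> cabs z < 1 ->
    (Lq (K (fun w => bk z w ^+ n)%R) <= (B * kd z)%:E)%E.
Proof.
move=> cK Ln B0; apply: contrapT => nr.
have H (m : nat) : exists z, [/\ 1 - m.+1%:R^-1 <= cabs z, cabs z < 1 &
    ((B * kd z)%:E < Lq (K (fun w => bk z w ^+ n)%R))%E].
  apply: contrapT => nz; apply: nr; exists (1 - m.+1%:R^-1); split.
    by rewrite subr_ge0 invf_le1 ?ltr0n // ler1n /= gtrBl invr_gt0 ltr0n.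
  move=> z rz z1; rewrite leNgt; apply/negP => h; apply: nz; exists z; split=> //.
have [zz Hz] := choice H.
have pi0 := @pi_gt0 R.
have zz1 m : cabs (zz m) < 1 by case: (Hz m).
have k0 m := kd_gt0 (zz1 m).
have af m : analytic_on_disc (fun w => bk (zz m) w ^+ n) by exact: kernel_analytic.
pose G m := fun w => ofR (kd (zz m))^-1 * bk (zz m) w ^+ n.
have Gb m : Ap_ball omega p (G m).
  by apply: ball_scale => //; exact: kernel_Jint (ltW p1) Ln _.
have [m Hm] : exists m, (Lq (K (G m)) <= B%:E)%E.
  apply: (weak_null cD p1 q1 upsD cK B0 Gb) => [m|e e0].
    exists (kd (zz m))^-1 => w w1; rewrite cabsM cabs_ofR ger0_norm ?invr_ge0 ?(ltW (k0 _)) //.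
    rewrite cabsX ler_piMr ?invr_ge0 ?(ltW (k0 _)) // exprn_ile1 ?cabs_ge0 //.
    by apply: cabs_bk_le1 => //; exact: ltW.
  have pp : 0 < p - 1 by rewrite subr_gt0.
  have [r [/andP[r0 r1] Hr]] := @kd_null ((e / pi) `^ (p - 1)^-1) (powR_gt0 _ (divr_gt0 e0 pi0)).
  have r1' : 0 < 1 - r by rewrite subr_gt0.
  exists (Num.Def.trunc (1 - r)^-1) => m Nm.
  rewrite Jint_scale // cabs_ofR ger0_norm ?invr_ge0 ?(ltW (k0 _)) //.
  have [h1 _ _] := Hz m.
  have rz : r <= cabs (zz m).
    apply: le_trans h1; rewrite lerBrDr -lerBrDl -[X in _ <= X]invrK lef_pV2 ?posrE ?ltr0n ?invr_gt0 //.
    by apply: le_trans (ltW (truncnS_gt _)) _; rewrite ler_nat ltnS.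
  have ke := Hr _ rz (zz1 m).
  apply: le_trans (lee_wpmul2l _ (kernel_Jint (lexx 1) Ln (zz1 m))) _.
    by rewrite lee_fin powR_ge0.
  rewrite -EFinM lee_fin powRr1 ?invr_ge0 ?(ltW (k0 _)) //.
  have -> : kd (zz m) `^ p = kd (zz m) `^ (p - 1) * kd (zz m).
    by rewrite -[X in _ = _ * X](powRr1 (ltW (k0 m))) -powRD ?(gt_eqF (k0 m)) ?implybT // subrK.
  have -> : (kd (zz m))^-1 * (pi * (kd (zz m) `^ (p - 1) * kd (zz m))) = pi * kd (zz m) `^ (p - 1).
    by field; rewrite gt_eqF.
  rewrite -ler_pdivlMl // mulrC.
  have -> : e / pi = ((e / pi) `^ (p - 1)^-1) `^ (p - 1).
    by rewrite -powRrM mulVf ?gt_eqF // powRr1 // divr_ge0 // ltW.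
  by apply: ge0_ler_powR; rewrite ?nnegrE ?powR_ge0 ?(ltW pp) ?(ltW (k0 _)).
have [_ _] := Hz m; rewrite ltNge => /negP; apply.
have fA : in_Ap p omega (fun w => bk (zz m) w ^+ n).
  apply/(in_ApE cD p0 (af m)); apply: le_lt_trans (kernel_Jint (ltW p1) Ln (zz1 m)) _.
  exact: ltry.
move: Hm; rewrite (compact_scale cK _ fA) Lq_scale //; last first.
  by case: cK => _ Km _; exact: cmeasurable_disc (Km _ fA).
rewrite cabs_ofR ger0_norm ?invr_ge0 ?(ltW (k0 _)) // => h.
have := lee_wpmul2l (_ : (0 <= (kd (zz m))%:E)%E) h; rewrite lee_fin => /(_ (ltW (k0 m))).
by rewrite muleA -EFinM mulfV ?(gt_eqF (k0 m)) // mul1e -EFinM mulrC.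
Qed.

End NormalizedKernels.

Lemma cabsM_le (R : realType) (a b : Cplx R) (x y : R) :
  cabs a <= x -> cabs b <= y -> cabs (a * b) <= x * y.
Proof. by move=> ax bY; rewrite cabsM ler_pM ?cabs_ge0. Qed.

(* The parenthesized terms are the values of T on three consecutive powers of a kernel; v is
   eliminated from them. *)
Lemma kernel_algebra (R : realType) (n : nat) (u v t s : Cplx R) :
  cabs t <= 1 -> cabs s <= 1 ->
  cabs (u * t ^+ n.+3) <= (2 * n%:R + 5) ^+ 2 *
    (cabs (u * t ^+ n.+1 + v * (n.+1%:R * s ^+ n)) +
     cabs (u * t ^+ n.+2 + v * (n.+2%:R * s ^+ n.+1)) +
     cabs (u * t ^+ n.+3 + v * (n.+3%:R * s ^+ n.+2))).
Proof.
move=> t1 s1.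
set a0 : Cplx R := _ + v * (n.+1%:R * s ^+ n); set a1 : Cplx R := _ + v * (n.+2%:R * _); set a2 : Cplx R := _ + v * _.
pose m : Cplx R := n.+1%:R.
(* Put delta = (m + 1) (t - s). Two combinations are free of [v]: (m + 1) s a0 - m a1 = u t^(n+1) (t
   - delta) and s^2 a0 - 2 s a1 + a2 = u t^(n+1) (t - s)^2. Multiply them by t + delta and (m + 1)^2
   and use (t + delta) (t - delta) + delta^2 = t^2. *)
have E : u * t ^+ n.+3 = ((t + (m + 1) * (t - s)) * (m + 1) * s + (m + 1) ^+ 2 * s ^+ 2) * a0 +
    (- ((t + (m + 1) * (t - s)) * m) - 2 * (m + 1) ^+ 2 * s) * a1 + (m + 1) ^+ 2 * a2.
  rewrite /a0 /a1 /a2 /m -[n.+3%:R]natr1 -[n.+2%:R]natr1 !exprS; ring.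
have mE : cabs m = n%:R + 1 by rewrite /m cabs_nat natr1.
have n0 : 0 <= n%:R :> R by exact: ler0n.
set N := n%:R in mE n0 *.
have m1 : cabs (m + 1) <= N + 2.
  by apply: le_trans (cabsD _ _) _; rewrite mE cabs1; lra.
have m2 : cabs ((m + 1) ^+ 2) <= (N + 2) ^+ 2 by rewrite !expr2; exact: cabsM_le.
have e2 : cabs (t - s) <= 2.
  by apply: le_trans (cabsB _ _) _; lra.
have te : cabs (t + (m + 1) * (t - s)) <= 2 * N + 5.
  apply: le_trans (cabsD _ _) _; have := cabsM_le m1 e2; lra.
have s2 : cabs (s ^+ 2) <= 1 by rewrite cabsX exprn_ile1 ?cabs_ge0.
have X0 : cabs ((t + (m + 1) * (t - s)) * (m + 1) * s + (m + 1) ^+ 2 * s ^+ 2) <= (2 * N + 5) ^+ 2.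
  apply: le_trans (cabsD _ _) _.
  have h1 := cabsM_le (cabsM_le te m1) s1; have h2 := cabsM_le m2 s2.
  apply: le_trans (lerD h1 h2) _; rewrite !mulr1; nra.
have X1 : cabs (- ((t + (m + 1) * (t - s)) * m) - 2 * (m + 1) ^+ 2 * s) <= (2 * N + 5) ^+ 2.
  apply: le_trans (cabsB _ _) _; rewrite cabsN.
  have h1 : cabs ((t + (m + 1) * (t - s)) * m) <= (2 * N + 5) * (N + 1).
    by apply: (cabsM_le te); rewrite mE.
  have c2 : cabs (2 : Cplx R) <= 2 by rewrite cabs_nat.
  have h2 := cabsM_le (cabsM_le c2 m2) s1.
  apply: le_trans (lerD h1 h2) _; rewrite !mulr1; nra.
have X2 : cabs ((m + 1) ^+ 2) <= (2 * N + 5) ^+ 2.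
  by apply: le_trans m2 _; nra.
rewrite E 2!(mulrDr ((2 * N + 5) ^+ 2)).
apply: le_trans (cabsD _ _) _; apply: lerD (cabsM_le X2 (lexx _)).
apply: le_trans (cabsD _ _) _; exact: lerD (cabsM_le X0 (lexx _)) (cabsM_le X1 (lexx _)).
Qed.

(** * Tonelli's inequality for a possibly non-sigma-finite measure *)

Section PartialTonelli.
Variables (R : realType) (d1 d2 : measure_display).
Variables (T1 : measurableType d1) (T2 : measurableType d2).
Variables (m1 : {sigma_finite_measure set T1 -> \bar R}) (m2 : {measure set T2 -> \bar R}).
Variables (D : set T2) (w : T2 -> R).
Hypotheses (mD : measurable D) (mw : measurable_fun D w) (w0 : forall x, D x -> 0 <= w x).
Hypothesis wfin : (\int[m2]_(x in D) (w x)%:E < +oo)%E.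

Let S k := D `&` [set x | k.+1%:R^-1 <= w x].

Let mS k : measurable (S k).
Proof.
have := mw mD (@measurable_itv R `[k.+1%:R^-1, +oo[).
rewrite (_ : D `&` _ = S k) //; apply/seteqP; split=> x [xD] /=; rewrite in_itv /= andbT //.
Qed.

(** Chebyshev's inequality for the integrable weight [w]. *)
Let S_fin k : (m2 (S k) < +oo)%E.
Proof.
have h : ((k.+1%:R^-1)%:E * m2 (S k) <= \int[m2]_(x in D) (w x)%:E)%E.
  rewrite -integral_cst // [X in (X <= _)%E]integral_mkcond [X in (_ <= X)%E]integral_mkcond.
  apply: le_ge0_integral => x _.
    by rewrite patchE; case: ifP => // _; rewrite lee_fin invr_ge0 ler0n.
  rewrite !patchE; case: ifPn => [/set_mem[xD wx]|_]; first by rewrite mem_set // lee_fin.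
  by case: ifPn => // /set_mem xD; rewrite lee_fin w0.
have := le_lt_trans h wfin; have := measure_ge0 m2 (S k).
by case: (m2 (S k)) => [r _ _|_|//]; rewrite ?ltry // gt0_muley ?ltxx // lte_fin invr_gt0 ltr0n.
Qed.

(* m2 need not be sigma-finite; w controls it on the set where it is positive. *)
Lemma tonelli_le (H : T1 * T2 -> \bar R) : measurable_fun setT H -> (forall t, (0 <= H t)%E) ->
  (\int[m2]_(x in D `&` [set x | (0 < w x)%R]) \int[m1]_y H (y, x) <=
   \int[m1]_y \int[m2]_(x in D) H (y, x))%E.
Proof.
move=> mH H0.
have mG : measurable_fun setT (fun x => \int[m1]_y H (y, x))%E.
  exact: (@measurable_fun_fubini_tonelli_G _ _ _ _ _ m1 H mH H0).
have SE : D `&` [set x | (0 < w x)%R] = \bigcup_k S k.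
  apply/seteqP; split=> x.
    move=> [xD /= wx]; exists (Num.Def.trunc (w x)^-1) => //; split=> //=.
    rewrite -[X in _ <= X]invrK lef_pV2 ?posrE ?ltr0n ?invr_gt0 //.
    exact: ltW (truncnS_gt _).
  by move=> [k _ [xD /= wx]]; split=> //=; apply: lt_le_trans wx; rewrite invr_gt0 ltr0n.
rewrite SE.
have ndS : nondecreasing_seq S.
  move=> i j ij; apply/subsetPset => x [xD /= wx]; split=> //=; apply: le_trans wx.
  by rewrite lef_pV2 ?posrE ?ltr0n // ler_nat ltnS.
have G0 i x : S i x -> (0 <= \int[m1]_y H (y, x))%E by move=> _; apply: integral_ge0.
have cv := @ge0_nondecreasing_set_cvg_integral _ _ _ S _ m2 ndS mS
  (fun i => @measurable_funTS _ _ _ _ (S i) _ mG) G0.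
apply: (cvge_to_le cv); apply: nearW => k.
(* Restricted to [S k] the measure is finite, so Tonelli applies; monotone convergence over k has
   already been used. *)
pose nu := mfrestr (mS k) (S_fin k).
have nuE F : (\int[m2]_(x in S k) F x = \int[nu]_(x in S k) F x)%E.
  apply: eq_measure_integral => A mA AS.
  have E : m2 (A `&` S k) = m2 A by rewrite setIidl.
  exact: esym E.
pose H' := H \_ (setT `*` S k).
have mX : measurable (setT `*` S k : set (T1 * T2)) by exact: measurableX.
have mH' : measurable_fun setT H'.
  by apply/(measurable_restrictT _ mX); exact: measurable_funTS.
have H'0 t : (0 <= H' t)%E by rewrite /H' patchE; case: ifP.
have H'E y x : H' (y, x) = (fun x => H (y, x)) \_ (S k) x.
  rewrite /H' !patchE; case: ifPn => [/set_mem[_ h]|]; first by rewrite mem_set.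
  by rewrite notin_setE => h; rewrite memNset // => h'; exact: h.
rewrite nuE; apply: (@le_trans _ _ (\int[nu]_x \int[m1]_y H' (y, x))%E).
  rewrite [X in (X <= _)%E]integral_mkcond; apply: le_ge0_integral => x _; rewrite patchE.
    by case: ifP => // _; apply: integral_ge0.
  case: ifPn => [xS|_]; last by apply: integral_ge0.
  by apply: le_ge0_integral => // y _; rewrite H'E patchE xS.
rewrite -(@fubini_tonelli _ _ _ _ _ m1 nu H' mH' H'0).
apply: le_ge0_integral => y _; first by apply: integral_ge0.
rewrite (eq_integral _ _ (fun x _ => H'E y x)) -integral_mkcond -nuE.
rewrite [X in (X <= _)%E]integral_mkcond [X in (_ <= X)%E]integral_mkcond.
apply: le_ge0_integral => x _; rewrite !patchE; first by case: ifP.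
case: ifPn => [/set_mem[xD _]|_]; first by rewrite mem_set.
by case: ifP.
Qed.

End PartialTonelli.

Lemma derive_mull (K : numFieldType) (c : K) (f : K -> K) z : derivable f z 1 ->
  'D_1 (fun w => c * f w) z = c * 'D_1 f z.
Proof. exact: deriveZ. Qed.

(** * The operator on powers of a kernel *)

Section WeightedComposition.
Variable R : realType.
Local Notation C := (Cplx R).
Local Notation D := (@discR R).
Local Notation rad := (@Defs.rad R).
Local Notation area := (@area R).
Variable omega : R -> R.
Hypothesis cD : classD omega.
Variables (p q : R) (L : nat) (A : R).
Hypothesis p1 : 1 < p.
Hypothesis pq : p <= q.
Hypothesis A0 : 0 < A.
Hypothesis HL : forall z : C, cabs z < 1 ->
  (\int[area]_x (om omega (rad x) * cabs (bk z (toC x)) ^+ L)%:E <=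
    (A * ((1 - cabs z) * hat omega (cabs z)))%:E)%E.
Variable ups : {measure set (R * R) -> \bar R}.
Hypothesis upsD : ups (~` D) = 0%E.
Variables phi psi u0 u1 : C -> C.
Hypotheses (sphi : self_map phi) (spsi : self_map psi).
Hypotheses (au0 : analytic_on_disc u0) (au1 : analytic_on_disc u1).
Local Notation T0 := (wcomp u0 phi).
Local Notation T1 := (wdcomp u1 psi).
Local Notation T := (op_add T0 T1).
Hypothesis bT : bounded_op p q omega ups T.
Local Notation Lq := (Lqnorm q ups).
Local Notation ball := (Ap_ball omega p).
Local Notation kd := (kd omega p A).

Let p0 : 0 < p. Proof. exact: lt_trans p1. Qed.

Let q1 : 1 <= q. Proof. exact: le_trans (ltW p1) pq. Qed.

Let q0 : 0 < q. Proof. exact: lt_le_trans q1. Qed.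

Lemma disc_toC x : D x -> toC x \in @discC R.
Proof. by move=> xD; rewrite inE /discC /= cabs_toC. Qed.

Lemma self_map_disc (f : C -> C) x : self_map f -> D x -> cabs (f (toC x)) < 1.
Proof. by move=> [_ sf] /disc_toC /sf; rewrite inE. Qed.

Lemma cmeas_analytic_toC (f : C -> C) : analytic_on_disc f -> cmeas D (fun x => f (toC x)).
Proof.
move=> af; apply: (cmeas_analytic (@measurable_discR R) _ _ af).
  by case: (@cmeas_toC R) => m1 m2; split; exact: measurable_funTS.
by move=> x xD; rewrite cabs_toC.
Qed.

Lemma cmeas_wcomp (f : C -> C) : analytic_on_disc f -> cmeas D (T0 f).
Proof.
move=> af; apply: cmeasM; first exact: cmeas_analytic_toC.
apply: (cmeas_analytic (@measurable_discR R) _ _ af); first exact: (cmeas_analytic_toC sphi.1).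
by move=> x xD; exact: self_map_disc.
Qed.

Lemma op_scale (a : C) (f : C -> C) x : analytic_on_disc f -> D x ->
  T (fun z => a * f z) x = a * T f x.
Proof.
move=> af xD; rewrite /op_add /wcomp /wdcomp /cderiv.
have ad : derivable f (psi (toC x)) 1 by apply: af; rewrite inE; exact: self_map_disc.
rewrite (@derive_mull C a f _ ad); ring.
Qed.

Lemma kernel_in_Ap z n : (L <= n)%N -> cabs z < 1 -> in_Ap p omega (fun w => bk z w ^+ n).
Proof.
move=> Ln z1; apply/(in_ApE cD p0 (@kernel_analytic R z n z1)).
by apply: le_lt_trans (kernel_Jint cD p1 A0 HL (ltW p1) Ln z1) _; exact: ltry.
Qed.

(** The constant 1 is the L-th power of b_0, hence belongs to the space, and [T] maps it to u0
    because its derivative vanishes. *)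
Lemma symbol_Lq : (Eq q ups (fun x => u0 (toC x)) < +oo)%E.
Proof.
have z1 : cabs (0 : C) < 1 by rewrite cabs0.
have b0 : (fun w : C => bk 0 w ^+ L) = fun=> 1.
  apply: funext => w; rewrite /bk cabs0 subr0 (_ : conj 0 = 0 :> C); last first.
    by rewrite /conj /=; apply/eqP; rewrite eq_complex /= oppr0 !eqxx.
  by rewrite mul0r subr0 divr1 expr1n.
have := kernel_in_Ap (leqnn L) z1; rewrite b0 => fA.
have [M HM] := bT.2; have := HM _ fA.
rewrite (@Lq_eq _ _ _ upsD _ (fun x => u0 (toC x))); last first.
  move=> x _; rewrite /op_add /wcomp /wdcomp /cderiv derive_cst mulr0 addr0 mulr1 //.
move=> h; apply: (Lq_lty q1 upsD); apply: le_lt_trans h _.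
have [a aE] : exists a, Apnorm p omega (fun=> 1) = a%:E.
  case: fA => _; have : (0 <= Apnorm p omega (fun=> 1%R))%E by rewrite /Apnorm poweR_ge0.
  by case: (Apnorm _ _ _) => // a _ _; exists a.
by rewrite aE -EFinM ltry.
Qed.

(** On a kernel power divided by [kd] both [T - K] and [K] have norm at most B, so [T] has norm at
    most 2 B. [kernel_algebra] with v = u1(x) b_z'(psi(x)) combines three powers; three times 2 B
    gives the 6. *)
Lemma kernel_estimate K (B : R) : compact_op p q omega ups K -> 0 < B ->
  (forall f, ball f -> (Lq (fun x => T f x - K f x)%R <= B%:E)%E) ->
  exists r : R, 0 <= r < 1 /\ forall z, r <= cabs z -> cabs z < 1 ->
    (Lq (fun x => u0 (toC x) * bk z (phi (toC x)) ^+ L.+3)%R <=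
      (6 * (2 * L%:R + 5) ^+ 2 * B * kd z)%:E)%E.
Proof.
move=> cK B0 HB.
have Tk n : (L <= n)%N -> exists r : R, 0 <= r < 1 /\ forall z, r <= cabs z -> cabs z < 1 ->
    (Lq (T (fun w => bk z w ^+ n)%R) <= (2 * B * kd z)%:E)%E.
  move=> Ln; have [r [r01 Hr]] := compact_kernel cD p1 A0 HL q1 upsD cK Ln B0.
  exists r; split=> // z rz z1; have af := @kernel_analytic R z n z1.
  have fA := kernel_in_Ap Ln z1; have k0 := kd_gt0 cD p A0 z1.
  have ki0 : 0 <= (kd z)^-1 by rewrite invr_ge0 ltW.
  have mT := cmeasurable_disc (bT.1 _ fA).
  have mK : cmeas D (K (fun w => bk z w ^+ n)) by case: cK => _ /(_ _ fA) /cmeasurable_disc.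
  have h := HB _ (ball_scale cD af k0 (kernel_Jint cD p1 A0 HL (ltW p1) Ln z1)).
  rewrite (@Lq_eq _ _ _ upsD _ (fun x => ofR (kd z)^-1 *
    (T (fun w => bk z w ^+ n) x - K (fun w => bk z w ^+ n) x))) in h; last first.
    by move=> x xD; rewrite op_scale // (compact_scale cK _ fA) mulrBr.
  rewrite Lq_scale // in h; last exact: cmeasD mT (cmeasN mK).
  rewrite cabs_ofR ger0_norm // in h.
  have h2 : (Lq (fun x => T (fun w => bk z w ^+ n) x - K (fun w => bk z w ^+ n) x)%R <= (B * kd z)%:E)%E.
    have := lee_wpmul2l (_ : (0 <= (kd z)%:E)%E) h; rewrite lee_fin => /(_ (ltW k0)).
    by rewrite muleA -EFinM mulfV ?(gt_eqF k0) // mul1e -EFinM mulrC.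
  rewrite (@Lq_eq _ _ _ upsD _ (fun x => (T (fun w => bk z w ^+ n) x - K (fun w => bk z w ^+ n) x) +
     K (fun w => bk z w ^+ n) x)); last by move=> x _; rewrite subrK.
  apply: le_trans (Lq_triangle q1 upsD (cmeasD mT (cmeasN mK)) mK) _.
  apply: le_trans (leeD h2 (Hr z rz z1)) _.
  by rewrite -EFinD lee_fin; lra.
have [r1 [/andP[r10 r11] H1]] := Tk L.+1 (leqnSn _).
have [r2 [/andP[r20 r21] H2]] := Tk L.+2 (leqW (leqnSn _)).
have [r3 [/andP[r30 r31] H3]] := Tk L.+3 (leqW (leqW (leqnSn _))).
exists (Num.max r1 (Num.max r2 r3)); split; first by rewrite le_max r10 /= !gt_max r11 r21 r31.
move=> z; rewrite !ge_max => /and3P[zr1 zr2 zr3] z1.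
have {}H1 := H1 z zr1 z1; have {}H2 := H2 z zr2 z1; have {}H3 := H3 z zr3 z1.
(* The moduli are packed as complex functions so that the triangle inequality of L^q applies to
   their sum. *)
pose a n x := ofR (cabs (T (fun w => bk z w ^+ n) x)).
have ma n : (L <= n)%N -> cmeas D (a n).
  move=> Ln; split; first exact: measurable_cabs (cmeasurable_disc (bT.1 _ (kernel_in_Ap Ln z1))).
  exact: measurable_cst.
have aL n : (Lq (a n) <= Lq (T (fun w => bk z w ^+ n)%R))%E.
  by apply: Lq_le_mono => // x _; rewrite cabs_ofR ger0_norm ?cabs_ge0.
set c := (2 * L%:R + 5) ^+ 2; have c0 : 0 <= c by rewrite sqr_ge0.
have m1 := ma L.+1 (leqnSn _); have m2 := ma L.+2 (leqW (leqnSn _)).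
have m3 := ma L.+3 (leqW (leqW (leqnSn _))).
apply: (@le_trans _ _ (Lq (fun x => ofR c * (a L.+1 x + a L.+2 x + a L.+3 x))%R)).
  apply: Lq_le_mono => // x xD.
  have px := self_map_disc sphi xD; have sx := self_map_disc spsi xD.
  have h := @kernel_algebra R L (u0 (toC x)) (u1 (toC x) * 'D_1 (bk z) (psi (toC x)))
    (bk z (phi (toC x))) (bk z (psi (toC x))) (cabs_bk_le1 z1 (ltW px)) (cabs_bk_le1 z1 (ltW sx)).
  have TE n : T (fun w => bk z w ^+ n.+1) x = u0 (toC x) * bk z (phi (toC x)) ^+ n.+1 +
      u1 (toC x) * 'D_1 (bk z) (psi (toC x)) * (n.+1%:R * bk z (psi (toC x)) ^+ n).
    rewrite /op_add /wcomp /wdcomp /cderiv (@derive_pow C (bk z) n _ (derivable_bk z1 (ltW sx))).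
    have mulCA (b1 b2 b3 b4 : C) : b1 + b2 * (b3 * b4) = b1 + b2 * b4 * b3 by ring.
    exact: mulCA.
  apply: le_trans h _; rewrite -!TE -!ofRD -ofRM cabs_ofR ler_norm //.
rewrite Lq_scale //; last by apply: cmeasD m3; exact: cmeasD.
rewrite cabs_ofR ger0_norm //.
have h : (Lq (fun x => a L.+1 x + a L.+2 x + a L.+3 x)%R <= (6 * B * kd z)%:E)%E.
  apply: le_trans (Lq_triangle q1 upsD (cmeasD m1 m2) m3) _.
  apply: le_trans (leeD (le_trans (Lq_triangle q1 upsD m1 m2) (leeD (le_trans (aL _) H1) (le_trans (aL _) H2)))
    (le_trans (aL _) H3)) _.
  by rewrite -!EFinD lee_fin; lra.
apply: le_trans (lee_wpmul2l _ h) _; first by rewrite lee_fin.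
by rewrite -EFinM lee_fin; lra.
Qed.

End WeightedComposition.

(** * The Carleson-type estimate *)

Section CarlesonTail.
Variable R : realType.
Local Notation C := (Cplx R).
Local Notation D := (@discR R).
Local Notation rad := (@Defs.rad R).
Local Notation area := (@area R).
Variable omega : R -> R.
Hypothesis cD : classD omega.
Variables (p q : R) (A : R).
Hypothesis p1 : 1 < p.
Hypothesis pq : p <= q.
Hypothesis A0 : 0 < A.
Variable ups : {measure set (R * R) -> \bar R}.
Hypothesis upsD : ups (~` D) = 0%E.
Variables phi u0 : C -> C.
Hypothesis sphi : self_map phi.
Hypothesis au0 : analytic_on_disc u0.
Hypothesis u0L : (Eq q ups (fun x => u0 (toC x)) < +oo)%E.
Local Notation T0 := (wcomp u0 phi).
Local Notation Lq := (Lqnorm q ups).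
Local Notation ball := (Ap_ball omega p).
Local Notation kd := (kd omega p A).

Let rw : radial_weight omega := cD.1.1.

Let q0 : 0 < q. Proof. by apply: lt_le_trans pq; apply: lt_trans p1. Qed.

Let phic := cut (fun x => phi (toC x)).
Let u0c := cut (fun x => u0 (toC x)).

Let mphic : cmeas setT phic.
Proof. exact: cmeas_cut (cmeas_analytic_toC sphi.1). Qed.

Let mu0c : cmeas setT u0c.
Proof. exact: cmeas_cut (cmeas_analytic_toC au0). Qed.

Variables (K : R) (n N : nat).
Hypothesis K0 : 0 < K.
Hypothesis Nn : N%:R * q <= n.+2%:R.
Hypothesis HK : forall f w, ball f -> cabs w < 1 ->
  ((cabs (f w) `^ q)%:E <= K%:E * \int[area]_x
    (om omega (rad x) * cabs (f (toC x)) `^ p *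
      ((cabs w <= rad x)%R%:R * Ww omega (- (q / p)) (rad x)) * cabs (bk (toC x) w) ^+ n.+2)%:E)%E.
Variables (r E : R).
Hypotheses (r0 : 0 <= r) (E0 : 0 <= E).
Hypothesis HE : forall z, r <= cabs z -> cabs z < 1 ->
  (Lq (fun x => u0 (toC x) * bk z (phi (toC x)) ^+ N)%R <= (E * kd z)%:E)%E.
Variable f : C -> C.
Hypothesis fb : ball f.

(** The integrand is split by variables: [h1] depends on the point y of the area integral, [h3] on
    the point x of the integral against [ups], and [h2] on both. [phic] and [u0c] vanish off the
    disc, which makes all factors measurable on the whole plane. *)
Let h1 y := om omega (rad y) * cabs (f (toC y)) `^ p * Ww omega (- (q / p)) (rad y).

Let h2 (t : (R * R) * (R * R)) :=
  (cabs (phic t.2) <= rad t.1)%R%:R * cabs (bk (toC t.1) (phic t.2)) ^+ n.+2.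

Let h3 x := (r <= cabs (phic x))%R%:R * cabs (u0c x) `^ q.

Let h1_ge0 y : 0 <= h1 y.
Proof. by apply: mulr_ge0; [apply: mulr_ge0; [exact: om_ge0|]|]; exact: powR_ge0. Qed.

Let h2_ge0 t : 0 <= h2 t.
Proof. by apply: mulr_ge0; [exact: ler0n|exact: exprn_ge0 (cabs_ge0 _)]. Qed.

Let h3_ge0 x : 0 <= h3 x.
Proof. by apply: mulr_ge0; [exact: ler0n|exact: powR_ge0]. Qed.

Let mh1 : measurable_fun setT h1.
Proof.
apply: measurable_funM; first exact: measurable_om_pow fb.1.
exact: (measurableT_comp (measurable_Ww cD _) (@measurable_rad R)).
Qed.

Let mh2 : measurable_fun setT h2.
Proof.
have mP : cmeas setT (fun t : (R * R) * (R * R) => phic t.2).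
  by case: mphic => m1 m2; split; [exact: measurableT_comp m1 measurable_snd|exact: measurableT_comp m2 measurable_snd].
have mY : cmeas setT (fun t : (R * R) * (R * R) => toC t.1).
  case: (@cmeas_toC R) => m1 m2.
  by split; [exact: measurableT_comp m1 measurable_fst|exact: measurableT_comp m2 measurable_fst].
have mr : measurable_fun setT (fun t : (R * R) * (R * R) => rad t.1).
  exact: measurableT_comp (@measurable_rad R) measurable_fst.
apply: measurable_funM.
  rewrite (_ : (fun t => _) = fun t => (0 <= rad t.1 - cabs (phic t.2))%R%:R); last first.
    by apply: funext => t; rewrite subr_ge0.
  apply: (measurableT_comp (@measurable_step R 0)).
  by apply: measurable_funB => //; exact: measurable_cabs.
apply: measurable_funX; under eq_fun do rewrite cabsM cabsV cabs_ofR cabs_toC.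
apply: measurable_funM.
  by apply: measurableT_comp => //; exact: measurable_funB.
apply: measurable_inv_ge0; first by move=> ?; exact: cabs_ge0.
apply: measurable_cabs; apply: cmeasB; first exact: cmeas_cst.
by apply: cmeasM => //; exact: cmeas_conj.
Qed.

Let mh3 : measurable_fun setT h3.
Proof.
apply: measurable_funM.
  exact: (measurableT_comp (@measurable_step R r) (measurable_cabs mphic)).
exact: (measurableT_comp (@measurable_powR R q) (measurable_cabs mu0c)).
Qed.

Let H (t : (R * R) * (R * R)) := (K * h3 t.2 * (h1 t.1 * h2 t))%:E.

Let H_ge0 t : (0 <= H t)%E.
Proof. by rewrite lee_fin; apply: mulr_ge0; apply: mulr_ge0 => //; exact: ltW. Qed.

Let mH : measurable_fun setT H.
Proof.
apply/measurable_EFinP.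
have m3 : measurable_fun setT (fun t : (R * R) * (R * R) => h3 t.2).
  exact: measurableT_comp mh3 measurable_snd.
have m1 : measurable_fun setT (fun t : (R * R) * (R * R) => h1 t.1).
  exact: measurableT_comp mh1 measurable_fst.
have mc : measurable_fun setT (fun _ : (R * R) * (R * R) => K) by exact: measurable_cst.
exact: (measurable_funM (measurable_funM mc m3) (measurable_funM m1 mh2)).
Qed.

Let phi1 x : D x -> cabs (phi (toC x)) < 1.
Proof. exact: self_map_disc. Qed.

(** The indicators force r <= |phi(x)| <= |y|, so the kernel hypothesis is available at z = y. As N
    q <= n + 2 and kernels are at most 1, it bounds the integral by E^q kd(y)^q, whose factor
    Nw^(q/p) cancels the weight in [h1]. *)
Let inner y : (\int[ups]_(x in D) H (y, x) <=
  ((K * (E `^ q * (A / pi) `^ (q / p))) * (om omega (rad y) * cabs (f (toC y)) `^ p))%:E)%E.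
Proof.
set c := K * _; have pi0 := @pi_gt0 R.
have c0 : 0 <= c by apply: mulr_ge0 (ltW K0) _; apply: mulr_ge0; exact: powR_ge0.
have o0 : 0 <= om omega (rad y) * cabs (f (toC y)) `^ p.
  by apply: mulr_ge0; [exact: om_ge0|exact: powR_ge0].
have [yD|yD] := pselect (D y); last first.
  rewrite (om_out omega yD) mul0r mulr0 integral0_eq; first exact: lexx.
  move=> x _; by rewrite /H /h1 /= (om_out omega yD) !mul0r mulr0.
have y1 : cabs (toC y) < 1 by rewrite cabs_toC.
have [ry|ry] := ltP (rad y) r.
  rewrite integral0_eq; first by rewrite lee_fin; exact: mulr_ge0 c0 o0.
  move=> x _; rewrite /H /h2 /h3 /=; case: leP => /= h; last by rewrite !mul0r mulr0 mul0r.
  by rewrite leNgt (lt_le_trans ry h) /= !mul0r !mulr0.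
have kE := HE (_ : r <= cabs (toC y)) y1; rewrite cabs_toC in kE; have {}kE := kE ry.
have k0 : 0 < kd (toC y) by apply: kd_gt0.
have Ek : 0 <= E * kd (toC y) by apply: mulr_ge0 E0 (ltW k0).
have q1 : 1 <= q by exact: le_trans (ltW p1) pq.
move/(Lq_le q1 upsD _ Ek): kE; rewrite EqE => kE.
have mg : cmeas D (fun x => u0 (toC x) * bk (toC y) (phi (toC x)) ^+ N).
  have := @cmeas_wcomp R phi u0 sphi au0 _ (@kernel_analytic R (toC y) N y1); exact.
apply: (@le_trans _ _ (\int[ups]_(x in D) ((K * h1 y)%:E *
    (cabs (u0 (toC x) * bk (toC y) (phi (toC x)) ^+ N) `^ q)%:E))%E).
  apply: le_ge0_integral => x xD; first exact: H_ge0.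
  rewrite /H -EFinM lee_fin /= mulrACA.
  apply: ler_wpM2l; first by apply: mulr_ge0 (h1_ge0 y); exact: ltW.
  rewrite /h2 /h3 /phic /u0c !cutE //=.
  set t := cabs (bk _ _); have t0 : 0 <= t := cabs_ge0 _.
  have t1 : t <= 1 by apply: cabs_bk_le1 => //; exact: ltW (phi1 xD).
  have tn : t ^+ n.+2 <= (t ^+ N) `^ q.
    rewrite -!powR_mulrn // -powRrM.
    have [->|tn0] := eqVneq t 0; first by rewrite [X in X <= _]powR0 ?powR_ge0 // pnatr_eq0.
    by apply: ger_powR Nn; rewrite lt_neqAle eq_sym tn0 t0.
  have b1 (b : bool) : b%:R <= 1 :> R by rewrite (ler_nat R _ 1) leq_b1.
  rewrite cabsM cabsX powRM ?cabs_ge0 ?exprn_ge0 // -/t.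
  rewrite [X in X * _ <= _]mulrC -mulrA.
  apply: (ler_wpM2l (powR_ge0 _ _)).
  apply: le_trans tn; rewrite mulrA ler_piMl ?exprn_ge0 //.
  by apply: mulr_ile1 => //; rewrite ler0n.
rewrite ge0_integralZl //; first last.
- by rewrite lee_fin mulr_ge0 ?(ltW K0).
- by move=> x _; rewrite lee_fin powR_ge0.
- by apply/measurable_EFinP; exact: measurable_cabs_powR.
- exact: measurable_discR.
apply: le_trans (lee_wpmul2l _ kE) _; first by rewrite lee_fin mulr_ge0 ?(ltW K0).
rewrite -EFinM lee_fin /c -!mulrA; apply: (ler_wpM2l (ltW K0)).
rewrite powRM ?(ltW k0) // /h1 WwE ?rad_ge0 ?(ltW yD) //.
have N0 : 0 < Nw omega (rad y) by apply: Nw_gt0; rewrite ?rad_ge0.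
have -> : kd (toC y) `^ q = (A / pi) `^ (q / p) * Nw omega (rad y) `^ (q / p).
  rewrite /kd cabs_toC -powRrM [p^-1 * q]mulrC -powRM ?divr_ge0 ?(ltW A0) ?(ltW pi0) ?(ltW N0) //.
  by rewrite mulrAC.
rewrite powRN le_eqVlt; apply/orP; left; apply/eqP; field.
by rewrite gt_eqF // powR_gt0.
Qed.

(** The pointwise estimate at w = phi(x), multiplied by |u0|^q, is integrated by [tonelli_le] with
    the integrable weight |u0|^q; where u0 vanishes, so does the integrand. Then [inner] leaves the
    p-th power integral of [f], which is at most pi. *)
Lemma carleson_tail :
  (Eq q ups (fun x => if (r <= cabs (phi (toC x)))%R then T0 f x else 0)%R <=
    (K * (A / pi) `^ (q / p) * pi * E `^ q)%:E)%E.
Proof.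
have pi0 := @pi_gt0 R; rewrite EqE.
have mw : measurable_fun D (fun x => cabs (u0 (toC x)) `^ q).
  by apply: measurable_cabs_powR; exact: cmeas_analytic_toC.
have w0 x : D x -> 0 <= cabs (u0 (toC x)) `^ q by move=> _; exact: powR_ge0.
have wfin := u0L; rewrite EqE in wfin.
have tl := @tonelli_le R _ _ _ _ area ups D _ (@measurable_discR R) mw w0 wfin _ mH H_ge0.
apply: (@le_trans _ _ (\int[ups]_(x in D `&` [set x | (0 < cabs (u0 (toC x)) `^ q)%R])
    \int[area]_y H (y, x))%E).
  rewrite [X in (X <= _)%E]integral_mkcond [X in (_ <= X)%E]integral_mkcond.
  apply: le_ge0_integral => x _; rewrite !patchE.
    by case: ifP => // _; rewrite lee_fin powR_ge0.
  have G0 : (0 <= \int[area]_y H (y, x))%E by apply: integral_ge0 => y _; exact: H_ge0.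
  case: ifPn => [/set_mem xD|_]; last by case: ifP.
  case: (leP r (cabs (phi (toC x)))) => rx; last first.
    by rewrite cabs0 powR0 ?gt_eqF //; case: ifP.
  case: ifPn => [_|]; last first.
    rewrite notin_setE => nw; rewrite lee_fin /wcomp cabsM powRM ?cabs_ge0 //.
    rewrite (_ : cabs (u0 (toC x)) `^ q = 0) ?mul0r //.
    by apply/eqP; rewrite eq_le powR_ge0 andbT leNgt; apply/negP => h; apply: nw.
  have F0 y : 0 <= h1 y * h2 (y, x) by exact: mulr_ge0.
  have mF : measurable_fun setT (fun y => h1 y * h2 (y, x)).
    by apply: measurable_funM => //; exact: (measurableT_comp mh2 (@measurable_pair2 _ _ _ _ _)).
  rewrite /H /= area_intZ //; last by apply: mulr_ge0 => //; exact: ltW.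
  rewrite mulrC EFinM -muleA /wcomp cabsM powRM ?cabs_ge0 // EFinM.
  have -> : h3 x = cabs (u0 (toC x)) `^ q by rewrite /h3 /phic /u0c !cutE // rx mul1r.
  apply: lee_wpmul2l; first by rewrite lee_fin powR_ge0.
  apply: le_trans (HK fb (phi1 xD)) _; apply: lee_wpmul2l; first by rewrite lee_fin ltW.
  rewrite le_eqVlt; apply/orP; left; apply/eqP; apply: eq_integral => y _.
  by rewrite /h1 /h2 /phic /= cutE //; congr EFin; ring.
apply: le_trans tl _.
set c := K * (E `^ q * (A / pi) `^ (q / p)).
have c0 : 0 <= c by apply: mulr_ge0 (ltW K0) _; apply: mulr_ge0; exact: powR_ge0.
apply: (@le_trans _ _ (\int[area]_y (c * (om omega (rad y) * cabs (f (toC y)) `^ p))%:E)%E).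
  by apply: le_ge0_integral => y _; [apply: integral_ge0 => x _; exact: H_ge0|exact: inner].
have F0 y : 0 <= om omega (rad y) * cabs (f (toC y)) `^ p.
  by apply: mulr_ge0; [exact: om_ge0|exact: powR_ge0].
rewrite (area_intZ c0 F0 (measurable_om_pow cD p fb.1)).
apply: le_trans (lee_wpmul2l _ fb.2) _; first by rewrite lee_fin.
by rewrite -EFinM lee_fin /c le_eqVlt; apply/orP; left; apply/eqP; ring.
Qed.

End CarlesonTail.

(** * Finite rank approximation *)

Section LipschitzOnDisc.
Variable R : realType.
Local Notation C := (Cplx R).
Local Notation Re := complex.Re.
Local Notation Im := complex.Im.
Implicit Types (a b x z w : C) (f : C -> C).

Lemma circle_den a x t r : cabs a <= r -> cabs x - r <= cabs (x * cis t - a).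
Proof.
move=> ar; apply: le_trans (cabs_dist _ _).
by rewrite cabsM cabs_cis mulr1 lerB.
Qed.

Lemma cauchy_kernel_diff a b z : z - a != 0 -> z - b != 0 ->
  z / (z - a) - z / (z - b) = z * (a - b) / ((z - a) * (z - b)).
Proof. by move=> za zb; field; rewrite za zb. Qed.

Lemma cauchy_kernel_ccts a x (c d : R) : cabs a < cabs x ->
  ccts c d (fun t => x * cis t / (x * cis t - a)).
Proof.
move=> ax; set m := cabs x - cabs a; have m0 : 0 < m by rewrite subr_gt0.
have dn t : m <= cabs (x * cis t - a) by exact: circle_den.
have nz t : x * cis t - a != 0 by rewrite -cabs_gt0 (lt_le_trans m0).
apply: (@ccts_lip _ _ _ _ (cabs a * cabs x * 2 / (m * m))) => s t _ _.
rewrite (_ : _ - _ = a * (x * (cis s - cis t)) / ((x * cis t - a) * (x * cis s - a))); last first.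
  by field; rewrite !nz.
rewrite !cabsM cabsV cabsM.
rewrite [X in _ <= X](_ : _ = cabs a * (cabs x * (2 * `|s - t|)) / (m * m)); last first.
  by rewrite distrC; ring.
apply: ler_pM; rewrite ?mulr_ge0 ?invr_ge0 ?cabs_ge0 ?mulr_ge0 ?cabs_ge0 //.
  by apply: (ler_wpM2l (cabs_ge0 _)); apply: (ler_wpM2l (cabs_ge0 _)); exact: cis_lip.
rewrite lef_pV2 ?posrE ?mulr_gt0 ?(lt_le_trans m0) //.
by apply: ler_pM; rewrite ?(ltW m0).
Qed.

(** Cauchy's formula at a and at b on the same circle: the kernels differ by z (a - b) / ((z - a) (z
    - b)), and both factors of the denominator are at least |x| - r. The unimodular [c] turns real
    parts into the modulus. *)
Lemma disc_lipschitz f x a b (r M : R) : r < cabs x -> cabs a <= r -> cabs b <= r ->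
  (forall z, cabs z <= cabs x -> derivable f z 1) ->
  (forall z, cabs z <= cabs x -> cabs (f z) <= M) ->
  cabs (f a - f b) <= M * cabs x / (cabs x - r) ^+ 2 * cabs (a - b).
Proof.
move=> rx ar br df fM; set s := cabs x in rx fM *.
have ax : cabs a < cabs x := le_lt_trans ar rx.
have bx : cabs b < cabs x := le_lt_trans br rx.
have m0 : 0 < s - r by rewrite subr_gt0.
have M0 : 0 <= M by apply: le_trans (fM a (ltW ax)); exact: cabs_ge0.
have k0 : 0 <= M * s / (s - r) ^+ 2 * cabs (a - b).
  apply: mulr_ge0 (cabs_ge0 _); apply: divr_ge0; first exact: mulr_ge0 (cabs_ge0 _).
  exact: sqr_ge0.
set d := f a - f b; have [d0|d0] := eqVneq (cabs d) 0; first by rewrite d0.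
have dp : 0 < cabs d by rewrite lt_neqAle eq_sym d0 cabs_ge0.
pose c := conj d / ofR (cabs d).
have cE : cabs c = 1.
  by rewrite /c cabsM cabsV cabs_conj cabs_ofR ger0_norm ?cabs_ge0 // mulfV.
have cd : c * d = ofR (cabs d).
  rewrite /c mulrAC [conj d * d]mulrC mul_conj expr2 ofRM mulfK //.
  by rewrite -cabs_eq0 cabs_ofR normr_eq0.
have dcf z : cabs z <= cabs x -> derivable (fun z => c * f z) z 1.
  by move=> zx; exact: (@derivable_mull C c f z (df z zx)).
have Ca := cauchy_formula ax dcf; have Cb := cauchy_formula bx dcf.
have cc y : cabs y < cabs x -> ctson 0 (pi *+ 2)
    (fun t => Re (c * f (x * cis t) * (x * cis t / (x * cis t - y)))).
  by move=> yx; exact: (ctson_ReM (@circle_ccts R 0 (pi *+ 2) x _ dcf) (@cauchy_kernel_ccts y x 0 (pi *+ 2) yx)).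
have pi2 : 0 < pi *+ 2 :> R by exact: pi2_gt0.
have E : RI 0 (pi *+ 2) (fun t => Re (c * f (x * cis t) * (x * cis t / (x * cis t - a))) -
    Re (c * f (x * cis t) * (x * cis t / (x * cis t - b)))) = pi *+ 2 * cabs d.
  rewrite RIB; [|exact: cc|exact: cc]; rewrite Ca Cb -mulrBr -ReN -ReD -mulrN -mulrDr cd //.
have := RI_norm_le (ltW pi2) (ctsonB (cc _ ax) (cc _ bx)) (k := M * s / (s - r) ^+ 2 * cabs (a - b)).
rewrite E subr0 ger0_norm ?mulr_ge0 ?(ltW pi2) ?cabs_ge0 // => H.
rewrite -(ler_pM2l pi2) [X in _ <= X]mulrC; apply: H => t _.
rewrite -ReN -ReD; apply: le_trans (Re_le_cabs _) _.
have da := circle_den x t ar; have db := circle_den x t br.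
have da0 := lt_le_trans m0 da; have db0 := lt_le_trans m0 db.
have zE : cabs (x * cis t) = s by rewrite cabsM cabs_cis mulr1.
move: da db da0 db0 zE; set z := x * cis t => da db da0 db0 zE.
rewrite -mulrBr cauchy_kernel_diff -?cabs_gt0 // cabsM [cabs (c * _)]cabsM cE mul1r.
rewrite [cabs (_ / _)]cabsM cabsV [cabs (z * _)]cabsM zE [cabs ((z - a) * _)]cabsM.
have fx : cabs (f z) <= M by apply: fM; rewrite zE.
rewrite [X in _ <= X](_ : _ = M * (s * cabs (a - b)) / (s - r) ^+ 2); last by ring.
rewrite mulrA; apply: ler_pM; rewrite ?invr_ge0 ?mulr_ge0 ?cabs_ge0 //.
  by apply: ler_wpM2r => //; rewrite mulr_ge0 ?cabs_ge0.
rewrite lef_pV2 ?posrE ?exprn_gt0 ?mulr_gt0 // expr2.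
by apply: ler_pM; rewrite ?(ltW m0).
Qed.

End LipschitzOnDisc.

(** * Finite grids and convergent subsequences *)

Section Grid.
Variable R : realType.
Local Notation C := (Cplx R).
Local Notation Re := complex.Re.
Local Notation Im := complex.Im.

Lemma rnd_finite m : exists s : seq R, forall r : R, `|r| <= 1 -> rnd m r \in s.
Proof.
pose v (i : nat) : R := (i%:R - m.+1%:R) / m.+1%:R.
exists [seq v i | i <- iota 0 (m.+1 + m.+1).+1] => r; rewrite ler_norml => /andP[r1 r2].
have N0 : 0 < m.+1%:R :> R by rewrite ltr0n.
set k := Num.floor (r * m.+1%:R).
have k1 : (- m.+1%:Z <= k)%R.
  rewrite /k floor_ge_int rmorphN /= -mulN1r; exact: (ler_wpM2r (ltW N0)).
have k2 : (k <= m.+1%:Z)%R.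
  by rewrite -(ler_int R); apply: le_trans (floor_le _) _; rewrite ler_piMl // ltW.
have kp : (0 <= k + m.+1%:Z)%R by rewrite -lerBlDr sub0r.
have aE := gez0_abs kp; move: aE; set i := absz _ => aE.
apply/mapP; exists i.
  by rewrite mem_iota add0n ltnS /= -lez_nat aE PoszD lerD2r.
rewrite /rnd /v -/k; congr (_ / _).
have -> : i%:R = (k + m.+1%:Z)%:~R :> R by rewrite -aE.
by rewrite rmorphD /= addrK.
Qed.

Lemma grd_finite m : exists s : seq C, forall z : C, cabs z <= 1 -> grd m z \in s.
Proof.
have [s Hs] := rnd_finite m.
exists [seq (a +i* b)%C | a <- s, b <- s] => z z1.
apply: allpairs_f; apply: Hs.
  exact: le_trans (Re_le_cabs _) z1.
exact: le_trans (Im_le_cabs _) z1.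
Qed.

Lemma strict_ge_id (s : nat -> nat) : (forall n, s n < s n.+1)%N -> forall n, (n <= s n)%N.
Proof. by move=> sS; elim=> // n IH; exact: leq_ltn_trans IH (sS n). Qed.

Lemma real_subsequence (u : nat -> R) (M : R) : (forall n, `|u n| <= M) ->
  exists s : nat -> nat, (forall n, (s n < s n.+1)%N) /\ exists l : R,
    forall e : R, 0 < e -> exists N, forall n, (N <= n)%N -> `|u (s n) - l| <= e.
Proof.
move=> uM; have bu : bounded_fun u.
  exists M; split; first exact: num_real.
  by move=> y My n _; exact: le_trans (uM n) (ltW My).
have [s sI /cvg_ex[l cl]] := bolzano_weierstrass bu.
exists s; split; first by move=> n; have h : (s n.+1 <= s n)%N = (n.+1 <= n)%N := sI n.+1 n; rewrite ltnNge h ltnn.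
exists l => e e0; have /cvgrPdist_le/(_ e e0)[N _ HN] := cl.
by exists N => n Nn; rewrite distrC; exact: HN.
Qed.

Lemma complex_subsequence (u : nat -> C) (M : R) : (forall n, cabs (u n) <= M) ->
  exists s : nat -> nat, (forall n, (s n < s n.+1)%N) /\ exists l : C,
    forall e : R, 0 < e -> exists N, forall n, (N <= n)%N -> cabs (u (s n) - l) <= e.
Proof.
move=> uM.
have [s [sS [a Ha]]] := @real_subsequence (fun n => Re (u n)) M (fun n => le_trans (Re_le_cabs _) (uM n)).
have [t [tS [b Hb]]] := @real_subsequence (fun n => Im (u (s n))) M (fun n => le_trans (Im_le_cabs _) (uM _)).
have sI : {homo s : i j / (i < j)%N} by apply: homo_ltn => //; exact: ltn_trans.
exists (s \o t); split; first by move=> n; exact: sI.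
exists (a +i* b)%C => e e0; have e2 : 0 < e / 2 by rewrite divr_gt0.
have [N1 H1] := Ha _ e2; have [N2 H2] := Hb _ e2.
exists (maxn N1 N2) => n; rewrite geq_max => /andP[n1 n2].
apply: le_trans (cabs_leD _) _; rewrite ReD ImD ReN ImN /=.
by rewrite [leRHS]splitr lerD // ?H2 // H1 // (leq_trans n1) // strict_ge_id.
Qed.

Lemma list_subsequence (s : seq C) (F : nat -> C -> C) (M : R) :
  (forall n w, w \in s -> cabs (F n w) <= M) ->
  exists t : nat -> nat, (forall n, (t n < t n.+1)%N) /\ exists g : C -> C,
    forall e : R, 0 < e -> exists N, forall n w, (N <= n)%N -> w \in s -> cabs (F (t n) w - g w) <= e.
Proof.
elim: s => [|w s IH] FM.
  by exists id; split=> //; exists id => e _; exists 0%N.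
have [t [tS [g Hg]]] := IH (fun n v vs => FM n v (mem_behead (vs : v \in behead (w :: s)))).
have [t' [t'S [l Hl]]] := @complex_subsequence (fun n => F (t n) w) M (fun n => FM _ _ (mem_head _ _)).
have tI : {homo t : i j / (i < j)%N} by apply: homo_ltn => //; exact: ltn_trans.
exists (t \o t'); split; first by move=> n; exact: tI.
exists (fun v => if v == w then l else g v) => e e0.
have [N1 H1] := Hg _ e0; have [N2 H2] := Hl _ e0.
exists (maxn N1 N2) => n v; rewrite geq_max => /andP[n1 n2]; rewrite inE.
case: eqVneq => [-> _|_ /= vs]; first exact: H2.
by apply: H1 => //; apply: leq_trans n1 _; exact: strict_ge_id.
Qed.

End Grid.

(** * Compact approximation of the weighted composition operator *)

Section FiniteRankApproximation.
Variable R : realType.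
Local Notation C := (Cplx R).
Local Notation D := (@discR R).
Variable omega : R -> R.
Hypothesis cD : classD omega.
Variables (p q : R).
Hypothesis p1 : 1 < p.
Hypothesis q1 : 1 <= q.
Variable ups : {measure set (R * R) -> \bar R}.
Hypothesis upsD : ups (~` D) = 0%E.
Variables phi u0 : C -> C.
Hypothesis sphi : self_map phi.
Hypothesis au0 : analytic_on_disc u0.
Hypothesis u0L : (Eq q ups (fun x => u0 (toC x)) < +oo)%E.
Local Notation T0 := (wcomp u0 phi).
Local Notation Lq := (Lqnorm q ups).
Local Notation ball := (Ap_ball omega p).
Implicit Types (f : C -> C) (w a b : C) (x : R * R).

Let p0 : 0 < p. Proof. exact: lt_trans p1. Qed.

Lemma ball_bound (r : R) : 0 <= r -> r < 1 ->
  exists M : R, 0 <= M /\ forall f w, ball f -> cabs w <= r -> cabs (f w) <= M.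
Proof.
move=> r0 r1; have [K [K0 HK]] := point_eval cD (ltW p1).
have N0 : 0 < Nw omega r by apply: Nw_gt0; rewrite ?r0.
exists ((K / Nw omega r) `^ p^-1); split=> [|f w fb wr]; first exact: powR_ge0.
have w1 := le_lt_trans wr r1; have h := HK f w fb w1.
have fp : cabs (f w) `^ p <= K / Nw omega r.
  rewrite ler_pdivlMr //; apply: le_trans h; apply: (ler_wpM2l (powR_ge0 _ _)).
  exact: Nw_le (cabs_ge0 _) wr r1.
have -> : cabs (f w) = (cabs (f w) `^ p) `^ p^-1.
  by rewrite -powRrM mulfV ?gt_eqF // powRr1 // cabs_ge0.
have i0 : 0 <= p^-1 by rewrite invr_ge0 ltW.
have K1 : 0 <= K / Nw omega r by exact: divr_ge0 (ltW K0) (ltW N0).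
by rewrite ge0_ler_powR // nnegrE ?powR_ge0.
Qed.

Lemma ball_lipschitz (r : R) : 0 <= r -> r < 1 ->
  exists M : R, 0 <= M /\ forall f a b, ball f -> cabs a <= r -> cabs b <= r ->
    cabs (f a - f b) <= M * cabs (a - b).
Proof.
move=> r0 r1; set s := (1 + r) / 2.
have [rs s1] : r < s /\ s < 1 by rewrite /s; split; lra.
have s0 : 0 <= s by lra.
have [M [M0 HM]] := ball_bound s0 s1.
exists (M * s / (s - r) ^+ 2); split=> [|f a b fb ar br].
  by apply: divr_ge0 (sqr_ge0 _); exact: mulr_ge0.
have xE : cabs (ofR s) = s by rewrite cabs_ofR ger0_norm.
have := @disc_lipschitz R f (ofR s) a b r M; rewrite xE; apply=> // z zs.
  by apply: fb.1; rewrite inE; exact: le_lt_trans s1.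
exact: HM.
Qed.

(** [f] enters through its values at the grid points only, finitely many on the disc. The
    restriction to |phi| < r is a numerical factor, which keeps linearity in [f] visible, and [cut]
    gives measurability on the whole plane. *)
Definition grid_op (r : R) m : operator R := fun f =>
  cut (fun x => ofR (cabs (phi (toC x)) < r)%R%:R * u0 (toC x) * f (grd m (phi (toC x)))).

Lemma grid_opE r m f x : D x ->
  grid_op r m f x = if cabs (phi (toC x)) < r then u0 (toC x) * f (grd m (phi (toC x))) else 0.
Proof.
by move=> xD; rewrite /grid_op cutE //; case: ltP => _; rewrite ofR_nat ?mul1r ?mul0r.
Qed.

Let mphi : cmeas D (fun x => phi (toC x)).
Proof. exact: cmeas_analytic_toC sphi.1. Qed.

Lemma cmeas_ofR (g : R * R -> R) : measurable_fun D g -> cmeas D (fun x => ofR (g x) : C).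
Proof. by move=> mg; split=> //; exact: measurable_cst. Qed.

Lemma grid_op_measurable r m f : cmeasurable (grid_op r m f).
Proof.
apply: cmeas_cut; apply: cmeasM.
  apply: cmeasM (cmeas_analytic_toC au0); apply: cmeas_ofR.
  rewrite (_ : (fun x => _) = fun x => 1 - (r <= cabs (phi (toC x)))%R%:R); last first.
    by apply: funext => x; case: ltP => _; rewrite ?subrr ?subr0.
  apply: measurable_funB => //.
  exact: (measurableT_comp (@measurable_step R r) (measurable_cabs mphi)).
split; first exact: (@measurable_grd R _ _ D m (fun z => complex.Re (f z)) _ (@measurable_discR R) mphi).
exact: (@measurable_grd R _ _ D m (fun z => complex.Im (f z)) _ (@measurable_discR R) mphi).
Qed.

Lemma symbol_norm : exists2 l : R, 0 <= l & Lq (fun x => u0 (toC x)) = l%:E.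
Proof. by apply: ge0_lty_EFin; [exact: Lq_ge0|exact: Eq_lty]. Qed.

(** The condition on [s] keeps the rounded points in |w| <= s, where the unit ball is uniformly
    bounded. A subsequence converges at the finitely many grid points, hence uniformly on them; the
    limit [g] is a mere function, since only its grid values matter. *)
Lemma grid_op_compact (r s : R) m : 0 <= s -> s < 1 -> r + 2 / m.+1%:R <= s ->
  compact_op p q omega ups (grid_op r m).
Proof.
move=> s0 s1 rs; split=> [f g a b _ _|f _|F HF]; last 1 first.
- have [M [M0 HM]] := ball_bound s0 s1; have [l l0 lE] := symbol_norm.
  have [grid Hgrid] := @grd_finite R m.
  have Fb n : ball (F n) by apply/(Ap_ballE cD (F n) p0); exact: HF.
  have [|t [tS [g Hg]]] := @list_subsequence R [seq w <- grid | cabs w <= s] F M.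
    by move=> n w; rewrite mem_filter => /andP[ws _]; exact: HM.
  exists t; split=> //; exists (grid_op r m g).
  have mu0 := cmeas_analytic_toC au0.
  have in_grid x : D x -> cabs (phi (toC x)) < r ->
      grd m (phi (toC x)) \in [seq w <- grid | cabs w <= s].
    move=> xD xr; rewrite mem_filter Hgrid ?(ltW (self_map_disc sphi xD)) // andbT.
    rewrite -[grd _ _](subrK (phi (toC x))); apply: le_trans (cabsD _ _) _.
    by apply: le_trans rs; rewrite addrC; apply: lerD (ltW xr) (grd_dist _ _).
  split; first exact: grid_op_measurable.
    have [N HN] := Hg 1 ltr01.
    apply: (@le_lt_trans _ _ (Lq (fun x => ofR (M + 1) * u0 (toC x)))); last first.
      by rewrite Lq_scale // lE -EFinM ltry.
    apply: Lq_le_mono => // x xD; rewrite grid_opE // cabsM cabs_ofR ger0_norm ?addr_ge0 //.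
    case: ltP => xr; last by rewrite cabs0 mulr_ge0 ?addr_ge0 ?cabs_ge0.
    rewrite cabsM mulrC; apply: (ler_wpM2r (cabs_ge0 _)).
    have h := HN N _ (leqnn N) (in_grid x xD xr).
    rewrite -[g _](subKr (F (t N) (grd m (phi (toC x))))).
    apply: le_trans (cabsB _ _) _; apply: lerD h; apply: HM => //.
    by have := in_grid x xD xr; rewrite mem_filter => /andP[].
  apply/ge0_cvge0P => [n|e e0]; first exact: Lq_ge0.
  have el : 0 < e / (l + 1) by rewrite divr_gt0 // ltr_wpDl.
  have [N HN] := Hg _ el; exists N => n Nn.
  apply: (@le_trans _ _ (Lq (fun x => ofR (e / (l + 1)) * u0 (toC x)))).
    apply: Lq_le_mono => // x xD; rewrite !grid_opE // cabsM cabs_ofR ger0_norm ?(ltW el) //.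
    case: ltP => xr; last by rewrite subr0 cabs0 mulr_ge0 ?(ltW el) ?cabs_ge0.
    rewrite -mulrBr cabsM mulrC; apply: (ler_wpM2r (cabs_ge0 _)).
    by apply: HN => //; exact: in_grid.
  rewrite Lq_scale // lE -EFinM lee_fin cabs_ofR ger0_norm ?(ltW el) //.
  by rewrite mulrAC ler_pdivrMr ?ltr_wpDl // ler_wpM2l ?(ltW e0) // lerDl.
- by apply: funext => x; rewrite /grid_op /cut; case: ifP => _; ring.
- exact: grid_op_measurable.
Qed.

Lemma grid_op_approx (r e : R) : 0 <= r -> r < 1 -> 0 < e ->
  exists m, compact_op p q omega ups (grid_op r m) /\
    forall f x, ball f -> D x -> cabs (phi (toC x)) < r ->
      cabs (T0 f x - grid_op r m f x) <= e * cabs (u0 (toC x)).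
Proof.
move=> r0 r1 e0; set s := (1 + r) / 2.
have [s0 s1] : 0 <= s /\ s < 1 by rewrite /s; split; lra.
have [M [M0 HM]] := ball_lipschitz s0 s1.
(* The first bound keeps the rounded points within radius [s]; the second makes the Lipschitz error
   at most [e]. *)
set d := Num.min ((1 - r) / 2) (e / (M + 1)).
have M1 : 0 < M + 1 by exact: ltr_wpDl.
have d0 : 0 < d by rewrite /d lt_min !divr_gt0 // subr_gt0.
pose m := Num.Def.trunc (2 / d).
have md : 2 / m.+1%:R <= d.
  by rewrite ler_pdivrMr ?ltr0n // mulrC -ler_pdivrMr //; exact: ltW (truncnS_gt _).
have d1 : d <= (1 - r) / 2 by rewrite /d ge_min lexx.
have d2 : d <= e / (M + 1) by rewrite /d ge_min lexx orbT.
have rs : r + 2 / m.+1%:R <= s.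
  by apply: le_trans (lerD (lexx r) (le_trans md d1)) _; rewrite /s; lra.
exists m; split; first exact: grid_op_compact s0 s1 rs.
move=> f x fb xD xr; rewrite grid_opE // xr /wcomp -mulrBr cabsM mulrC.
apply: (ler_wpM2r (cabs_ge0 _)).
have gd := grd_dist m (phi (toC x)).
have gs : cabs (grd m (phi (toC x))) <= s.
  rewrite -[grd _ _](subrK (phi (toC x))); apply: le_trans (cabsD _ _) _.
  by apply: le_trans rs; rewrite addrC; apply: lerD (ltW xr) gd.
apply: le_trans (HM f _ _ fb _ gs) _.
  by apply: le_trans (ltW xr) _; rewrite /s; lra.
rewrite cabs_distC; apply: le_trans (ler_wpM2l M0 (le_trans gd (le_trans md d2))) _.
by rewrite mulrA ler_pdivrMr // mulrC ler_wpM2l ?(ltW e0) // lerDl.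
Qed.

(** The approximating operator vanishes on |phi| >= r, so the error there is the assumed tail bound;
    on |phi| < r it is at most B / (l + 1) times |u0|, where [l] is the norm of u0. *)
Lemma wcomp_approx (r B E : R) : 0 <= r -> r < 1 -> 0 < B -> 0 <= E ->
  (forall f, ball f -> (Eq q ups (fun x => if (r <= cabs (phi (toC x)))%R then T0 f x else 0)%R <=
     (E `^ q)%:E)%E) ->
  exists2 K, compact_op p q omega ups K &
    forall f, ball f -> (Lq (fun x => T0 f x - K f x)%R <= (E + B)%:E)%E.
Proof.
move=> r0 r1 B0 E0 H; have [l l0 lE] := symbol_norm.
have l1 : 0 < l + 1 by exact: ltr_wpDl.
have [m [cK HK]] := grid_op_approx r0 r1 (divr_gt0 B0 l1).
exists (grid_op r m) => // f fb.
pose g x := ofR (r <= cabs (phi (toC x)))%R%:R * T0 f x.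
have gE x : g x = if r <= cabs (phi (toC x)) then T0 f x else 0.
  by rewrite /g; case: ifP => _; rewrite ofR_nat ?mul1r ?mul0r.
have mT : cmeas D (T0 f) := cmeas_wcomp sphi au0 fb.1.
have mg : cmeas D g.
  apply: cmeasM mT; apply: cmeas_ofR.
  exact: (measurableT_comp (@measurable_step R r) (measurable_cabs mphi)).
have mK : cmeas D (grid_op r m f) by apply: cmeasurable_disc; exact: grid_op_measurable.
rewrite (@Lq_eq _ _ _ upsD _ (fun x => g x + (T0 f x - grid_op r m f x - g x))); last first.
  by move=> x _; rewrite [RHS]addrC subrK.
apply: le_trans (Lq_triangle q1 upsD mg (cmeasD (cmeasD mT (cmeasN mK)) (cmeasN mg))) _.
rewrite EFinD; apply: leeD.
  apply/(Lq_le q1 upsD _ E0); rewrite (_ : g = fun x => if r <= cabs (phi (toC x)) then T0 f x else 0).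
    exact: H.
  by apply: funext => x; exact: gE.
apply: (@le_trans _ _ (Lq (fun x => ofR (B / (l + 1)) * u0 (toC x)))).
  have Bl : 0 <= B / (l + 1) by exact: divr_ge0 (ltW B0) (ltW l1).
  apply: Lq_le_mono => // x xD; rewrite cabsM cabs_ofR ger0_norm // gE.
  case: (leP r (cabs (phi (toC x)))) => xr; last by rewrite subr0; exact: HK.
  by rewrite grid_opE // ltNge xr /= subr0 subrr cabs0 mulr_ge0 ?cabs_ge0.
rewrite Lq_scale // ?lE -?EFinM ?lee_fin ?cabs_ofR ?ger0_norm ?divr_ge0 ?(ltW l1) ?(ltW B0) //.
  by rewrite mulrAC ler_pdivrMr // ler_wpM2l ?(ltW B0) // lerDl.
exact: cmeas_analytic_toC.
Qed.

End FiniteRankApproximation.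

(** * Essential norms *)

Section EssentialNorm.
Variable R : realType.
Local Notation C := (Cplx R).
Local Notation D := (@discR R).
Variable omega : R -> R.
Hypothesis cD : classD omega.
Variables (p q : R).
Hypothesis p1 : 1 < p.
Hypothesis q1 : 1 <= q.
Variable ups : {measure set (R * R) -> \bar R}.
Hypothesis upsD : ups (~` D) = 0%E.
Local Notation Lq := (Lqnorm q ups).
Local Notation ball := (Ap_ball omega p).
Local Notation opnorm := (opnorm_diff p q omega ups).
Local Notation ess := (ess_norm p q omega ups).
Implicit Types (T K : operator R).

Let p0 : 0 < p. Proof. exact: lt_trans p1. Qed.

Lemma opnorm_leP T K (y : \bar R) :
  (opnorm T K <= y)%E <-> forall f, ball f -> (Lq (fun x => T f x - K f x)%R <= y)%E.
Proof.
split=> [h f fb|h].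
  apply: le_trans h; apply: ereal_sup_ubound; exists f => //.
  exact/(Ap_ballE cD f p0).
by apply: ge_ereal_sup => _ [f /(Ap_ballE cD f p0) fb <-]; exact: h.
Qed.

(** The ball contains the zero function, so the supremum is not over an empty set, which would give
    -oo. Zero is written [0 * 1] to fit [Jint_scale]. *)
Lemma opnorm_ge0 T K : (0 <= opnorm T K)%E.
Proof.
have a1 := @analytic_cst R 1.
have fb : ball (fun z => 0 * 1).
  split; first exact: analytic_cst.
  rewrite (@Jint_scale R omega cD p 0 (fun=> 1) a1) cabs0 powR0 ?gt_eqF // mul0e.
  by rewrite lee_fin pi_ge0.
have /opnorm_leP/(_ _ fb) h := lexx (opnorm T K).
exact: le_trans (Lq_ge0 _ upsD _) h.
Qed.

Lemma ess_ge0 T : (0 <= ess T)%E.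
Proof. by apply: le_ereal_inf_tmp => _ [K _ <-]; exact: opnorm_ge0. Qed.

Lemma ess_le T K (y : \bar R) : compact_op p q omega ups K ->
  (forall f, ball f -> (Lq (fun x => T f x - K f x)%R <= y)%E) -> (ess T <= y)%E.
Proof.
move=> cK /opnorm_leP h; apply: le_trans h; apply: ereal_inf_lbound.
by exists K.
Qed.

(** Serves with c = 1 for the triangle inequality of essential norms and with c = -1 for the second
    summand of [T]. *)
Lemma compact_addZ (c : C) K K' : compact_op p q omega ups K -> compact_op p q omega ups K' ->
  compact_op p q omega ups (fun f x => K f x + c * K' f x).
Proof.
move=> [lK mK sK] [lK' mK' sK']; split=> [f g a b fA gA|f fA|F HF].
- by rewrite lK // lK' //; apply: funext => x; ring.
- exact: cmeasD (mK _ fA) (cmeasM (cmeas_cst _ _) (mK' _ fA)).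
have [s [sS [g [mg gL cg]]]] := sK _ HF.
have [t [tS [h [mh hL ch]]]] := sK' (F \o s) (fun n => HF (s n)).
have sI : {homo s : i j / (i < j)%N} by apply: homo_ltn => //; exact: ltn_trans.
exists (s \o t); split; first by move=> n; exact: sI.
have mgD := cmeasurable_disc mg; have mhD := cmeasurable_disc mh.
have mZ (k : R * R -> C) : cmeas D k -> cmeas D (fun x => c * k x).
  by move=> mk; exact: cmeasM (cmeas_cst _ _) mk.
exists (fun x => g x + c * h x); split.
- exact: cmeasD mg (cmeasM (cmeas_cst _ _) mh).
- apply: le_lt_trans (Lq_triangle q1 upsD mgD (mZ _ mhD)) _; rewrite Lq_scale //.
  have [a _ ->] := ge0_lty_EFin (Lq_ge0 q upsD g) gL.
  have [b _ ->] := ge0_lty_EFin (Lq_ge0 q upsD h) hL.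
  exact: ltry.
apply/ge0_cvge0P => [n|e e0]; first exact: Lq_ge0.
have c1 : 0 < cabs c + 1 by rewrite ltr_wpDl ?cabs_ge0.
have e1 : 0 < e / 2 by rewrite divr_gt0.
have e2 : 0 < e / 2 / (cabs c + 1) by rewrite divr_gt0.
move/ge0_cvge0P: cg => /(_ (fun n => Lq_ge0 q upsD _) _ e1)[N1 H1].
move/ge0_cvge0P: ch => /(_ (fun n => Lq_ge0 q upsD _) _ e2)[N2 H2].
exists (maxn N1 N2) => n; rewrite geq_max => /andP[n1 n2] /=.
rewrite (@Lq_eq _ _ _ upsD _ (fun x => (K (F (s (t n))) x - g x) + c * (K' (F (s (t n))) x - h x))); last first.
  by move=> x _; ring.
have mKf := cmeasurable_disc (mK _ (HF (s (t n))).1).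
have mKf' := cmeasurable_disc (mK' _ (HF (s (t n))).1).
have m2 := cmeasD mKf' (cmeasN mhD).
apply: le_trans (Lq_triangle q1 upsD (cmeasD mKf (cmeasN mgD)) (mZ _ m2)) _.
rewrite Lq_scale // (_ : e = e / 2 + e / 2); last by rewrite -splitr.
rewrite EFinD; apply: leeD.
  by apply: H1; apply: leq_trans n1 _; exact: strict_ge_id.
apply: le_trans (lee_wpmul2l _ (H2 n n2)) _; first by rewrite lee_fin cabs_ge0.
by rewrite -EFinM lee_fin mulrCA ler_piMr ?(ltW e1) // ler_pdivrMr // mul1r lerDl.
Qed.

Lemma ess_add T S : (forall f, ball f -> cmeas D (T f)) -> (forall f, ball f -> cmeas D (S f)) ->
  (ess (op_add T S) <= ess T + ess S)%E.
Proof.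
move=> mT mS.
have [eT|eT] := eqVneq (ess T) +oo%E; first by rewrite eT addye ?leey // gt_eqF // (lt_le_trans _ (ess_ge0 S)) ?ltNyr.
have [eS|eS] := eqVneq (ess S) +oo%E; first by rewrite eS addey ?leey // gt_eqF // (lt_le_trans _ (ess_ge0 T)) ?ltNyr.
have fin U : ess U != +oo%E -> ess U \is a fin_num.
  by move=> h; rewrite ge0_fin_numE ?ess_ge0 // ltey.
apply/lee_addgt0Pr => e e0; have e2 : 0 < e / 2 by rewrite divr_gt0.
have [_ [K cK <-] /ltW HK] := lb_ereal_inf_adherent e2 (fin _ eT).
have [_ [K' cK' <-] /ltW HK'] := lb_ereal_inf_adherent e2 (fin _ eS).
apply: (ess_le (compact_addZ 1 cK cK')) => f fb.
have fA := ball_in_Ap cD p1 fb.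
have mK : cmeas D (K f) by case: cK => _ /(_ _ fA) /cmeasurable_disc.
have mK' : cmeas D (K' f) by case: cK' => _ /(_ _ fA) /cmeasurable_disc.
rewrite (@Lq_eq _ _ _ upsD _ (fun x => (T f x - K f x) + (S f x - K' f x))); last first.
  by move=> x _; rewrite /op_add; ring.
apply: le_trans (Lq_triangle q1 upsD (cmeasD (mT _ fb) (cmeasN mK)) (cmeasD (mS _ fb) (cmeasN mK'))) _.
have /opnorm_leP/(_ _ fb) h := HK; have /opnorm_leP/(_ _ fb) h' := HK'.
apply: le_trans (leeD h h') _.
by rewrite addeACA -EFinD -splitr.
Qed.

End EssentialNorm.

Theorem theorem3p1 (R : realType) (p q : R) (omega : R -> R) :
  1 < p -> p <= q -> classD omega ->
  exists c : R, 0 < c /\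
  forall (ups : {measure set (R * R) -> \bar R})
         (phi psi u0 u1 : Cplx R -> Cplx R),
    ups (~` @discR R) = 0%E ->
    self_map phi -> self_map psi ->
    analytic_on_disc u0 -> analytic_on_disc u1 ->
    bounded_op p q omega ups (op_add (wcomp u0 phi) (wdcomp u1 psi)) ->
    (c%:E * (ess_norm p q omega ups (wcomp u0 phi)
             + ess_norm p q omega ups (wdcomp u1 psi))
       <= ess_norm p q omega ups (op_add (wcomp u0 phi) (wdcomp u1 psi)))%E /\
    (ess_norm p q omega ups (op_add (wcomp u0 phi) (wdcomp u1 psi))
       <= c^-1%:E * (ess_norm p q omega ups (wcomp u0 phi)
                     + ess_norm p q omega ups (wdcomp u1 psi)))%E.
Proof.
move=> p1 pq cD; have p0 : 0 < p := lt_trans ltr01 p1.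
have q1 : 1 <= q := le_trans (ltW p1) pq.
have q0 : 0 < q := lt_le_trans ltr01 q1.
have [L [A [A0 HL]]] := kernel_integral_le cD.1.1 cD.1.2.
(* Large enough that t^(n+2) <= t^((L+3) q) for kernel values t <= 1; L + 3 is the power in the
   kernel estimate. *)
pose n := Num.Def.trunc (L.+3%:R * q).
have Nn : L.+3%:R * q <= n.+2%:R.
  by apply: le_trans (ltW (truncnS_gt _)) _; rewrite ler_nat.
have [K [K0 HK]] := carleson_pointwise cD n p1 pq.
pose X := (K * (A / pi) `^ (q / p) * pi) `^ q^-1.
pose c1 := 6 * (2 * L%:R + 5) ^+ 2 : R.
have X0 : 0 <= X by exact: powR_ge0.
have Xq : X `^ q = K * (A / pi) `^ (q / p) * pi.
  rewrite /X -powRrM mulVf ?gt_eqF // powRr1 //.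
  by rewrite mulr_ge0 ?pi_ge0 // mulr_ge0 ?powR_ge0 // ltW.
have c10 : 0 <= c1 by rewrite mulr_ge0 ?sqr_ge0.
(* In units of [B]: the Carleson estimate on |phi| >= r costs [X * c1], the approximation on |phi| <
   r costs 1. *)
pose k := X * c1 + 1; have k0 : 0 <= k by rewrite addr_ge0 ?mulr_ge0.
(* The first summand of [T] costs k, the second 1 + k; as 1 + 2 k >= 1, the same constant serves the
   triangle inequality. *)
have c0 : 0 < 1 + 2 * k by rewrite ltr_pwDl // mulr_ge0.
exists (1 + 2 * k)^-1; split=> [|ups phi psi u0 u1 upsD sphi spsi au0 au1 bT]; first by rewrite invr_gt0.
set T0 := wcomp u0 phi; set T1 := wdcomp u1 psi; set T := op_add T0 T1.
have u0L := symbol_Lq cD p1 pq A0 HL upsD bT.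
have mT0 f : Ap_ball omega p f -> cmeas (@discR R) (T0 f) by move=> fb; exact: (cmeas_wcomp sphi au0 fb.1).
have mT f : Ap_ball omega p f -> cmeas (@discR R) (T f).
  by move=> fb; exact: (cmeasurable_disc (bT.1 _ (ball_in_Ap cD p1 fb))).
have mT1 f : Ap_ball omega p f -> cmeas (@discR R) (T1 f).
  move=> fb; rewrite (_ : T1 f = fun x => T f x - T0 f x); first exact: (cmeasD (mT _ fb) (cmeasN (mT0 _ fb))).
  by apply: funext => x; rewrite /T /op_add addrC addKr.
have e00 := ess_ge0 cD q p1 upsD T0; have e10 := ess_ge0 cD q p1 upsD T1.
split; last first.
  apply: le_trans (ess_add cD p1 q1 upsD mT0 mT1) _.
  rewrite invrK -[X in (X <= _)%E]mul1e; apply: lee_wpmul2r; first exact: adde_ge0.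
  by rewrite lee_fin lerDl mulr_ge0.
apply: le_ereal_inf_tmp => _ [Kc cK <-].
have o0 := opnorm_ge0 cD q p1 upsD T Kc.
have [->|oo] := eqVneq (opnorm_diff p q omega ups T Kc) +oo%E; first exact: leey.
have [b b0 bE] : exists2 b : R, 0 <= b & opnorm_diff p q omega ups T Kc = b%:E.
  by apply: ge0_lty_EFin => //; rewrite ltey.
rewrite bE; apply/lee_addgt0Pr => d d0; rewrite -EFinD.
(* The margin [d] keeps the bound positive even when b = 0, as the kernel estimate requires. *)
have B0 : 0 < b + d by exact: ltr_wpDl.
set B := b + d in B0 *.
have HB f : Ap_ball omega p f -> (Lqnorm q ups (fun x => T f x - Kc f x)%R <= B%:E)%E.
  move=> fb; have : (opnorm_diff p q omega ups T Kc <= B%:E)%E.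
    by rewrite bE lee_fin /B lerDl ltW.
  by move=> /(opnorm_leP cD q p1); apply.
have [r [/andP[r0 r1] Hr]] := kernel_estimate cD p1 pq A0 HL upsD sphi spsi bT cK B0 HB.
have E0 : 0 <= c1 * B by rewrite mulr_ge0 // ltW.
have [K' cK' HK'] : exists2 K', compact_op p q omega ups K' &
    forall f, Ap_ball omega p f -> (Lqnorm q ups (fun x => T0 f x - K' f x)%R <= (X * (c1 * B) + B)%:E)%E.
  apply: (wcomp_approx cD p1 q1 upsD sphi au0 u0L r0 r1 B0 (mulr_ge0 X0 E0)) => f fb.
  have := carleson_tail cD p1 pq A0 upsD sphi au0 u0L K0 Nn HK E0 Hr fb.
  by rewrite [(X * _) `^ q]powRM // Xq.
have XE : X * (c1 * B) + B = k * B by rewrite /k; ring.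
rewrite XE in HK'.
have h0 : (ess_norm p q omega ups T0 <= (k * B)%:E)%E by exact: (ess_le cD p1 cK' HK').
have h1 : (ess_norm p q omega ups T1 <= (B + k * B)%:E)%E.
  (* T1 - (Kc - K') = (T - Kc) - (T0 - K'). *)
  apply: (ess_le cD p1 (compact_addZ q1 upsD (-1) cK cK')) => f fb.
  have fA := ball_in_Ap cD p1 fb.
  have mK : cmeas (@discR R) (Kc f) by case: cK => _ /(_ _ fA) /cmeasurable_disc.
  have mK' : cmeas (@discR R) (K' f) by case: cK' => _ /(_ _ fA) /cmeasurable_disc.
  rewrite (@Lq_eq _ _ _ upsD _ (fun x => (T f x - Kc f x) - (T0 f x - K' f x))); last first.
    by move=> x _; rewrite /T /op_add; ring.
  apply: le_trans (Lq_triangleB q1 upsD (cmeasD (mT _ fb) (cmeasN mK)) (cmeasD (mT0 _ fb) (cmeasN mK'))) _.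
  by rewrite EFinD; apply: leeD; [exact: HB|exact: HK'].
have ci : (0 <= ((1 + 2 * k)^-1)%:E)%E by rewrite lee_fin invr_ge0 ltW.
apply: le_trans (lee_wpmul2l ci (leeD h0 h1)) _.
rewrite -EFinD -EFinM lee_fin ler_pdivrMl // le_eqVlt; apply/orP; left; apply/eqP; ring.
Qed.
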